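(* Let $1\le i\le n$, let $w\in W^i$ and let $m\ge 0$ be an integer. Let $I\subset S(\mathfrak n^-_w)$ be the ideal with $(U(\mathfrak n_w^-).v_m)^a\cong S(\mathfrak n_w^-)/I$. Then: \begin{enumerate} \item $\{f^{\mathbf s}.v_m \mid \mathbf s\in m\mathcal C_{\underline\ell_w}\cap\mathbb Z^N\}$ is a basis of $(U(\mathfrak n_w^-).v_m)^a$. \item $I$ is generated, as an ideal of $S(\mathfrak n_w^-)$, by $\big(U(\mathfrak n^+).\{f_\alpha^{m+1}\mid \alpha\in R_w^-\}\big)\cap S(\mathfrak n^-_w)$. \item $\{w(f^{\mathbf s}).v_{w(m\omega_i)} \mid \mathbf s\in m\mathcal C_{\underline\ell_w}\cap\mathbb Z^N\}$ is a basis of $V_w(m\omega_i)^a$. \item If $\tau\in W^i$ and $w\le\tau$ in the Bruhat order, then $m\mathcal C_{\underline\ell_w}$ is a face of $m\mathcal C_{\underline\ell_\tau}$. \item If $w_0$ denotes the minimal length representative in $W^i$ of the class of the longest element of $W$, then $m\mathcal C_{\underline\ell_{w_0}}=P(m\omega_i)$. \end{enumerate}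
   Context: Lie algebra notation. $\mathfrak{sl}_{n+1}(\mathbb C)=\mathfrak n^+\oplus\mathfrak h\oplus\mathfrak n^-$ is the standard triangular decomposition, $\mathfrak b=\mathfrak h\oplus\mathfrak n^+$, $R$ (resp. $R^+$, $R^-$) the set of (positive, negative) roots, $\alpha_{k,j}=\alpha_k+\dots+\alpha_j$ ($1\le k\le j\le n$) the positive roots, $e_\alpha,f_\alpha$ ($\alpha\in R^+$) root vectors of roots $\alpha,-\alpha$, belonging to $\mathfrak{sl}_2$-triples. $\omega_i$ is the $i$-th fundamental weight, $V(m\omega_i)$ the simple module of highest weight $m\omega_i$, $v_m$ a highest weight vector. $W=S_{n+1}$ is the Weyl group, $W^i=W/\mathrm{Stab}_W(\omega_i)=S_{n+1}/(S_i\times S_{n+1-i})$; each coset is identified with its representative of minimal length. For $w\in W^i$: $R_w^-=w^{-1}(R^-)\cap R^+$, $\mathfrak n_w^-=\langle f_\alpha\mid\alpha\in R_w^-\rangle$, $N=|R_w^-|$ (the length of $w$). For $1\le k\le i$ put $\ell_k=\max\big(\{i-1\}\cup\{j\mid i\le j\le n,\ \alpha_{k,j}\in R_w^-\}\big)$ and $\underline\ell_w=(i-1\le\ell_1\le\dots\le\ell_i\le n)$. One has $R_w^-=\{\alpha_{k,j}\mid 1\le k\le i,\ i\le j\le\ell_k\}$. Poset and chain polytope. For a sequence of integers $\underline\ell=(i-1\le\ell_1\le\dots\le\ell_i\le n)$, $\mathcal P_{\underline\ell}$ is the poset with elements $x_{k,j}$, $1\le k\le i$, $i\le j\le\ell_k$,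 and $x_{k_1,j_1}\ge x_{k_2,j_2}$ iff $k_1\le k_2$ and $j_1\ge j_2$. With $N=|\mathcal P_{\underline\ell}|$, $$m\mathcal C_{\underline\ell}=\Big\{(s_{k,j})\in\mathbb R_{\ge0}^N \,\Big|\, \textstyle\sum_p s_{k_p,j_p}\le m\text{ for all chains }x_{k_1,j_1}>\dots>x_{k_s,j_s}\text{ in }\mathcal P_{\underline\ell}\Big\}.$$ The coordinate $s_{k,j}$ is also written $s_\alpha$ with $\alpha=\alpha_{k,j}$; coordinates are thus indexed by $R_w^-$ when $\underline\ell=\underline\ell_w$. For $w\le\tau$ one has $R_w^-\subset R_\tau^-$, and $\mathbb R^{R_w^-}$ is regarded as the coordinate subspace of $\mathbb R^{R_\tau^-}$ where the remaining coordinates vanish. Modules. For $\mathbf s=(s_\alpha)\in\mathbb Z_{\ge0}^N$ put $f^{\mathbf s}=\prod_{\alpha\in R_w^-}f_\alpha^{s_\alpha}\in S(\mathfrak n_w^-)$. The Demazure module is $V_w(m\omega_i)=U(\mathfrak b).v_{w(m\omega_i)}\subset V(m\omega_i)$, where $v_{w(m\omega_i)}$ spans the one-dimensional weight space of weight $w(m\omega_i)$. For a finite-dimensional Lie algebra $\mathfrak u$ the PBW filtration is $U(\mathfrak u)_s=\langle x_1\cdots x_r\mid x_j\in\mathfrak u,\ r\le s\rangle$; for a cyclic module $M=U(\mathfrak u).v$ put $M_s=U(\mathfrak u)_s.v$, and let $M^a$ be the associated graded space, a cyclic $S(\mathfrak u)$-module. This defines $(U(\mathfrak n_w^-).v_m)^a$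 (with $\mathfrak u=\mathfrak n_w^-$) and $V_w(m\omega_i)^a$ (with $\mathfrak u=\mathfrak b$). The Weyl group acts on root vectors (through lifts of its elements): $w(f^{\mathbf s})=\prod_{\alpha\in R_w^-}w(f_\alpha)^{s_\alpha}\in S(\mathfrak n^+)$, where $w(f_\alpha)$ is a nonzero root vector of the positive root $-w(\alpha)$. $\mathfrak n^+$ acts on $S(\mathfrak n^-)$ by derivations extending the action on $\mathfrak n^-\cong\mathfrak{sl}_{n+1}/(\mathfrak h\oplus\mathfrak n^+)$ induced by the adjoint action; thus, up to nonzero scalars, $e_\alpha.f_\beta=f_{\beta-\alpha}$ if $\beta-\alpha\in R^+$ and $e_\alpha.f_\beta=0$ otherwise. $U(\mathfrak n^+).\{\ldots\}$ denotes the $\mathfrak n^+$-submodule of $S(\mathfrak n^-)$ generated by the given set. $P(m\omega_i)$ is the polytope of Backhaus–Desczyk in type $A_n$: the points $(s_\alpha)\in\mathbb R_{\ge0}^{N}$, indexed by the positive roots $\alpha_{k,j}$ with $k\le i\le j$, such that $\sum_{\alpha\in p}s_\alpha\le m$ for every directed path $p$ in the Hasse diagram of this set of roots (edges join two roots differing by a simple root, directed from the larger to the smaller root). *)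

(* Defs.v *)
From HB Require Import structures.
From mathcomp Require Import all_boot all_order all_algebra all_fingroup.
From mathcomp Require Import complex reals.
From mathcomp Require Import mpoly.

Set Implicit Arguments.
Unset Strict Implicit.
Unset Printing Implicit Defensive.

Import Order.TTheory GRing.Theory Num.Theory.
Local Open Scope ring_scope.

Section Quotient.
Variables (K : fieldType) (W : vectType K).

(* The quotient space W / B, carried by the complement B^C of B; only the     *)
(* canonical map quot_pi matters, it is onto with kernel B.                   *)
Definition quot (B : {vspace W}) := subvs_of (B^C)%VS.

Definition quot_pi (B : {vspace W}) : 'Hom(W, quot B) :=
  (linfun (vsproj (B^C)%VS) \o daddv_pi (B^C)%VS B)%VF.

Lemma quot_capv B : (B^C :&: B = 0 :> {vspace W})%VS.
Proof. by rewrite capvC capv_compl. Qed.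

Lemma quot_pi_val B x : vsval (quot_pi B x) = daddv_pi (B^C)%VS B x.
Proof. by rewrite comp_lfunE lfunE /= vsprojK // memv_pi. Qed.

Lemma quot_piK B : cancel vsval (quot_pi B).
Proof.
move=> y; apply: val_inj.
by rewrite [LHS]quot_pi_val daddv_pi_id ?quot_capv ?subvsP.
Qed.

Lemma quot_pi_eq0 B x : (quot_pi B x == 0) = (x \in B).
Proof.
have dec : daddv_pi (B^C)%VS B x + daddv_pi B (B^C)%VS x = x.
  by rewrite daddv_pi_add ?quot_capv // addvC addv_complf memvf.
rewrite -(inj_eq val_inj) [val _]quot_pi_val linear0.
apply/eqP/idP => [e | xB].
  by rewrite -dec e add0r memv_pi.
apply/eqP; rewrite -memv0 -(quot_capv B) memv_cap memv_pi /=.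
rewrite (_ : daddv_pi _ _ _ = x - daddv_pi B (B^C)%VS x); last first.
  by rewrite -{2}dec addrK.
by rewrite memvB ?memv_pi.
Qed.

End Quotient.

Section Graded.
Variables (K : fieldType) (V : vectType K).
Implicit Types (F : nat -> {vspace V}) (T : 'End(V)).

Definition dsum_inj (N : nat) (r : 'I_N) (x : V) : {ffun 'I_N -> V} :=
  [ffun s => if s == r then x else 0].

Fact dsum_inj_linear N (r : 'I_N) : linear (dsum_inj r).
Proof.
move=> a x y; apply/ffunP=> s; rewrite !ffunE.
by case: eqP => // _; rewrite scaler0 addr0.
Qed.

HB.instance Definition _ N (r : 'I_N) :=
  GRing.isLinear.Build K V {ffun 'I_N -> V} *:%R (dsum_inj r)
    (dsum_inj_linear r).

Definition dsum (N : nat) (F : nat -> {vspace V}) :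
    {vspace {ffun 'I_N -> V}} :=
  (\sum_(r < N) linfun (dsum_inj r) @: F r)%VS.

Lemma mem_dsum N F (g : {ffun 'I_N -> V}) :
  reflect (forall r, g r \in F r) (g \in dsum N F).
Proof.
apply: (iffP idP) => [|gF].
  case/memv_sumP=> h hP -> r; rewrite sum_ffunE memv_suml // => s _.
  have /memv_imgP[x xF ->] := hP s isT.
  by rewrite lfunE ffunE; case: eqP => [->|_] //; rewrite mem0v.
have -> : g = \sum_r dsum_inj r (g r).
  apply/ffunP=> s; rewrite sum_ffunE (bigD1 s) //= ffunE eqxx big1 ?addr0 //.
  by move=> r /negPf rs; rewrite ffunE eq_sym rs.
apply: memv_sumr => r _; apply/memv_imgP.
by exists (g r); rewrite ?lfunE.
Qed.

(* F (r - 1), with F (-1) = 0 *)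
Definition lower (F : nat -> {vspace V}) (r : nat) : {vspace V} :=
  if r is r'.+1 then F r' else 0%VS.

(* The sum of the F r / F (r - 1) is realized as the quotient of the sum of   *)
(* the F r by the sum of the F (r - 1), for r <= dim V: the filtrations below *)
(* are stationary from dim V on (PBW_stationary).                             *)
Notation degs := (\dim {:V}).+1.

Definition gr_ambient (F : nat -> {vspace V}) := quot (dsum degs (lower F)).

Definition gr (F : nat -> {vspace V}) : {vspace gr_ambient F} :=
  (quot_pi (dsum degs (lower F)) @: dsum degs F)%VS.

(* The class of x \in F r in F r / F (r - 1). *)
Definition gr_class (F : nat -> {vspace V}) (r : 'I_degs) (x : V) :
    gr_ambient F :=
  quot_pi (dsum degs (lower F)) (dsum_inj r x).

(* An operator T with T (F r) <= F (r + 1) acts on gr F with degree 1. *)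
Definition shift (T : 'End(V)) (g : {ffun 'I_degs -> V}) :
    {ffun 'I_degs -> V} :=
  [ffun r : 'I_degs => if r == 0%N :> nat then 0 else T (g (inord r.-1))].

Definition gr_op (F : nat -> {vspace V}) (T : 'End(V)) (y : gr_ambient F) :
    gr_ambient F :=
  quot_pi (dsum degs (lower F)) (shift T (vsval y)).

Lemma gr_class_eq0 F (r : 'I_degs) x :
  (gr_class F r x == 0) = (x \in lower F r).
Proof.
rewrite quot_pi_eq0; apply/mem_dsum/idP => [/(_ r)|xF s].
  by rewrite ffunE eqxx.
by rewrite ffunE; case: eqP => [->|_] //; rewrite mem0v.
Qed.

Lemma gr_op_pi F (T : 'End(V)) (g : {ffun 'I_degs -> V}) :
    (forall r x, x \in F r -> T x \in F r.+1) ->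
  gr_op T (quot_pi (dsum degs (lower F)) g) =
    quot_pi (dsum degs (lower F)) (shift T g).
Proof.
move=> TF; apply/eqP; rewrite /gr_op -subr_eq0 -linearB quot_pi_eq0.
set p := quot_pi _; set d := vsval (p g) - g.
have /mem_dsum dB : d \in dsum degs (lower F).
  by rewrite -quot_pi_eq0 -/p linearB /= quot_piK subrr.
suff -> : shift T (vsval (p g)) - shift T g = shift T d.
  apply/mem_dsum=> -[[|r] ltr]; rewrite ffunE /= ?mem0v //.
  have ltr' : (r < degs)%N by apply: ltnW.
  have := dB (inord r); rewrite inordK //.
  by case: (r) => [|r'] /=; [rewrite memv0 => /eqP->; rewrite linear0 mem0v|
    exact: TF].
apply/ffunP=> r; rewrite !ffunE; case: eqP => _; first by rewrite subrr.
by rewrite linearB.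
Qed.

Lemma gr_op_class F (T : 'End(V)) (r : 'I_degs) (r' : 'I_degs) x :
    (forall r x, x \in F r -> T x \in F r.+1) -> r' = r.+1 :> nat ->
  gr_op T (gr_class F r x) = gr_class F r' (T x).
Proof.
move=> TF rr'; rewrite gr_op_pi //; congr (quot_pi _ _); apply/ffunP=> s.
rewrite !ffunE -(inj_eq val_inj s r') /= rr'.
case: s => -[|s] lts //=; rewrite eqSS -(inj_eq val_inj) /= inordK.
  by case: eqP => // _; rewrite linear0.
exact: ltnW.
Qed.

(* The action of a polynomial p in commuting variables indexed by I, where    *)
(* the variable of index t acts on gr F through the operator T t.             *)
Definition sym_act (F : nat -> {vspace V}) (I : finType) (T : I -> 'End(V))
    (p : {mpoly K[#|I|]}) (y : gr_ambient F) : gr_ambient F :=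
  \sum_(mu <- msupp p) p@_mu *:
    foldr (fun t => iter (mu (enum_rank t)) (gr_op (T t))) y (enum I).

End Graded.

Definition is_basis_family (K : fieldType) (W : vectType K) (T : eqType)
    (P : T -> Prop) (x : T -> W) (U : {vspace W}) : Prop :=
  exists X : seq T, [/\ uniq X, forall t, t \in X <-> P t
                      & basis_of U [seq x t | t <- X]].

(* The pair (a, b) stands for eps_a - eps_b, with 0-based a < b; hence        *)
(* alpha_{k,j} = eps_k - eps_{j+1} (1-based) is the pair (k - 1, j).          *)
Definition posroot (n : nat) : predArgType :=
  {p : 'I_n.+1 * 'I_n.+1 | (p.1 < p.2)%N}.

HB.instance Definition _ n := Finite.on (posroot n).

Section TypeA.
Variable n : nat.
Implicit Types (al be : posroot n) (w : 'S_n.+1).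

Definition rk al : nat := (val al).1.+1.
Definition rj al : nat := (val al).2.

(* w acts by eps_a |-> eps_(w a) *)
Definition Rminus w : {set posroot n} :=
  [set al | (w (val al).2 < w (val al).1)%N].

(* For a permutation this number is the Coxeter length. *)
Definition weyl_length w : nat := #|Rminus w|.

Definition stab_omega (i : nat) : {set 'S_n.+1} :=
  [set u : 'S_n.+1 | [forall a, (u a < i)%N == (a < i)%N]].

(* In MathComp (u * w) a = w (u a), so that u * w runs over the left coset    *)
(* w.Stab(omega_i) of the usual convention.                                   *)
Definition Wmin (i : nat) : {set 'S_n.+1} :=
  [set w | [forall u in stab_omega i, weyl_length w <= weyl_length (u * w)%g]%N].

Definition bruhat_step : rel 'S_n.+1 := fun u w =>
  [exists a, [exists b, w == (u * tperm a b)%g]] &&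
  (weyl_length u < weyl_length w)%N.

Definition bruhat_le : rel 'S_n.+1 := connect bruhat_step.

Definition is_longest w : bool := [forall u, weyl_length u <= weyl_length w]%N.

Definition same_coset (i : nat) : rel 'S_n.+1 := fun u w =>
  [exists s in stab_omega i, u == (s * w)%g].

Definition ell (i : nat) w (k : nat) : nat :=
  maxn i.-1
    (\max_(al in Rminus w | (rk al == k) && (i <= rj al)%N) rj al).

(* All polytopes live in the real vector space with coordinates indexed by    *)
(* the positive roots; a coordinate subspace is the set of the points that    *)
(* vanish at the remaining coordinates.                                       *)

Definition in_poset (i : nat) (l : nat -> nat) al : bool :=
  (rk al <= i)%N && (i <= rj al <= l (rk al))%N.

Definition poset_ge : rel (posroot n) := fun al be =>
  (rk al <= rk be)%N && (rj be <= rj al)%N.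

Definition poset_gt : rel (posroot n) := fun al be =>
  (al != be) && poset_ge al be.

Definition root_vec al : 'rV[int]_n.+1 :=
  delta_mx 0 (val al).1 - delta_mx 0 (val al).2.

Definition is_simple al : bool := rk al == rj al.

(* The edges alpha -> alpha - (simple root) of the Hasse diagram. *)
Definition hasse_edge : rel (posroot n) := fun al be =>
  [exists ga, is_simple ga && (root_vec al - root_vec be == root_vec ga)].

Section Polytopes.
Variable R : realType.

Definition chain_polytope (m i : nat) (l : nat -> nat)
    (s : {ffun posroot n -> R}) : Prop :=
  [/\ forall al, 0 <= s al,
      forall al, ~~ in_poset i l al -> s al = 0
    & forall c : seq (posroot n), all (in_poset i l) c -> sorted poset_gt c ->
        \sum_(al <- c) s al <= m%:R].

Definition BD_polytope (m i : nat) (s : {ffun posroot n -> R}) : Prop :=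
  [/\ forall al, 0 <= s al,
      forall al, ~~ (rk al <= i <= rj al)%N -> s al = 0
    & forall p : seq (posroot n), all (fun al => rk al <= i <= rj al)%N p ->
        sorted hasse_edge p -> \sum_(al <- p) s al <= m%:R].

Definition is_face (F P : {ffun posroot n -> R} -> Prop) : Prop :=
  exists (c : {ffun posroot n -> R}) (d : R),
    (forall x, P x -> \sum_al c al * x al <= d) /\
    (forall x, F x <-> P x /\ \sum_al c al * x al = d).

Definition lattice_point (P : {ffun posroot n -> R} -> Prop)
    (s : {ffun posroot n -> nat}) : Prop :=
  P [ffun al => (s al)%:R].

End Polytopes.

Section Lie.
Variable R : realType.
Local Notation C := R[i].
Local Notation M := 'M[C]_n.+1.

Definition lie (x y : M) : M := x *m y - y *m x.

Definition sl : {vspace M} := lker (linfun (mxtrace : M -> C^o)).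

Definition cartan : {vspace M} :=
  (sl :&: <<[seq delta_mx a a | a : 'I_n.+1]>>)%VS.

Definition nplus : {vspace M} :=
  <<[seq delta_mx (val al).1 (val al).2 | al : posroot n]>>%VS.

Definition borel : {vspace M} := (cartan + nplus)%VS.

(* Weights are linear forms on the Cartan subalgebra. *)
Definition root_wt al (h : M) : C :=
  h (val al).1 (val al).1 - h (val al).2 (val al).2.

Definition omega (i : nat) (h : M) : C := \sum_(a < n.+1 | (a < i)%N) h a a.

(* (w mu)(h) = mu (w^-1 h); the matrix w^-1 h has entries h (w a) (w b) *)
Definition weyl_wt w (mu : M -> C) (h : M) : C := mu (mxsub w w h).

Definition negroot_vector al (x : M) : Prop :=
  [/\ x \in sl, x != 0
    & forall h, h \in cartan -> lie h x = - root_wt al h *: x].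

(* g represents w in the normalizer of the torus *)
Definition is_lift (g : M) w : Prop :=
  g \in unitmx /\
  forall h, h \in cartan -> invmx g *m h *m g = mxsub w w h.

Section Modules.
(* A representation of sl is given by a linear map defined on all matrices,   *)
(* of which only the restriction to sl is ever used.                          *)
Variables (V : vectType C) (rho : {linear M -> 'End(V)}).
Implicit Types (u : {vspace M}) (v : V).

Definition is_rep : Prop := forall x y, x \in sl -> y \in sl ->
  forall v, rho (lie x y) v = rho x (rho y v) - rho y (rho x v).

Definition is_simple_module : Prop :=
  (fullv != 0 :> {vspace V})%VS /\
  forall U : {vspace V}, (forall x, x \in sl -> (rho x @: U <= U)%VS) ->
    U = 0%VS \/ U = fullv.

Definition is_weight_vector (mu : M -> C) (v : V) : Prop :=
  v != 0 /\ forall h, h \in cartan -> rho h v = mu h *: v.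

Definition is_highest_weight_vector (mu : M -> C) (v : V) : Prop :=
  is_weight_vector mu v /\ forall x, x \in nplus -> rho x v = 0.

Fixpoint PBW (u : {vspace M}) (v : V) (r : nat) : {vspace V} :=
  if r is r'.+1 then
    (PBW u v r' + \sum_(x <- vbasis u) rho x @: PBW u v r')%VS
  else <[v]>%VS.

Lemma PBW_le u v r r' : (r <= r')%N -> (PBW u v r <= PBW u v r')%VS.
Proof.
move/subnK <-; elim: (r' - r)%N => [|d IH]; rewrite ?subvv // addSn.
exact: subv_trans IH (addvSl _ _).
Qed.

Lemma PBW_act u v r x y :
  x \in u -> y \in PBW u v r -> rho x y \in PBW u v r.+1.
Proof.
move=> xu yM; rewrite (coord_vbasis xu) linear_sum sum_lfunE /=.
apply: memv_suml => t _; rewrite linearZ /= scale_lfunE memvZ //.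
apply: (subvP (addvSr _ _)); rewrite big_tuple.
apply: (subvP (sumv_sup t _ (subvv _))) => //.
by rewrite (tnth_nth 0); apply: memv_img.
Qed.

(* PBW u v r is the span of the x_1 ... x_k v with x_j \in u and k <= r. *)
Lemma PBW_word u v r (s : seq M) : {subset s <= u} -> (size s <= r)%N ->
  foldr (fun x => rho x) v s \in PBW u v r.
Proof.
move=> su sr; apply: (subvP (PBW_le u v sr)).
elim: s su {sr} => [|x s IH] su /=; first exact: memv_line.
apply: PBW_act; first by apply: su; rewrite mem_head.
by apply: IH => y ys; apply: su; rewrite in_cons ys orbT.
Qed.

Lemma PBW_min u v r (U : {vspace V}) :
    (forall s : seq M, {subset s <= u} -> (size s <= r)%N ->
       foldr (fun x => rho x) v s \in U) ->
  (PBW u v r <= U)%VS.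
Proof.
elim: r U => [|r IH] U UP /=.
  by rewrite -memvE; apply: (UP [::]).
rewrite subv_add IH => [/=|s su sr]; last by apply: UP => //; apply: leqW.
rewrite big_seq; elim/big_ind: _ => [|A B AU BU|x /vbasis_mem xu].
- exact: sub0v.
- by rewrite subv_add AU.
apply/subvP => _ /memv_imgP[z zM ->]; rewrite memv_preim.
apply: (subvP (IH _ _)) zM => t tu tr; rewrite -memv_preim.
by apply: (UP (x :: t)) => //= y; rewrite in_cons => /predU1P[->|/tu].
Qed.

Lemma PBW_stationary u v r : (\dim {:V} <= r)%N ->
  PBW u v r = PBW u v (\dim {:V}).
Proof.
have stat a : PBW u v a = PBW u v a.+1 ->
    forall b, (a <= b)%N -> PBW u v b = PBW u v a.
  move=> e b /subnK <-; elim: (b - a)%N => // d IH.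
  by rewrite addSn /= IH [in RHS]e.
have [[a aD e] | ne] : (exists2 a, (a <= \dim {:V})%N
      & PBW u v a = PBW u v a.+1) \/
    (forall a, (a <= \dim {:V})%N -> PBW u v a <> PBW u v a.+1).
- have [/existsP[a /eqP e]|/existsPn ne] :=
      boolP [exists a : 'I_(\dim {:V}).+1, PBW u v a == PBW u v a.+1].
    by left; exists a => //; rewrite -ltnS.
  right=> a aD e; have := ne (Ordinal (aD : (a < _.+1)%N)).
  by rewrite /= [X in X == _]e eqxx.
- by move=> Dr; rewrite (stat _ e _ aD) (stat _ e) // (leq_trans aD).
have dimlt a : (a <= (\dim {:V}).+1)%N -> (a <= \dim (PBW u v a))%N.
  elim: a => // a IH aD; rewrite (leq_ltn_trans (IH (ltnW aD))) //.
  rewrite (ltn_leqif (dimv_leqif_eq (PBW_le u v (leqnSn a)))).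
  by apply/eqP/ne.
by have := leq_trans (dimlt _ (leqnn _)) (dimvS (subvf _)); rewrite ltnn.
Qed.

(* p.v in (U(u).v)^a, the variable of index al of p acting through x al \in u *)
Definition sym_eval (u : {vspace M}) (v : V) (x : posroot n -> M)
    (p : {mpoly C[#|posroot n|]}) : gr_ambient (PBW u v) :=
  sym_act (fun al => rho (x al)) p (gr_class (PBW u v) ord0 v).

End Modules.

(* The symmetric algebra of n^- is the polynomial ring in the root vectors    *)
(* f al, a root vector of root - al for every positive root al.               *)
Section SymmetricAlgebra.
Variable f : posroot n -> M.
Local Notation S := {mpoly C[#|posroot n|]}.
Implicit Types (p q : S) (G : S -> Prop).

Definition nminus_of w : {vspace M} := <<[seq f al | al in Rminus w]>>%VS.

Definition svar al : S := 'X_(enum_rank al).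

Definition fmon w (s : {ffun posroot n -> nat}) : S :=
  \prod_(al in Rminus w) svar al ^+ s al.

Definition in_Sw w p : Prop := forall mu, mu \in msupp p ->
  forall al, al \notin Rminus w -> mu (enum_rank al) = 0%N.

(* The class of y in sl / (h + n^+) = n^-, in terms of the f be: the vector   *)
(* f be is a multiple of the elementary matrix E_(b, a) when be = (a, b).     *)
Definition nminus_class (y : M) : S :=
  \sum_be (y (val be).2 (val be).1 / f be (val be).2 (val be).1) *: svar be.

Definition der (x : M) p : S :=
  \sum_al nminus_class (lie x (f al)) * p^`M(enum_rank al).

(* The n^+-submodule U(n^+).G of S(n^-) generated by G. *)
Inductive nplus_module G : S -> Prop :=
| NplusGen p : G p -> nplus_module G p
| NplusZero : nplus_module G 0
| NplusLin (c : C) p q :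
    nplus_module G p -> nplus_module G q -> nplus_module G (c *: p + q)
| NplusDer x p : x \in nplus -> nplus_module G p -> nplus_module G (der x p).

Definition root_powers w (m : nat) p : Prop :=
  exists2 al, al \in Rminus w & p = svar al ^+ m.+1.

(* The ideal of S(n_w^-) generated by G (meant for G inside S(n_w^-)). *)
Definition ideal_gen w G p : Prop :=
  exists2 s : seq (S * S),
    forall t, t \in s -> in_Sw w t.1 /\ G t.2 & p = \sum_(t <- s) t.1 * t.2.

End SymmetricAlgebra.
End Lie.
End TypeA.

Arguments chain_polytope {n} R m i l s.
Arguments BD_polytope {n} R m i s.
Arguments borel {n R}.
Arguments Wmin {n} i.

(* Main.v *)
From HB Require Import structures.
Require Import Defs.
From mathcomp Require Import all_boot all_order all_algebra all_fingroup.
From mathcomp Require Import complex reals boolp.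
From mathcomp Require Import mpoly.
From mathcomp Require Import zify ring.

Set Implicit Arguments.
Unset Strict Implicit.
Unset Printing Implicit Defensive.

Import Order.TTheory GRing.Theory Num.Theory.
Local Open Scope ring_scope.

(** In the positive roots, written as pairs a < b, only the grid a < i <= b
    matters: the other lowering operators kill the highest weight vector v.
    Let z_(a,b) be the multiple of f_(a,b) that is the elementary matrix
    E_(b,a); the operators of the grid commute. For w in W^i the set R_w^-
    is a part of the grid that contains with a root all smaller ones of the
    grid, because w increases on {a < i} and on {b >= i}.

    Relations. By sl_2-theory z_(a,b)^(m+1) kills v. The derivation of S(n^-)
    defined by x in n^+ is the commutator with the Levi part of x, which kills
    v (pact_lie), so the whole n^+-module generated by these powers kills v
    (nplus_module_null). It contains all permanents
      sum over pi of the products of the z_(A k, B (pi k)), k = 0, ..., m,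
    with rows a <= A k < i and columns i <= B k <= b (perm_poly_nplus). If the exponents
    of a monomial violate a chain inequality, m + 1 of its factors lie on a
    chain. The permanent of their rows and columns rewrites the product of
    these factors into products with the same rows and columns, whose tables
    of exponents have larger corner sums, by a counting argument
    (table_perm_lt). As the corner sums are bounded, iteration expresses every
    element of S(n_w^-), modulo the ideal of relations, by the monomials of
    lattice points of the chain polytope (straighten).

    Independence. These monomials applied to v are independent. To see this,
    V is compared with the tensor product of m copies of the i-th exterior
    power of C^(n+1): a relation homogeneous in the lowering operators that
    holds for v holds for the highest weight vector of that space too, since
    raising operators bring it to a multiple of the pair of highest weight
    vectors with vanishing first component, and raising is adjoint to lowering
    for a positive definite form (transfer). A lattice point s is a sum of m
    antichains (antichain_decomposition). Read as a state of the m tensor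
    factors, they define a basis tensor that occurs in the monomial of s, and
    in the monomials of other exponents only if these have a smaller corner
    sum (fword_lead, fword_lead_neq0). So evaluation at the state of a term of
    smallest corner sum refutes a nontrivial relation (normal_indep).

    Grading. The length of a word in the lowering operators of the grid is
    visible in the eigenvalue of the sum of the E_(a,a), a < i. Hence the
    module is graded by word length already and nothing is lost on passing to
    the associated graded space (ev_eq0). This gives the basis
    (monomial_basis) and the ideal (relations).

    Demazure modules. Twist the representation by conjugation with the lift g
    of w. The extremal vector is a highest weight vector of the twisted
    representation because the entries of all weights lie in [0, m]
    (twist_hw). The algebra b becomes w^-1(b), which contains n_w^-, and its
    other root vectors preserve the filtration given by n_w^- (F_stable), so
    both filtrations agree (PBW_twist), and the basis is an instance of the
    first one applied to the twisted representation (demazure_basis).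

    Polytopes. If w <= tau, the set R_w^- is contained in R_tau^-, by counting
    large values in the first i positions (Rminus_bruhat), so one polytope is
    cut out from the other one by coordinate hyperplanes
    (chain_polytope_face). For the longest element R_w^- is the whole grid
    (Rminus_longest), and every chain of the grid can be refined to a path in
    the Hasse diagram (hasse_refine_chain). *)

(** * Inversions and minimal coset representatives *)

Section Weyl.
Variable n : nat.
Implicit Types (u w tau : 'S_n.+1) (al be : posroot n).

Lemma posrootP al : ((val al).1 < (val al).2)%N.
Proof. exact: valP al. Qed.

Definition mkroot (a b : 'I_n.+1) (h : (a < b)%N) : posroot n :=
  exist (fun p : 'I_n.+1 * 'I_n.+1 => (p.1 < p.2)%N) (a, b) h.

Definition inversions u : {set 'I_n.+1 * 'I_n.+1} :=
  [set p : 'I_n.+1 * 'I_n.+1 | (p.1 < p.2)%N && (u p.2 < u p.1)%N].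

Lemma weyl_lengthE u : weyl_length u = #|inversions u|.
Proof.
rewrite /weyl_length -(card_imset _ val_inj); congr #|pred_of_set _|.
apply/setP=> p; rewrite inE; apply/imsetP/andP => [[al] | [h1 h2]].
  by rewrite inE => h ->; rewrite posrootP.
by exists (mkroot h1); rewrite ?inE //=; case: p h1 h2.
Qed.

(** Composing with the transposition of the two positions of an inversion
    (x, y) shortens a permutation: an inversion (p, q) of the product goes to
    the inversion of the original one at the transposed positions if these
    are still in increasing order, and to (p, q) otherwise; (x, y) is not
    reached. *)
Lemma weyl_length_swap u (x y : 'I_n.+1) : (x < y)%N -> (u y < u x)%N ->
  (weyl_length (tperm x y * u)%g < weyl_length u)%N.
Proof.
move=> xy uyx; rewrite !weyl_lengthE; set t := tperm x y.
pose h (p : 'I_n.+1 * 'I_n.+1) :=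
  if (t p.1 < t p.2)%N then (t p.1, t p.2) else p.
have tK z : t (t z) = z by rewrite tpermK.
have h_inj : {in inversions (t * u)%g &, injective h}.
  move=> [p q] [p' q']; rewrite !inE /= => /andP[pq _] /andP[pq' _].
  rewrite /h /=; case: ifP => c; case: ifP => c' [] e1 e2.
  - by rewrite -(tK p) -(tK q) e1 e2 !tK.
  - by move: c'; rewrite -e1 -e2 !tK pq.
  - by move: c; rewrite e1 e2 !tK pq'.
  - by rewrite e1 e2.
rewrite -(card_in_imset h_inj).
have xyu : (x, y) \in inversions u by rewrite inE /= xy.
rewrite [ltnRHS](cardsD1 (x, y)) xyu add1n ltnS.
apply/subset_leq_card/subsetP => _ /imsetP[[p q] + ->].
rewrite !inE /= !permM -/t /h /= => /andP[pq upq].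
case: ifP => c /=.
  rewrite c upq xpair_eqE !andbT; apply/negP => /andP[/eqP e1 /eqP e2].
  by move: pq; rewrite -(tK p) -(tK q) e1 e2 /t tpermL tpermR; lia.
rewrite pq xpair_eqE /=.
move: upq c; rewrite /t; case: (tpermP x y p) => [e1|e1|/eqP e1 /eqP f1];
  case: (tpermP x y q) => [e2|e2|/eqP e2 /eqP f2]; subst; rewrite ?eqxx /=;
  try lia.
Qed.

(** The transposition of two positions of the same block lies in the
    stabilizer of omega_i, so an inversion inside a block could be removed
    without leaving the coset. *)
Lemma Wmin_incr i w (a b : 'I_n.+1) : w \in Wmin i -> (a < b)%N ->
  ((a < i) == (b < i))%N -> (w a < w b)%N.
Proof.
rewrite inE => /forall_inP wmin ab /eqP abi; rewrite ltnNge; apply/negP => wba.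
have wba' : (w b < w a)%N.
  rewrite ltn_neqAle wba andbT; apply/eqP => /val_inj/perm_inj e.
  by rewrite e ltnn in ab.
have /wmin : tperm a b \in stab_omega n i.
  rewrite inE; apply/forallP => c.
  by case: (tpermP a b c) => [->|->|] //; rewrite abi.
by rewrite leqNgt weyl_length_swap.
Qed.

(** The roots of the abelian nilradical opposite to the maximal parabolic
    subalgebra of omega_i: the vectors f_alpha of the others kill v_m. *)
Definition grid i al : bool := ((val al).1 < i <= (val al).2)%N.

Lemma Rminus_grid i w al : w \in Wmin i -> al \in Rminus w -> grid i al.
Proof.
move=> wm; rewrite inE => wal; have lt := posrootP al.
case e : (((val al).1 < i)%N == ((val al).2 < i)%N).
  by have := Wmin_incr wm lt e; rewrite ltnNge (ltnW wal).
by rewrite /grid; lia.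
Qed.

Lemma Rminus_closed i w al be : w \in Wmin i -> grid i be ->
  al \in Rminus w -> poset_ge al be -> be \in Rminus w.
Proof.
move=> wm gb aw /andP[]; rewrite /rk /rj ltnS => ab1 ab2.
have ga := Rminus_grid wm aw; move: aw ga gb; rewrite !inE /grid => aw ga gb.
have h1 : (w (val al).1 <= w (val be).1)%N.
  move: ab1; rewrite leq_eqVlt => /orP[/eqP/val_inj-> //|ab1].
  by apply: ltnW; apply: Wmin_incr wm ab1 _; lia.
have h2 : (w (val be).2 <= w (val al).2)%N.
  move: ab2; rewrite leq_eqVlt => /orP[/eqP/val_inj-> //|ab2].
  by apply: ltnW; apply: Wmin_incr wm ab2 _; lia.
exact: leq_ltn_trans h2 (leq_trans aw h1).
Qed.

(** A root of the grid belongs to R_w^- once a root of R_w^- in its row has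
    at least its column, so the maxima ell determine R_w^-. *)
Lemma in_poset_Rminus i w al : (0 < i)%N -> w \in Wmin i ->
  in_poset i (ell i w) al = (al \in Rminus w).
Proof.
move=> i0 wm; apply/idP/idP; last first.
  move=> aw; have := Rminus_grid wm aw; rewrite /grid /in_poset /rk /rj => ga.
  apply/andP; split; first by lia.
  apply/andP; split; first by lia.
  rewrite /ell leq_max; apply/orP; right.
  apply: (leq_bigmax_cond (F := fun al0 => @rj n al0)).
  by rewrite aw /rk /rj eqxx; case/andP: ga.
rewrite /in_poset => /and3P[k1 k2]; rewrite /ell leq_max.
have -> /= : (rj al <= i.-1)%N = false by lia.
have [[be /and3P[bw /eqP bk bi] e]|ne] := pselect (exists2 be : posroot n,
    [&& be \in Rminus w, rk be == rk al & (i <= rj be)%N] & (rj al <= rj be)%N).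
  move=> _; apply: (Rminus_closed wm _ bw); last by rewrite /poset_ge /= bk leqnn e.
  by move: k1 k2; rewrite /grid /rk /rj => -> ->.
suff : (\max_(be in Rminus w | (rk be == rk al) && (i <= rj be)%N) rj be
          <= (rj al).-1)%N.
  by move=> h1 h2; have := leq_trans h2 h1; lia.
apply/bigmax_leqP => be h; rewrite leqNgt; apply/negP => h'; apply: ne.
by exists be => //; lia.
Qed.

(** * Bruhat order *)

Definition above (D : pred 'I_n.+1) w (p : nat) : nat :=
  #|[set a : 'I_n.+1 | D a && (p <= w a)%N]|.

Lemma bruhat_step_swap u w : bruhat_step u w ->
  exists x y : 'I_n.+1, [/\ (x < y)%N, (u x < u y)%N & w = (tperm x y * u)%g].
Proof.
move=> /andP[/existsP[a /existsP[b /eqP ->]]].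
pose x := (u^-1)%g a; pose y := (u^-1)%g b.
have -> : (u * tperm a b = tperm x y * u)%g.
  have : ((tperm x y) ^ u = tperm a b)%g by rewrite tpermJ !permKV.
  by rewrite conjgE => <-; rewrite !mulgA mulgV mul1g.
wlog xy : {a b} x y / (x < y)%N => [th|] lt.
  case: (ltngtP x y) => [xy|xy|/val_inj xy]; first exact: th.
    by move: lt; rewrite (tpermC x y) => lt; exact: th.
  by move: lt; rewrite xy tperm1 mul1g ltnn.
exists x, y; split => //; rewrite ltnNge; apply/negP => uyx.
have : (u y < u x)%N.
  rewrite ltn_neqAle uyx andbT; apply/eqP => /val_inj/perm_inj e.
  by rewrite e ltnn in xy.
by move=> /(weyl_length_swap xy); rewrite ltnNge (ltnW lt).
Qed.

(** A Bruhat step exchanges two values such that the larger one moves to the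
    left, so large values can only enter the first i positions. *)
Lemma above_bruhat i u w p : bruhat_le u w ->
  (above (fun a => a < i)%N u p <= above (fun a => a < i)%N w p)%N.
Proof.
move=> /connectP[s + ->]; elim: s u => //= u' s IH u /andP[st] /IH.
apply: leq_trans; have [x [y [xy uxy ->]]] := bruhat_step_swap st.
have [yi|iy] := ltnP y i.
  rewrite /above -[leqLHS](card_imset _ (@perm_inj _ (tperm x y))).
  apply/subset_leq_card/subsetP => _ /imsetP[a + ->].
  rewrite !inE permM tpermK => /andP[ai ->]; rewrite andbT.
  by case: tpermP => // _; lia.
apply/subset_leq_card/subsetP => a; rewrite !inE permM => /andP[ai pa].
rewrite ai; case: tpermP pa => [->|e|//]; first by lia.
by rewrite e in ai; lia.
Qed.

Lemma above_compl (D : pred 'I_n.+1) w p :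
  (above D w p + above (predC D) w p = #|[set a : 'I_n.+1 | p <= a]|)%N.
Proof.
rewrite -(card_imset _ (@perm_inj _ w^-1%g)) -(cardsID [set a | D a]).
congr (_ + _)%N; apply: eq_card => a; rewrite !inE; apply/andP/andP => [[h1 h2]|].
- split=> //; apply/imsetP; exists (w a); rewrite ?inE ?permK //.
- by move=> [/imsetP[c + ->] h]; rewrite inE permKV.
- split=> //; apply/imsetP; exists (w a); rewrite ?inE ?permK //.
- by move=> [h /imsetP[c + e]]; rewrite inE e permKV => ->; rewrite -e.
Qed.

(** The positions of D with value at least p are the last ones of D. *)
Lemma above_incr (D : pred 'I_n.+1) w (a : 'I_n.+1) p :
    {in D &, {homo w : x y / (x < y)%N}} -> D a ->
  (p <= w a)%N = (#|[set c : 'I_n.+1 | D c && (a <= c)%N]| <= above D w p)%N.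
Proof.
move=> inc Da; apply/idP/idP => [pa|].
  apply/subset_leq_card/subsetP => c; rewrite !inE => /andP[Dc].
  rewrite Dc leq_eqVlt => /orP[/eqP/val_inj <- //|ac].
  by apply: leq_trans pa (ltnW _); apply: inc.
apply: contraLR; rewrite -!ltnNge => wap.
apply/proper_card/properP; split.
  apply/subsetP => c; rewrite !inE => /andP[Dc pc]; rewrite Dc /= leqNgt.
  by apply/negP => ca; have := inc _ _ Dc Da ca; lia.
by exists a; rewrite !inE Da ?leqnn //= -ltnNge.
Qed.

(** Going up in the Bruhat order increases the values on {a < i} and decreases
    those on {b >= i}: on a block these values are determined by the numbers
    of values at least p, for all p. *)
Lemma Rminus_bruhat i w tau : w \in Wmin i -> tau \in Wmin i ->
  bruhat_le w tau -> Rminus w \subset Rminus tau.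
Proof.
move=> wm tm wt; apply/subsetP => al aw.
have /andP[ai ib] := Rminus_grid wm aw; move: aw; rewrite !inE => aw.
pose L := (fun a : 'I_n.+1 => a < i)%N.
have incL u : u \in Wmin i -> {in L &, {homo u : x y / (x < y)%N}}.
  move=> um x y xi yi /(Wmin_incr um); apply.
  by rewrite -[(x < i)%N]/(x \in L) -[(y < i)%N]/(y \in L) xi yi.
have incH u : u \in Wmin i -> {in predC L &, {homo u : x y / (x < y)%N}}.
  move=> um x y /negbTE xi /negbTE yi /(Wmin_incr um); apply.
  by rewrite -[(x < i)%N]/(L x) -[(y < i)%N]/(L y) xi yi.
have h1 : (w (val al).1 <= tau (val al).1)%N.
  rewrite (above_incr _ (incL _ tm)) //.
  by apply: leq_trans (above_bruhat _ _ wt); rewrite -(above_incr _ (incL _ wm)).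
have h2 : (tau (val al).2 <= w (val al).2)%N.
  have Hb : predC L (val al).2 by rewrite /L /= -leqNgt.
  rewrite (above_incr _ (incH _ wm)) //.
  suff h : (above (predC L) tau (tau (val al).2)
             <= above (predC L) w (tau (val al).2))%N.
    by apply: leq_trans h; rewrite -(above_incr _ (incH _ tm)).
  rewrite -(leq_add2l (above L w (tau (val al).2))) above_compl.
  by rewrite -(above_compl L tau) leq_add2r; apply: above_bruhat.
exact: leq_ltn_trans h2 (leq_trans aw h1).
Qed.

Lemma Rminus_longest i (w0 wl : 'S_n.+1) : is_longest wl ->
  same_coset i w0 wl -> forall al, grid i al -> al \in Rminus w0.
Proof.
move=> lw /exists_inP[s + /eqP ->] al /andP[ai ib].
rewrite inE => /forallP st.
have full : Rminus wl = setT.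
  apply/eqP; rewrite eqEcard subsetT /=.
  have /forallP/(_ (perm (@rev_ord_inj n.+1))) := lw.
  rewrite {1}/weyl_length (_ : Rminus _ = setT) //.
  apply/setP => be; rewrite !inE !permE /=; have := posrootP be.
  by move: (ltn_ord (val be).1) (ltn_ord (val be).2); move: (val be).1 (val be).2 => a b; lia.
rewrite inE !permM.
have /eqP e1 := st (val al).1; have /eqP e2 := st (val al).2.
have lt : (s (val al).1 < s (val al).2)%N.
  by rewrite (leq_trans (_ : _ < i)%N) ?e1 // leqNgt e2 -leqNgt.
have : mkroot lt \in Rminus wl by rewrite full inE.
by rewrite inE.
Qed.

End Weyl.

(** * Faces of chain polytopes *)

Section Chains.
Variable n : nat.
Implicit Types (u w tau : 'S_n.+1) (al be : posroot n).

Lemma posrootI al be :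
  (val al).1 = (val be).1 -> (val al).2 = (val be).2 -> al = be.
Proof.
by move=> e1 e2; apply/val_inj; case: (val al) (val be) e1 e2 => ? ? [? ?] /= -> ->.
Qed.

Lemma poset_geE al be : poset_ge al be =
  ((val al).1 <= (val be).1)%N && ((val be).2 <= (val al).2)%N.
Proof. by []. Qed.

Lemma poset_ge_trans : transitive (@poset_ge n).
Proof.
move=> be al ga; rewrite !poset_geE => /andP[a1 a2] /andP[b1 b2].
by rewrite (leq_trans a1 b1) (leq_trans b2 a2).
Qed.

Lemma poset_ge_anti : antisymmetric (@poset_ge n).
Proof.
move=> al be; rewrite !poset_geE => /andP[/andP[a1 a2] /andP[b1 b2]].
by apply: posrootI; apply/val_inj/eqP; rewrite eqn_leq ?a1 ?a2 ?b1 ?b2.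
Qed.

Lemma poset_gt_trans : transitive (@poset_gt n).
Proof.
move=> be al ga /andP[n1 g1] /andP[n2 g2]; apply/andP; split.
  apply/eqP => e; subst ga; case/negP: n1; apply/eqP/poset_ge_anti.
  by rewrite g1 g2.
exact: poset_ge_trans g1 g2.
Qed.

Section Face.
Variable R : realType.

Lemma sum_chain_filter (s : {ffun posroot n -> R}) (P : pred (posroot n)) c :
  (forall al, ~~ P al -> s al = 0) ->
  \sum_(al <- c) s al = \sum_(al <- filter P c) s al.
Proof.
move=> s0; rewrite big_filter [RHS]big_mkcond; apply: eq_bigr => al _.
by case: ifP => // /negbT/s0.
Qed.

(** The supporting functional is minus the sum of the coordinates outside of
    R_w^-. *)
Lemma chain_polytope_face m i w tau : (0 < i)%N -> w \in Wmin i ->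
  tau \in Wmin i -> Rminus w \subset Rminus tau ->
  is_face (n := n) (chain_polytope R m i (ell i w)) (chain_polytope R m i (ell i tau)).
Proof.
move=> i0 wm tm /subsetP wt.
exists [ffun al => - (al \notin Rminus w)%:R], 0; split=> [x [x0 _ _]|x].
  apply: sumr_le0 => al _; rewrite ffunE mulNr oppr_le0 mulr_ge0 ?ler0n //.
split=> [[x0 xw ch]|[[x0 xt ch] /eqP]].
  have xw' al : ~~ (al \in Rminus w) -> x al = 0.
    by move=> aw; apply: xw; rewrite in_poset_Rminus.
  split; last first.
    apply: big1 => al _; rewrite ffunE; case: (boolP (al \in Rminus w)) => aw.
      by rewrite oppr0 mul0r.
    by rewrite xw' ?mulr0.
  split=> // [al|c _ sc].
    rewrite in_poset_Rminus // => at'; apply: xw'.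
    by apply: contra at' => /wt.
  rewrite (sum_chain_filter _ xw'); apply: ch.
    by apply/allP => al; rewrite mem_filter in_poset_Rminus // => /andP[].
  exact: sorted_filter poset_gt_trans _ _ sc.
rewrite -oppr_eq0 -sumrN psumr_eq0; last first.
  by move=> al _; rewrite ffunE mulNr opprK mulr_ge0 ?ler0n.
move=> /allP xw; split=> // [al|c /allP cw sc].
  rewrite in_poset_Rminus // => aw.
  have := xw al (mem_index_enum _); rewrite ffunE aw mulN1r opprK.
  by move/eqP.
apply: ch => //; apply/allP => al /cw.
by rewrite !in_poset_Rminus //; apply: wt.
Qed.

End Face.

(** * Chains and paths in the Hasse diagram *)

Section Paths.
Variables (R : realType) (i : nat).

(* splits the indicators of equalities of natural numbers into cases *)
Ltac split_eq := rewrite ?eqxx; repeat (case: eqVneq => ?); lia.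

(** The difference of alpha_(k,j) and a smaller root is simple only if it is
    alpha_k or alpha_j. *)
Lemma hasse_edgeP al be : hasse_edge al be <->
  ((val al).1.+1 = (val be).1 :> nat /\ (val al).2 = (val be).2) \/
  ((val al).1 = (val be).1 /\ (val al).2 = (val be).2.+1 :> nat).
Proof.
case: al => [[a b] /= ab]; case: be => [[a' b'] /= ab'].
split=> [/existsP[[[c c'] /= cc] /andP[/eqP sg /eqP e]]|].
  rewrite /rk /rj /= in sg.
  have ev x : (x == a :> nat)%:R - (x == b :> nat)%:R
     - ((x == a' :> nat)%:R - (x == b' :> nat)%:R)
     = (x == c :> nat)%:R - (x == c' :> nat)%:R :> int.
    case: (ltnP x n.+1) => lx; last first.
      by do ![case: eqP => [h|_]; first by [have := ltn_ord a; have := ltn_ord b;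
        have := ltn_ord a'; have := ltn_ord b'; have := ltn_ord c;
        have := ltn_ord c'; lia]].
    by move/rowP/(_ (Ordinal lx)): e; rewrite !mxE !eqxx -!val_eqE.
  have [e1|n1] := eqVneq (a : nat) a'.
    right; split; first exact/val_inj.
    have cb : c = b' :> nat by move: (ev c); split_eq.
    have cb' : c' = b :> nat by move: (ev c'); split_eq.
    by rewrite -cb -cb'.
  left; have ca : a = c :> nat by move: (ev a); split_eq.
  have ca' : a' = c' :> nat by move: (ev a'); split_eq.
  split; first by rewrite ca ca'.
  have nb : a' <> b :> nat by move=> nb; move: (ev a'); split_eq.
  by apply/val_inj => /=; move: (ev b); split_eq.
case=> /= -[e1 e2].
  have lt : (a < a')%N by rewrite -e1.
  apply/existsP; exists (mkroot lt); rewrite /is_simple /rk /rj /= e1 eqxx /=.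
  by apply/eqP; rewrite /root_vec /= e2 opprB addrA subrK.
have lt : (b' < b)%N by rewrite e2.
apply/existsP; exists (mkroot lt); rewrite /is_simple /rk /rj /= e2 eqxx /=.
by apply/eqP; rewrite /root_vec /= e1 opprB addrC addrA subrK.
Qed.

Lemma hasse_edge_gt al be : hasse_edge al be -> poset_gt al be.
Proof.
move=> /hasse_edgeP h; rewrite /poset_gt poset_geE; apply/andP; split.
  by apply/eqP => e; move: h; rewrite e => -[[]|[]]; lia.
by case: h => -[]; [move=> <- ->|move=> -> ->]; rewrite leqnn leqnSn.
Qed.

(** Descend from al to be by lowering first the second index, then raising
    the first one; nonnegativity of s makes the longer sum the larger one. *)
Lemma hasse_refine (s : {ffun posroot n -> R}) al be p :
    (forall ga, 0 <= s ga) -> grid i al -> poset_gt al be ->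
    all (grid i) (be :: p) -> path (@hasse_edge n) be p ->
  exists p', [/\ all (grid i) p', path (@hasse_edge n) al p' &
    \sum_(ga <- be :: p) s ga <= \sum_(ga <- p') s ga].
Proof.
move=> s0 + + gp pp.
move: {2}(_ + _)%N (leqnn ((val be).1 - (val al).1 + ((val al).2 - (val be).2))).
move=> d; elim: d al => [|d IH] al le ga /andP[ne]; rewrite poset_geE => /andP[h1 h2].
  move: le; rewrite leqn0 addn_eq0 !subn_eq0 => /andP[h3 h4].
  case/negP: ne; apply/eqP; apply: posrootI; apply/val_inj/eqP;
    by rewrite eqn_leq ?h1 ?h2 ?h3 ?h4.
have gb : grid i be by case/andP: gp.
have step al' : ((val al).1.+1 = (val al').1 :> nat /\ (val al).2 = (val al').2) \/
    ((val al).1 = (val al').1 /\ (val al).2 = (val al').2.+1 :> nat) ->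
    grid i al' -> ((val al').1 <= (val be).1)%N && ((val be).2 <= (val al').2)%N ->
    ((val be).1 - (val al').1 + ((val al').2 - (val be).2) <= d)%N ->
  exists p', [/\ all (grid i) p', path (@hasse_edge n) al p' &
    \sum_(ga <- be :: p) s ga <= \sum_(ga <- p') s ga].
  move=> /hasse_edgeP e ga' ge le'; have [eab|nab] := eqVneq al' be.
    by exists (be :: p); split=> //=; rewrite -eab e eab.
  have [|p' [gp' pp' lep']] := IH al' le' ga'; first by rewrite /poset_gt nab.
  exists (al' :: p'); split; rewrite /= ?ga' ?e //.
  by rewrite [leRHS]big_cons (le_trans lep') // lerDr.
have bb := posrootP be; move: ga gb (ltn_ord (val be).1) (ltn_ord (val al).2).
rewrite /grid; have [e1|n1] := eqVneq (val al).1 (val be).1.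
  have lt2 : ((val be).2 < (val al).2)%N.
    rewrite ltn_neqAle h2 andbT; apply: contraNneq ne => e2.
    by apply/eqP/posrootI => //; apply/val_inj.
  move: (val al) (val be) le h1 h2 e1 lt2 bb step => [a b] [a' b'] /= le h1 h2 e1 lt2 bb step ga gb l1 l2.
  have pr : (b.-1 < n.+1)%N by lia.
  have lt : (a < Ordinal pr)%N by move: lt2; rewrite e1 /=; lia.
  apply: (step (mkroot lt)); rewrite /grid /=; try lia.
  by right; split=> //; lia.
have lt1 : ((val al).1 < (val be).1)%N.
  by rewrite ltn_neqAle h1 andbT.
move: (val al) (val be) le h1 h2 lt1 bb step => [a b] [a' b'] /= le h1 h2 lt1 bb step ga gb l1 l2.
have pr : (a.+1 < n.+1)%N by lia.
have lt : (Ordinal pr < b)%N by move=> /=; lia.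
by apply: (step (mkroot lt)); rewrite /grid /=; try lia; left.
Qed.

Lemma hasse_refine_chain (s : {ffun posroot n -> R}) c :
    (forall ga, 0 <= s ga) -> all (grid i) c -> sorted (@poset_gt n) c ->
  exists p, [/\ all (grid i) p, sorted (@hasse_edge n) p &
    \sum_(ga <- c) s ga <= \sum_(ga <- p) s ga].
Proof.
move=> s0; case: c => [|al c]; first by exists [::].
move=> /= /andP[ga gc] pc.
suff [p [gp pp le]] : exists p', [/\ all (grid i) p', path (@hasse_edge n) al p' &
    \sum_(ga <- c) s ga <= \sum_(ga <- p') s ga].
  by exists (al :: p); split; rewrite /= ?ga // !big_cons lerD2l.
elim: c al ga gc pc => [|be c IH] al ga /=; first by exists [::].
move=> /andP[gb gc] /andP[ab pc]; have [p [gp pp le]] := IH be gb gc pc.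
have gbp : all (grid i) (be :: p) by rewrite /= gb.
have [p' [gp' pp' le']] := hasse_refine s0 ga ab gbp pp.
by exists p'; split=> //; apply: le_trans le'; rewrite !big_cons lerD2l.
Qed.

Lemma chain_polytope_full m w0 (s : {ffun posroot n -> R}) : (0 < i)%N ->
    w0 \in Wmin i -> (forall al, grid i al -> al \in Rminus w0) ->
  chain_polytope R m i (ell i w0) s <-> BD_polytope R m i s.
Proof.
move=> i0 wm full.
have iw al : in_poset i (ell i w0) al = grid i al.
  rewrite in_poset_Rminus //; apply/idP/idP; [exact: Rminus_grid|exact: full].
split=> -[s0 sz sc]; split=> //.
- by move=> al ga; apply: sz; rewrite iw.
- move=> p gp sp; apply: sc; first by rewrite (eq_all iw).
  by apply: sub_sorted sp => al be; apply: hasse_edge_gt.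
- by move=> al; rewrite iw; apply: sz.
- move=> c; rewrite (eq_all iw) => gc sc'.
  have [p [gp sp le]] := hasse_refine_chain s0 gc sc'.
  exact: le_trans le (sc _ gp sp).
Qed.

End Paths.

(** * Lattice points and antichains *)

Section Antichains.
Variables (m : nat) (s : {ffun posroot n -> nat}).
Hypothesis s_chain : forall c, sorted (@poset_gt n) c ->
  (\sum_(al <- c) s al <= m)%N.

Definition is_chain (c : {set posroot n}) : bool :=
  [forall x in c, forall y in c, poset_ge x y || poset_ge y x].

Lemma is_chainP (c : {set posroot n}) :
  reflect (forall x y, x \in c -> y \in c -> poset_ge x y || poset_ge y x)
    (is_chain c).
Proof.
apply: (iffP forall_inP) => [h x y xc yc|h x xc].
  by have /forall_inP/(_ y yc) := h x xc.
by apply/forall_inP => y yc; apply: h.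
Qed.

Lemma sum_is_chain (c : {set posroot n}) : is_chain c -> (\sum_(al in c) s al <= m)%N.
Proof.
move=> /is_chainP tot; pose l := sort (@poset_ge n) (enum c).
have sl : sorted (@poset_ge n) l.
  apply: (sort_sorted_in (P := fun x => x \in c)); first by move=> x y; apply: tot.
  by apply/allP => x; rewrite mem_enum.
have ul : uniq l by rewrite sort_uniq enum_uniq.
rewrite -big_enum -(perm_big _ (permEl (perm_sort (@poset_ge n) _))) /=.
apply: s_chain; rewrite sorted_pairwise; last exact: poset_gt_trans.
move: sl ul; rewrite sorted_pairwise ?uniq_pairwise; last exact: poset_ge_trans.
by move=> h1 h2; rewrite -/l /poset_gt (pairwise_relI (fun x y => x != y)) h1 h2.
Qed.

(** The largest weight of a chain with all elements below x. *)
Definition chain_weight x : nat :=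
  \max_(c : {set posroot n} | is_chain c && [forall y in c, poset_ge x y])
     \sum_(y in c) s y.

Lemma chain_weight_le x : (chain_weight x <= m)%N.
Proof. by apply/bigmax_leqP => c /andP[/sum_is_chain]. Qed.

Lemma poset_ge_refl (x : posroot n) : poset_ge x x.
Proof. by rewrite poset_geE !leqnn. Qed.

Lemma chain_weight_gt (x y : posroot n) : poset_gt y x ->
  (chain_weight x + s y <= chain_weight y)%N.
Proof.
move=> /andP[nyx yx].
have [|c /andP[/is_chainP cc /forall_inP cx] e] :=
  eq_bigmax_cond (fun c : {set posroot n} => \sum_(y in c) s y)%N
   (A := [pred c | is_chain c && [forall y in c, poset_ge x y]]).
  apply/card_gt0P; exists set0; rewrite inE; apply/andP; split.
    by apply/is_chainP => z t; rewrite inE.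
  by apply/forall_inP => z; rewrite inE.
rewrite (_ : chain_weight x = \sum_(z in c) s z)%N; last exact: e.
have yc : y \notin c.
  apply/negP => /cx xy; case/negP: nyx; apply/eqP/poset_ge_anti.
  by rewrite yx xy.
rewrite addnC -(big_setU1 _ yc) /=.
have cy z : z \in c -> poset_ge y z by move=> /cx; apply: poset_ge_trans.
apply: (leq_bigmax_cond (F := fun c : {set posroot n} => \sum_(y in c) s y)%N).
apply/andP; split.
  apply/is_chainP => z t; rewrite !inE.
  case/predU1P=> [->|zc] /predU1P[->|tc]; rewrite ?poset_ge_refl ?cy ?orbT //.
  exact: cc.
apply/forall_inP => z; rewrite !inE.
by case/predU1P=> [->|/cy //]; rewrite poset_ge_refl.
Qed.

Lemma chain_weight_ge x : (s x <= chain_weight x)%N.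
Proof.
rewrite (_ : s x = \sum_(y in [set x]) s y)%N; last by rewrite big_set1.
apply: (leq_bigmax_cond (F := fun c : {set posroot n} => \sum_(y in c) s y)%N).
apply/andP; split.
  by apply/is_chainP => y z /set1P-> /set1P->; rewrite poset_ge_refl.
by apply/forall_inP => y /set1P->; rewrite poset_ge_refl.
Qed.

(** The element x occupies s x consecutive layers, the last one below its
    chain weight. Comparable elements occupy disjoint sets of layers, because
    the chain weight grows by at least s y from x to a larger y. *)
Definition layer (t : nat) x : bool :=
  (chain_weight x - s x <= t < chain_weight x)%N.

Lemma layer_antichain t x y : layer t x -> layer t y -> poset_ge x y -> x = y.
Proof.
move=> /andP[x1 x2] /andP[y1 y2] xy; apply/eqP/negPn/negP => ne.
have := @chain_weight_gt y x; rewrite /poset_gt ne xy => /(_ isT).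
lia.
Qed.

Lemma card_interval p q : (q <= m)%N ->
  #|[set t : 'I_m | (p <= t < q)%N]| = (q - p)%N.
Proof.
move=> qm; rewrite -sum1dep_card -(big_mkord (fun t => p <= t < q)%N (fun=> 1%N)).
rewrite -[RHS](size_iota p) -[RHS]sum1_size -[LHS]big_filter.
apply: perm_big; apply: uniq_perm; rewrite ?filter_uniq ?iota_uniq // => t.
by rewrite mem_filter !mem_index_iota; lia.
Qed.

Lemma card_layer x : #|[set t : 'I_m | layer t x]| = s x.
Proof.
by rewrite card_interval ?chain_weight_le // subKn // chain_weight_ge.
Qed.

(** The antichains are the layers. An antichain of the grid is a partial
    increasing map from rows to columns, extended by the identity. *)
Lemma antichain_decomposition i : (forall al, ~~ grid i al -> s al = 0%N) ->
  exists sg : 'I_m -> 'I_n.+1 -> 'I_n.+1,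
  [/\ forall t a, (sg t a < i)%N -> sg t a = a,
      forall t (a a' : 'I_n.+1), (a < a' < i)%N -> (i <= sg t a)%N -> (i <= sg t a')%N ->
        (sg t a < sg t a')%N
    & forall al, grid i al ->
        s al = #|[set t | sg t (val al).1 == (val al).2]|].
Proof.
move=> s0.
pose P t a b := [exists al, [&& val al == (a, b), grid i al & layer t al]].
pose sg (t : 'I_m) a := odflt a [pick b | P t a b].
have sgP t al : grid i al -> (sg t (val al).1 == (val al).2) = layer t al.
  move=> ga; rewrite /sg; case: pickP => [b /existsP[be /and3P[/eqP e gb lb]]|no] /=.
    apply/eqP/idP => [eb|la].
      by suff -> : al = be by []; apply: posrootI; rewrite e.
    have [ab|ab] := leqP (val al).2 b.
      have := @layer_antichain t be al lb la; rewrite poset_geE e /= leqnn ab.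
      by move=> /(_ isT) <-; rewrite e.
    have := @layer_antichain t al be la lb; rewrite poset_geE e /= leqnn (ltnW ab).
    by move=> /(_ isT) ->; rewrite e.
  have := no (val al).2; rewrite /P => /existsPn/(_ al).
  rewrite ga /= -surjective_pairing eqxx /= => /negbTE->.
  by have := posrootP al; case: eqP => // ->; rewrite ltnn.
exists sg; split=> [t a|t a a' /andP[aa' ai]|al ga].
- rewrite /sg; case: pickP => //= b /existsP[al /and3P[/eqP e]].
  by rewrite /grid e /= => /andP[_ ib] _ bi; lia.
- rewrite /sg; case: pickP => /= [b /existsP[al /and3P[/eqP e ga la]]|_]; last lia.
  case: pickP => /= [b' /existsP[al' /and3P[/eqP e' ga' la']]|_]; last lia.
  move=> _ _; rewrite ltnNge; apply/negP => bb.
  have := @layer_antichain t al al' la la'; rewrite poset_geE e e' /=.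
  rewrite (ltnW aa') bb => /(_ isT) ee; move: e'; rewrite -ee e => -[ea _].
  by rewrite ea ltnn in aa'.
- by rewrite -card_layer; apply: eq_card => t; rewrite !inE sgP.
Qed.

End Antichains.
End Chains.

(** * Eigenvectors *)

(** Subspaces as predicates, which can be defined by an inductive type or a
    linear condition. *)
Definition lclosed (K : pzRingType) (V : lmodType K) (P : V -> Prop) : Prop :=
  P 0 /\ forall c x y, P x -> P y -> P (c *: x + y).

Section Linear.
Variables (F : pzRingType) (V W : lmodType F) (H : V -> W).
Hypothesis linH : linear H.

Lemma lin0 : H 0 = 0.
Proof. by have := linH (-1) 0 0; rewrite scaler0 addr0 scaleN1r addNr. Qed.

Lemma linZ c x : H (c *: x) = c *: H x.
Proof. by have := linH c x 0; rewrite lin0 !addr0. Qed.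

Lemma linD x y : H (x + y) = H x + H y.
Proof. by have := linH 1 x y; rewrite !scale1r. Qed.

Lemma linB x y : H (x - y) = H x - H y.
Proof. by rewrite -scaleN1r linD linZ scaleN1r. Qed.

Lemma lin_sum (J : Type) (r : seq J) (P : pred J) (h : J -> V) :
  H (\sum_(j <- r | P j) h j) = \sum_(j <- r | P j) H (h j).
Proof. by elim/big_rec2: _ => [|j a b _ <-]; rewrite ?lin0 ?linD. Qed.

End Linear.

Lemma eigen_indep (F : fieldType) (V : lmodType F) (H : V -> V) (N : nat)
    (mu : nat -> F) (y : nat -> V) : linear H ->
    (forall j, (j < N)%N -> H (y j) = mu j *: y j) ->
    (forall j k, (j < N)%N -> (k < N)%N -> mu j = mu k -> j = k) ->
  \sum_(j < N) y j = 0 -> forall j, (j < N)%N -> y j = 0.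
Proof.
move=> linH; elim: N y => [|N IH] y eH inj //; rewrite big_ord_recr /= => s0.
have z j : (j < N)%N -> (mu j - mu N) *: y j = 0.
  apply: (IH (fun j => (mu j - mu N) *: y j)) => [k kN|k l kN lN|].
  - rewrite (linZ linH) eH ?ltnS ?(ltnW kN) //.
    by rewrite !scalerA mulrC.
  - by apply: inj; exact: ltnW.
  have : H (\sum_(k < N) y k + y N) = 0 by rewrite s0 (lin0 linH).
  rewrite (linD linH) (lin_sum linH) /= (eq_bigr (fun k : 'I_N => mu k *: y k)).
    rewrite eH // [in LHS](_ : y N = - \sum_(k < N) y k).
      rewrite scalerN scaler_sumr -sumrB => e; rewrite -[RHS]e.
      by apply: eq_bigr => k _; rewrite scalerBl.
    by apply/eqP; rewrite -addr_eq0 addrC s0.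
  by move=> k _; apply: eH; apply: ltnW; rewrite ltnS.
have yN j : (j < N)%N -> y j = 0.
  move=> jN; have /eqP := z j jN; rewrite scaler_eq0 subr_eq0 => /orP[/eqP e|/eqP //].
  by have := inj _ _ (ltnW (jN : (j < N)%N)) (ltnSn N) e; lia.
move=> j; rewrite ltnS leq_eqVlt => /predU1P[->|/yN //].
by move: s0; rewrite big1 ?add0r // => k _; apply: yN.
Qed.

(** Nonzero eigenvectors of distinct eigenvalues would be independent. *)
Lemma eigen_finite (F : fieldType) (V : vectType F) (H : V -> V)
    (mu : nat -> F) (y : nat -> V) : linear H ->
    (forall j, H (y j) = mu j *: y j) -> injective mu ->
  exists j, y j = 0.
Proof.
move=> linH eH inj; apply/not_existsP => ny.
pose N := (\dim {:V}).+1; pose X := [tuple y j | j < N].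
have : free X.
  apply/freeP => k; under eq_bigr do rewrite -tnth_nth tnth_mktuple.
  pose k' j := if insub j is Some j' then k j' else 0.
  have kE (j : 'I_N) : k' j = k j by rewrite /k' valK.
  under eq_bigr do rewrite -kE.
  move=> s0 j; have e := @eigen_indep _ _ H N mu (fun j => k' j *: y j) linH.
  suff /eqP : k' j *: y j = 0 by rewrite scaler_eq0 kE => /orP[/eqP //|/eqP/ny].
  apply: e => // [l _|l1 l2 _ _]; last exact: inj.
  by rewrite (linZ linH) eH !scalerA mulrC.
move/eqP; rewrite size_tuple => e.
by have := dimvS (subvf <<X>>%VS); rewrite e ltnn.
Qed.

(** * Representations of gl and highest weight vectors *)

Section GlSystem.
Variables (F : numClosedFieldType) (n : nat).
Local Notation I := 'I_n.+1.

(** The commutation relations of the matrix units. *)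
Definition gl_system (V : lmodType F) (X : I -> I -> V -> V) : Prop :=
  (forall p q, linear (X p q)) /\
  forall p q r s y, X p q (X r s y) =
    X r s (X p q y) + (q == r)%:R *: X p s y - (s == p)%:R *: X r q y.

(** The weight is m omega_i as a weight of gl. Besides the raising operators,
    all lowering operators outside of the grid kill v. *)
Definition hw_vector (i m : nat) (V : lmodType F) (X : I -> I -> V -> V) v :=
  forall p q : I, ~~ ((i <= p)%N && (q < i)%N) ->
    X p q v = (m * ((p == q) && (p < i)%N))%:R *: v.

Lemma ord_neq (i : nat) (p q : I) : (p < i)%N -> (i <= q)%N -> (p == q) = false.
Proof. by move=> pi iq; apply/eqP => e; move: pi; rewrite e ltnNge iq. Qed.

Section System.
Variables (i m : nat) (V : lmodType F) (X : I -> I -> V -> V) (v : V).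
Hypotheses (glX : gl_system X) (hwv : hw_vector i m X v).

Let linX p q : linear (X p q). Proof. by case: glX => h _; apply: h. Qed.

Lemma glC p q r s y : X p q (X r s y) =
    X r s (X p q y) + (q == r)%:R *: X p s y - (s == p)%:R *: X r q y.
Proof. by case: glX => _; apply. Qed.

Lemma glP p q c x y : X p q (c *: x + y) = c *: X p q x + X p q y.
Proof. exact: linX. Qed.

Lemma gl0 p q : X p q 0 = 0.
Proof. exact: lin0 (linX p q). Qed.

Lemma glZ p q c x : X p q (c *: x) = c *: X p q x.
Proof. exact: linZ (linX p q) _ _. Qed.

Lemma glB p q x y : X p q (x - y) = X p q x - X p q y.
Proof. exact: linB (linX p q) _ _. Qed.

Lemma gl_sum p q (J : Type) (r : seq J) (P : pred J) (h : J -> V) :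
  X p q (\sum_(j <- r | P j) h j) = \sum_(j <- r | P j) X p q (h j).
Proof. exact: (lin_sum (linX p q)). Qed.

(** The span of the words of length d in the lowering operators X b a,
    a < i <= b, applied to v. *)
Inductive gword : nat -> V -> Prop :=
| Gword_v : gword 0 v
| Gword_0 d : gword d 0
| Gword_lin d c x y : gword d x -> gword d y -> gword d (c *: x + y)
| Gword_X d (a b : I) y : (a < i)%N -> (i <= b)%N -> gword d y ->
    gword d.+1 (X b a y).

Lemma gwordD d x y : gword d x -> gword d y -> gword d (x + y).
Proof. by move=> gx gy; rewrite -[x]scale1r; apply: Gword_lin. Qed.

Lemma gwordZ d c x : gword d x -> gword d (c *: x).
Proof. by move=> gx; rewrite -[_ *: _]addr0; apply/Gword_lin/Gword_0. Qed.

Lemma gwordB d x y : gword d x -> gword d y -> gword d (x - y).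
Proof. by move=> gx gy; rewrite -scaleN1r; apply/gwordD/gwordZ. Qed.

Lemma gword_sum d (J : Type) (r : seq J) (P : pred J) (h : J -> V) :
  (forall j, P j -> gword d (h j)) -> gword d (\sum_(j <- r | P j) h j).
Proof.
by move=> hP; apply: big_ind => //; [exact: Gword_0 | exact: gwordD].
Qed.

Lemma gword_levi d y (p q : I) : (p < i)%N = (q < i)%N -> gword d y ->
  gword d (X p q y).
Proof.
move=> + gy; elim: gy p q => {d y} [|d|d c x y _ IHx _ IHy|d a b y ai ib gy IH] p q pq.
- rewrite hwv; first exact/gwordZ/Gword_v.
  by rewrite -pq leqNgt andNb.
- by rewrite gl0; apply: Gword_0.
- by rewrite glP; apply: Gword_lin; [exact: IHx | exact: IHy].
rewrite glC; apply: gwordB; first apply: gwordD.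
- by apply: Gword_X => //; apply: IH.
- case: eqP => [e|_]; last by rewrite scale0r; apply: Gword_0.
  apply/gwordZ/Gword_X => //; rewrite leqNgt pq e -leqNgt //.
- case: eqP => [e|_]; last by rewrite scale0r; apply: Gword_0.
  by apply/gwordZ/Gword_X => //; rewrite -pq -e.
Qed.

Lemma gword_up d y (a b : I) : (a < i)%N -> (i <= b)%N -> gword d y ->
  if d is d'.+1 then gword d' (X a b y) else X a b y = 0.
Proof.
move=> ai ib; elim=> {d y} [|d|d c x y _ IHx _ IHy|d a' b' y ai' ib' gy IH].
- rewrite hwv ?[(i <= a)%N]leqNgt ?ai //.
  by rewrite (ord_neq ai ib) muln0 scale0r.
- by case: d => [|d]; rewrite gl0 //; apply: Gword_0.
- case: d IHx IHy => [|d] IHx IHy; rewrite glP ?IHx ?IHy ?scaler0 ?addr0 //.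
  exact: Gword_lin.
rewrite glC; apply: gwordB; first apply: gwordD.
- case: d gy IH => [|d] gy IH; first by rewrite IH gl0; apply: Gword_0.
  exact: Gword_X.
- by apply/gwordZ/gword_levi => //; rewrite ai ai'.
- by apply/gwordZ/gword_levi => //; rewrite !ltnNge ib ib'.
Qed.

Lemma gword0 y : gword 0 y -> exists c, y = c *: v.
Proof.
move: {-2}0%N (erefl 0%N) => d e gy; elim: gy e => {d y} // [|d|d c x y _ IHx _ IHy] e.
- by exists 1; rewrite scale1r.
- by exists 0; rewrite scale0r.
have [c1 ->] := IHx e; have [c2 ->] := IHy e.
by exists (c * c1 + c2); rewrite scalerDl scalerA.
Qed.

(** The action of a central element of the Levi subalgebra. *)
Definition Zop (y : V) : V := \sum_(a < n.+1 | (a < i)%N) X a a y.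

Lemma Zop_linear : linear Zop.
Proof.
move=> c x y; rewrite /Zop scaler_sumr -big_split.
by apply: eq_bigr => a _; rewrite glP.
Qed.

Lemma gword_Z d y : gword d y ->
  Zop y = ((m * #|[pred a : I | (a < i)%N]|)%:R - d%:R) *: y.
Proof.
elim=> {d y} [|d|d c x y _ IHx _ IHy|d a b y ai ib gy IH].
- rewrite /Zop subr0 -sum1_card big_distrr natr_sum scaler_suml.
  by apply: eq_bigr => a ai; rewrite hwv ?eqxx ?ai // leqNgt ai.
- by rewrite scaler0; rewrite /Zop big1 // => a _; rewrite gl0.
- by rewrite Zop_linear IHx IHy scalerDr !scalerA mulrC.
have -> : Zop (X b a y) = X b a (Zop y) - X b a y.
  rewrite /Zop gl_sum; under eq_bigr do rewrite glC.
  rewrite sumrB big_split /= [X in _ + X - _]big1 ?addr0; last first.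
    by move=> a0 ai0; rewrite (ord_neq ai0 ib) scale0r.
  congr (_ - _); rewrite (bigD1 a) //= eqxx scale1r big1 ?addr0 // => a0 /andP[_ na].
  by rewrite eq_sym (negbTE na) scale0r.
by rewrite IH glZ -{2}[X b a y]scale1r -scalerBl -natr1 opprD addrA.
Qed.

(** The lengths of words can be told apart by the eigenvalues of Zop. *)
Lemma gword_indep N (y : nat -> V) : (forall j, (j < N)%N -> gword j (y j)) ->
  \sum_(j < N) y j = 0 -> forall j, (j < N)%N -> y j = 0.
Proof.
move=> gy; apply: (eigen_indep (mu := fun j =>
  (m * #|[pred a : I | (a < i)%N]|)%:R - j%:R) Zop_linear) => [j /gy/gword_Z //|j k _ _].
by move=> /(addrI _) /oppr_inj /eqP; rewrite eqr_nat => /eqP.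
Qed.

Definition fword (L : seq (posroot n)) (y : V) : V :=
  foldr (fun al => X (val al).2 (val al).1) y L.

Lemma gword_span d y (P : V -> Prop) : lclosed P ->
    (forall L, size L = d -> all (grid i) L -> P (fword L v)) ->
  gword d y -> P y.
Proof.
move=> + + gy; elim: gy P => {d y} [|d|d c x y _ IHx _ IHy|d a b y ai ib gy IH] P cP hP.
- exact: (hP [::]).
- by case: cP.
- by case: (cP) => _; apply; [exact: IHx | exact: IHy].
have ab : (a < b)%N by lia.
apply: (IH (fun y => P (X b a y))); first split.
- by rewrite gl0; case: cP.
- by move=> c x z Px Pz; rewrite glP; case: (cP) => _; apply.
move=> L sL gL; apply: (hP (mkroot ab :: L)) => /=; first by rewrite sL.
by rewrite gL /grid /= ai ib.
Qed.

Lemma grid_comm al be y : grid i al -> grid i be ->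
  X (val al).2 (val al).1 (X (val be).2 (val be).1 y) =
  X (val be).2 (val be).1 (X (val al).2 (val al).1 y).
Proof.
move=> /andP[a1 a2] /andP[b1 b2]; rewrite glC.
by rewrite (ord_neq a1 b2) (ord_neq b1 a2) !scale0r addr0 subr0.
Qed.

End System.

(** If X b a has a highest weight vector of weight difference k, then a
    nonzero (X b a)^(k+1) v would be followed by infinitely many nonzero
    weight vectors. *)
Lemma sl2_nilpotent (V : vectType F) (X : I -> I -> V -> V) v (a b : I) k
    (ca cb : F) : gl_system X -> a != b ->
    X a b v = 0 -> X a a v = ca *: v -> X b b v = cb *: v -> ca - cb = k%:R ->
  iter k.+1 (X b a) v = 0.
Proof.
move=> glX ab e0 ea eb ek; apply/eqP/negPn/negP => nz.
pose y j := iter j (X b a) v; pose H z := X a a z - X b b z.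
have linH : linear H.
  by move=> c z t; rewrite /H !(glP glX) scalerBr opprD addrACA.
have Hy j : H (y j) = (k%:R - (2 * j)%:R) *: y j.
  elim: j => [|j IH]; first by rewrite /H /y /= ea eb -scalerBl ek subr0.
  have -> : H (y j.+1) = X b a (H (y j)) - 2 *: y j.+1.
    rewrite /H /y /= !(glC glX _ _ b a) !eqxx (negbTE ab) !scale1r !scale0r.
    rewrite addr0 subr0 (glB glX) scaler_nat mulr2n !opprD !addrA.
    by congr (_ - _); rewrite addrAC.
  rewrite IH (glZ glX) -/(y j.+1) -scalerBl; congr (_ *: _).
  by rewrite mulnS natrD; ring.
have Ey j : X a b (y j.+1) = (j.+1%:R * (k%:R - j%:R)) *: y j.
  elim: j => [|j IH].
    rewrite /y /= (glC glX) e0 (gl0 glX) add0r !eqxx !scale1r ea eb -scalerBl ek.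
    by rewrite mul1r subr0.
  have -> : y j.+2 = X b a (y j.+1) by [].
  rewrite (glC glX) IH (glZ glX) -/(y j.+1).
  rewrite !eqxx !scale1r -addrA -/(H (y j.+1)) Hy -scalerDl; congr (_ *: _).
  by rewrite -[j.+2%:R]natr1 -[j.+1%:R]natr1 mulnS natrD natrM -natr1; ring.
have ny j : y (k.+1 + j)%N != 0.
  elim: j => [|j IH]; first by rewrite addn0.
  apply: contraNneq IH => ey; have := Ey (k.+1 + j)%N.
  rewrite -addnS ey (gl0 glX) => /esym/eqP; rewrite scaler_eq0 => /orP[|//].
  by rewrite mulf_eq0 pnatr_eq0 /= subr_eq0 eqr_nat; lia.
have inj : injective (fun j => k%:R - (2 * (k.+1 + j))%:R : F).
  by move=> j l /(addrI _) /oppr_inj /eqP; rewrite eqr_nat; lia.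
have [j /eqP] := eigen_finite (y := fun j => y (k.+1 + j)%N) linH
   (fun j => Hy (k.+1 + j)%N) inj.
by rewrite (negbTE (ny j)).
Qed.

(** * Transfer of linear relations *)

Section Transfer.
Variables (i m : nat) (V T : lmodType F).
Variables (X : I -> I -> V -> V) (v : V) (Y : I -> I -> T -> T) (t : T).
Hypotheses (glX : gl_system X) (hwv : hw_vector i m X v) (v0 : v != 0).
Hypotheses (glY : gl_system Y) (hwt : hw_vector i m Y t).

Definition pair_op (p q : I) (y : (V * T)%type) : (V * T)%type :=
  (X p q y.1, Y p q y.2).

Lemma pair_gl : gl_system pair_op.
Proof.
split=> [p q c x y|p q r s y]; rewrite /pair_op /=.
  by rewrite (glP glX) (glP glY).
by rewrite (glC glX) (glC glY).
Qed.

Lemma pair_hw : hw_vector i m pair_op (v, t).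
Proof. by move=> p q pq; rewrite /pair_op /= hwv // hwt. Qed.

Lemma gword_pair2 d y : gword i pair_op (v, t) d y -> gword i Y t d y.2.
Proof.
elim=> {d y} [|d|d c x y _ IHx _ IHy|d a b y ai ib gy IH].
- exact: Gword_v.
- exact: Gword_0.
- exact: Gword_lin.
- exact: Gword_X.
Qed.

(** If T carries a positive definite form for which raising and lowering
    operators are adjoint, a relation between the words on v also holds for
    the words on t: applying raising operators brings it to a multiple of
    (v, t) with vanishing first component, so its image in T is orthogonal to
    all words on t, itself included. *)
Lemma transfer (B : T -> T -> F) d y :
    (forall x, B 0 x = 0) ->
    (forall x, lclosed (fun z => B x z = 0)) ->
    (forall p q x z, B x (Y p q z) = B (Y q p x) z) ->
    (forall x, B x x = 0 -> x = 0) ->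
  gword i pair_op (v, t) d (0, y) -> y = 0.
Proof.
move=> B0 Bl adj def gy; apply: def.
apply: (gword_span glY (Bl y) _ (gword_pair2 gy)) => L.
elim: L d y gy => [|al L IH] d y gy /= dL.
  move: gy; rewrite -dL => /gword0[c [/esym/eqP]].
  by rewrite scaler_eq0 (negbTE v0) orbF => /eqP-> ->; rewrite scale0r B0.
move=> /andP[/andP[a1 a2] gL]; rewrite adj; case: d dL gy => // d [dL] gy.
apply: (IH d) => //; have := gword_up pair_gl pair_hw a1 a2 gy.
by rewrite /pair_op /= (gl0 glX).
Qed.

End Transfer.
End GlSystem.

(** * Corner sums *)

Section Corner.
Variables (n i : nat).
Implicit Types (s t : {ffun posroot n -> nat}) (al : posroot n).

(** For given row and column sums, a corner is smallest on a chain: the total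
    of all corners measures the progress of straightening. *)
Definition corner (A B : nat) s : nat :=
  \sum_(al | [&& grid i al, A <= (val al).1 & B <= (val al).2]%N) s al.

Definition corner_sum s : nat := \sum_(A < n.+1) \sum_(B < n.+1) corner A B s.

End Corner.

(** ** Rearrangements in one block *)

(* In one tensor factor, b c is the state of the row c, and f moves the rows
   with state at least i among themselves. *)
Section Block.
Variables (i : nat) (b : 'I_i -> nat) (f : 'I_i -> 'I_i).
Hypotheses (f_inj : injective f) (f_fix : forall c, (b c < i)%N -> f c = c).
Hypothesis b_incr : forall c c' : 'I_i, (c < c')%N ->
  (i <= b c)%N -> (i <= b c')%N -> (b c < b c')%N.

Lemma card_ge_inj (A : nat) :
  #|[set c | (A <= f c)%N]| = #|[set c : 'I_i | (A <= c)%N]|.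
Proof.
have [g fK gK] := injF_bij f_inj.
rewrite -(card_imset _ f_inj); apply: eq_card => c; rewrite inE.
apply/imsetP/idP => [[d + ->]|ac]; first by rewrite inE.
by exists (g c); rewrite ?inE gK.
Qed.

Lemma card_moved (A : nat) : #|[set c | (i <= b c)%N && (A <= f c)%N]| =
  #|[set c : 'I_i | (i <= b c)%N && (A <= c)%N]|.
Proof.
have := card_ge_inj A.
rewrite -(cardsID [set c | (i <= b c)%N]) -[RHS](cardsID [set c | (i <= b c)%N]).
rewrite [X in (_ + X = _)%N](_ : _ =
    #|[set c : 'I_i | (A <= c)%N] :\: [set c | (i <= b c)%N]|).
  by move/addIn; congr (_ = _); apply: eq_card => c; rewrite !inE andbC.
apply: eq_card => c; rewrite !inE -ltnNge.
by case: ltnP => //= bc; rewrite f_fix.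
Qed.

(** The elements with value at least B are the last ones of those with value
    at least i, so no rearrangement of these can increase their number in
    the last positions. *)
Lemma block_le (A B : nat) :
  (#|[set c | [&& i <= b c, B <= b c & A <= f c]]|
    <= #|[set c : 'I_i | [&& i <= b c, B <= b c & A <= c]]|)%N.
Proof.
have [/existsP[c0 /and3P[c1 c2 c3]]|/existsPn no] :=
    boolP [exists c : 'I_i, [&& (i <= b c)%N, (B <= b c)%N & (c < A)%N]].
  apply: leq_trans (_ : #|[set c | (i <= b c)%N && (A <= f c)%N]| <= _)%N.
    apply/subset_leq_card/subsetP => c; rewrite !inE.
    by move=> /and3P[-> _ ->].
  rewrite card_moved; apply/subset_leq_card/subsetP => c; rewrite !inE.
  move=> /andP[ib ac]; rewrite ib ac andbT /=.
  by apply: leq_trans c2 (ltnW (b_incr _ c1 ib)); apply: leq_trans c3 ac.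
apply/subset_leq_card/subsetP => c; rewrite !inE => /and3P[h1 h2 _].
by have := no c; rewrite h1 h2 /= -leqNgt.
Qed.

(** The quadrant starts at a row c that f maps to an earlier one. *)
Lemma block_lt c0 : f c0 != c0 -> exists c : 'I_i,
  (#|[set d | [&& i <= b d, b c <= b d & c <= f d]]|
    < #|[set d : 'I_i | [&& i <= b d, b c <= b d & c <= d]]|)%N.
Proof.
move=> fc0; have [c fc] : exists c : 'I_i, (f c < c)%N.
  apply: contrapT => no; have ge (c : 'I_i) : (c <= f c)%N.
    by rewrite leqNgt; apply/negP => lt; apply: no; exists c.
  have : (\sum_(c < i) c < \sum_c f c)%N.
    rewrite (bigD1 c0) //= [ltnRHS](bigD1 c0) //= -addSn leq_add //.
      by rewrite ltn_neqAle ge andbT eq_sym.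
    by apply: leq_sum => c _; apply: ge.
  by rewrite [ltnLHS](reindex_inj f_inj) ltnn.
have ib : (i <= b c)%N.
  by rewrite leqNgt; apply/negP => /f_fix e; rewrite e ltnn in fc.
exists c; apply/proper_card/properP; split; last first.
  by exists c; rewrite !inE ib !leqnn //= -ltnNge.
apply/subsetP => d; rewrite !inE => /and3P[h1 h2 _]; rewrite h1 h2 /=.
rewrite leqNgt; apply/negP => dc.
by have := b_incr dc h1 ib; rewrite ltnNge h2.
Qed.

End Block.

(** * A tensor model *)

Section Model.
Variables (F : numClosedFieldType) (n i m : nat).
Hypothesis hi : (i <= n.+1)%N.
Local Notation I := 'I_n.+1.
Local Notation pos := ('I_m * 'I_i)%type.
Local Notation state := {ffun pos -> I}.

(** Tensors in m * i copies of C^(n+1), as functions on the states, that is on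
    the basis tensors; the copies are arranged in m blocks of size i. *)
Definition tensor := {ffun state -> F^o}.
HB.instance Definition _ := GRing.Lmodule.on tensor.

Implicit Types (x : pos) (sg tau : state) (psi : tensor).

Definition upd sg x (q : I) : state := [ffun y => if y == x then q else sg y].

Lemma upd_same sg x q : upd sg x q x = q.
Proof. by rewrite ffunE eqxx. Qed.

Lemma upd_neq sg x y q : y != x -> upd sg x q y = sg y.
Proof. by rewrite ffunE => /negbTE->. Qed.

Lemma upd_upd sg x p q : upd (upd sg x p) x q = upd sg x q.
Proof. by apply/ffunP => y; rewrite !ffunE; case: eqP. Qed.

Lemma upd_comm sg x y p q : x != y ->
  upd (upd sg x p) y q = upd (upd sg y q) x p.
Proof.
move=> xy; apply/ffunP => z; rewrite !ffunE; case: eqP => // ->.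
by rewrite eq_sym (negbTE xy).
Qed.

Lemma upd_id sg x : upd sg x (sg x) = sg.
Proof. by apply/ffunP => y; rewrite ffunE; case: eqP => [->|]. Qed.

Definition tensor_op (p q : I) psi : tensor :=
  [ffun sg : state => \sum_(x : pos | sg x == p) psi (upd sg x q)].

(** The sum over pairs of different copies is symmetric in the two operators,
    so it cancels in the commutator. *)
Lemma tensor_opM p q r s psi sg : tensor_op p q (tensor_op r s psi) sg =
  \sum_(x : pos) \sum_(y : pos | (x != y) && ((sg x == p) && (sg y == r)))
     psi (upd (upd sg x q) y s) + (q == r)%:R *: tensor_op p s psi sg.
Proof.
rewrite !ffunE scaler_sumr [X in _ + X]big_mkcond -big_split /= big_mkcond.
apply: eq_bigr => x _; case: ifP => xp; last first.
  by rewrite addr0 big_pred0 // => y; rewrite andbF.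
rewrite ffunE (bigID (fun y => x == y)) /= addrC; congr (_ + _).
  apply: eq_bigl => y; case: (eqVneq x y) => xy; rewrite ?andbF //= andbT.
  by rewrite upd_neq // eq_sym.
case: (eqVneq q r) => qr; last first.
  rewrite scale0r big_pred0 // => y; case: (eqVneq x y) => [<-|]; rewrite ?andbF //.
  by rewrite upd_same (negbTE qr).
rewrite (big_pred1 x) ?upd_upd ?scale1r // => y /=; rewrite [x == y]eq_sym.
by case: (eqVneq y x) => [->|]; rewrite ?andbF // upd_same qr eqxx.
Qed.

Lemma tensor_gl : gl_system tensor_op.
Proof.
split=> [p q c y z|p q r s psi].
  apply/ffunP => sg; rewrite !ffunE scaler_sumr -big_split /=.
  by apply: eq_bigr => x _; rewrite !ffunE.
apply/ffunP => sg.
have addE (a b : tensor) : (a + b) sg = a sg + b sg by rewrite ffunE.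
have oppE (a : tensor) : (- a) sg = - a sg by rewrite ffunE.
have sclE c (a : tensor) : (c *: a) sg = c *: a sg by rewrite ffunE.
rewrite !addE oppE !sclE !tensor_opM [RHS]addrAC addrK; congr (_ + _).
rewrite (exchange_big_dep xpredT) //=.
apply: eq_bigr => y _; rewrite big_mkcond [RHS]big_mkcond /=.
apply: eq_bigr => x _; rewrite (eq_sym y x) [(sg y == r) && _]andbC.
by case: ifP => // /andP[xy _]; rewrite upd_comm.
Qed.

(** The form for which tensor_op p q and tensor_op q p are adjoint. *)
Definition tensor_form (y z : tensor) : F := \sum_sg (y sg)^* * z sg.

Lemma tensor_form0 z : tensor_form 0 z = 0.
Proof. by apply: big1 => sg _; rewrite ffunE conjC0 mul0r. Qed.

Lemma tensor_form_lclosed y : lclosed (fun z => tensor_form y z = 0).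
Proof.
split; first by apply: big1 => sg _; rewrite ffunE mulr0.
move=> c z t z0 t0; rewrite /tensor_form.
under eq_bigr do rewrite !ffunE mulrDr mulrCA.
by rewrite big_split -mulr_sumr /= [X in c * X]z0 [X in _ + X]t0 mulr0 addr0.
Qed.

Lemma tensor_form_def y : tensor_form y y = 0 -> y = 0.
Proof.
move=> /eqP; rewrite /tensor_form psumr_eq0 => [/allP y0|sg _]; last first.
  by rewrite mulrC mul_conjC_ge0.
apply/ffunP => sg; have := y0 sg (mem_index_enum _).
by rewrite mulrC mul_conjC_eq0 ffunE => /eqP.
Qed.

Lemma tensor_form_adj p q y z :
  tensor_form y (tensor_op p q z) = tensor_form (tensor_op q p y) z.
Proof.
rewrite /tensor_form.
under eq_bigr do rewrite ffunE mulr_sumr big_mkcond.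
under [RHS]eq_bigr do rewrite ffunE rmorph_sum mulr_suml big_mkcond.
rewrite exchange_big [RHS]exchange_big /=; apply: eq_bigr => x _.
rewrite -!big_mkcond /= (reindex_onto (fun sg => upd sg x p) (fun sg => upd sg x q)) /=.
  apply: eq_big => [sg|sg]; rewrite upd_same eqxx upd_upd.
    by apply/eqP/eqP => [<-|<-]; rewrite ?upd_same ?upd_id.
  by move=> /eqP->.
by move=> sg /eqP <-; rewrite upd_upd upd_id.
Qed.

(** ** The highest weight vector *)

Definition row_ord (c : 'I_i) : I := widen_ord hi c.

Definition block_mx_of sg (t : 'I_m) : 'M[F]_i :=
  \matrix_(c, a) (sg (t, c) == row_ord a)%:R.

(** The m-th tensor power of the wedge product of the first i basis vectors. *)
Definition hw_tensor : tensor := [ffun sg : state => \prod_t \det (block_mx_of sg t)].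

Lemma block_upd_neq sg t t' c q : t' != t ->
  block_mx_of (upd sg (t, c) q) t' = block_mx_of sg t'.
Proof.
move=> tt; apply/matrixP => d a; rewrite !mxE upd_neq //.
by rewrite xpair_eqE (negbTE tt).
Qed.

(** The sum over the rows c in state p, with the row c replaced by the unit
    vector of q, is an entry of the product of the matrix by its adjugate. *)
Lemma sum_det_upd sg t (p q : I) : ~~ ((i <= p)%N && (q < i)%N) ->
  \sum_(c < i | sg (t, c) == p) \det (block_mx_of (upd sg (t, c) q) t) =
  ((p == q) && (p < i)%N)%:R * \det (block_mx_of sg t).
Proof.
move=> pq; have [qi|iq] := ltnP q i; last first.
  have -> : (p == q) && (p < i)%N = false.
    by case: eqP => //= ->; rewrite ltnNge iq.
  rewrite mul0r big1 // => c _; rewrite (expand_det_row _ c) big1 // => a _.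
  rewrite mxE upd_same (_ : q == row_ord a = false) ?mul0r //.
  by rewrite eq_sym (ord_neq (ltn_ord a : (row_ord a < i)%N)).
have pi : (p < i)%N by move: pq; rewrite qi andbT -ltnNge.
rewrite pi andbT; set M := block_mx_of sg t.
pose p' := Ordinal pi; pose q' := Ordinal qi.
have -> : (p == q) = (q' == p') by rewrite eq_sym.
have := congr1 (fun A : 'M_i => A q' p') (mul_adj_mx M); rewrite !mxE.
rewrite mulr_natl => <-; rewrite big_mkcond; apply: eq_bigr => c _.
have -> : p = row_ord p' by apply/val_inj.
rewrite !mxE; case: ifP => _; last by rewrite mulr0.
rewrite mulr1 (expand_det_row _ c) (bigD1 q') //= big1 ?addr0; last first.
  move=> a aq; rewrite mxE upd_same (_ : q == row_ord a = false) ?mul0r //.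
  by apply: contraNF aq => /eqP e; apply/eqP/val_inj; rewrite /= e.
rewrite mxE upd_same (_ : q == row_ord q') ?mul1r; last by apply/eqP/val_inj.
rewrite /cofactor; congr (_ * \det _); apply/matrixP => d a.
by rewrite !mxE upd_neq // xpair_eqE eqxx /= eq_sym neq_lift.
Qed.

Lemma hw_tensorP : hw_vector i m tensor_op hw_tensor.
Proof.
move=> p q pq; apply/ffunP => sg; rewrite !ffunE.
transitivity (\sum_t \sum_(c | sg (t, c) == p)
    \prod_t' \det (block_mx_of (upd sg (t, c) q) t')).
  by rewrite pair_big_dep /=; apply: eq_big => -[t c] //= _; rewrite ffunE.
transitivity (\sum_(t < m) (((p == q) && (p < i)%N)%:R *
   \prod_t \det (block_mx_of sg t))); last first.
  have cst (c : F) : \sum_(t < m) c = m%:R * c by rewrite sumr_const card_ord mulr_natl.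
  by rewrite [LHS]cst [LHS]mulrA -natrM.
apply: eq_bigr => t _.
rewrite [X in _ * X](bigD1 t) //= mulrA -sum_det_upd // mulr_suml.
apply: eq_bigr => c _; rewrite (bigD1 t) //=; congr (_ * _).
by apply: eq_bigr => t' tt; rewrite block_upd_neq.
Qed.

Lemma hw_tensor_neq0 tau : hw_tensor tau != 0 ->
  (forall x, (tau x < i)%N) /\
  forall t, injective (fun c => tau (t, c)).
Proof.
rewrite ffunE => /prodf_neq0 d0; split=> [[t c]|t c c' e].
  rewrite ltnNge; apply/negP => it; have /eqP := d0 t isT; apply.
  rewrite (expand_det_row _ c) big1 // => a _; rewrite mxE.
  by rewrite eq_sym (ord_neq (ltn_ord a : (row_ord a < i)%N)) ?mul0r.
apply/eqP/negPn/negP => cc; have /eqP := d0 t isT; apply.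
by apply: (determinant_alternate cc) => a; rewrite !mxE e.
Qed.

Definition id_state : state := [ffun x => row_ord x.2].

Lemma hw_tensor_id : hw_tensor id_state = 1.
Proof.
rewrite ffunE big1 // => t _; rewrite (_ : block_mx_of _ _ = 1%:M) ?det1 //.
by apply/matrixP => c a; rewrite !mxE ffunE.
Qed.

(** ** Evaluation of words of lowering operators *)

(** The coefficient of psi tau in the word L applied to psi and evaluated at
    sg: the letters of L replace one after the other an entry b of the state
    by a, for some copy of C^(n+1). *)
Fixpoint ways (L : seq (posroot n)) sg tau : nat :=
  if L is al :: L' then
    \sum_(x : pos | sg x == (val al).2) ways L' (upd sg x (val al).1) tau
  else sg == tau.

Lemma fword_ways L psi sg :
  fword tensor_op L psi sg = \sum_tau (ways L sg tau)%:R * psi tau.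
Proof.
elim: L sg => [|al L IH] sg /=.
  rewrite (bigD1 sg) //= eqxx mul1r big1 ?addr0 // => tau.
  by rewrite eq_sym => /negbTE->; rewrite mul0r.
rewrite ffunE (eq_bigr _ (fun x _ => IH (upd sg x (val al).1))) exchange_big /=.
apply: eq_bigr => tau _.
by rewrite natr_sum mulr_suml.
Qed.

(** The number of copies in which passing from sg to tau replaces b by a. *)
Definition moves sg tau (al : posroot n) : nat :=
  #|[set x : pos | (sg x == (val al).2) && (tau x == (val al).1)]|.

Lemma moves_upd sg tau x (al be : posroot n) : grid i al -> grid i be ->
    sg x = (val be).2 -> tau x = (val be).1 ->
  moves sg tau al = ((be == al) + moves (upd sg x (val be).1) tau al)%N.
Proof.
move=> /andP[a1 a2] /andP[b1 b2] sx tx; rewrite /moves (cardsD1 x) !inE sx tx.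
congr (nat_of_bool _ + _)%N.
  apply/andP/eqP => [[/eqP e2 /eqP e1]|->]; last by rewrite !eqxx.
  exact: posrootI.
apply: eq_card => y; rewrite !inE; case: (eqVneq y x) => [->|yx] /=.
  by rewrite upd_same (ord_neq b1 a2).
by rewrite upd_neq.
Qed.

Lemma waysP L sg tau : all (grid i) L -> (forall x, (tau x < i)%N) ->
    ways L sg tau != 0%N ->
  (forall al, grid i al -> count_mem al L = moves sg tau al) /\
  (forall x, (sg x < i)%N -> tau x = sg x).
Proof.
move=> + ti; elim: L sg => [|be L IH] sg /=.
  move=> _; rewrite eqb0 negbK => /eqP->; split=> // al /andP[a1 a2]; apply/esym/eqP.
  rewrite cards_eq0; apply/eqP/setP => x; rewrite !inE.
  by rewrite (ord_neq (ti x) a2).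
move=> /andP[gb gL]; rewrite sum_nat_eq0 => /forall_inPn[x /eqP sx].
move=> /(IH _ gL)[h1 h2]; have /andP[b1 b2] := gb.
have tx : tau x = (val be).1 by rewrite h2 upd_same.
split=> [al ga|y yi]; first by rewrite (moves_upd ga gb sx tx) h1.
have yx : y != x by apply: contraTneq yi => ->; rewrite sx -leqNgt.
by rewrite h2 upd_neq.
Qed.

Lemma ways_gt0 L sg : all (grid i) L ->
    (forall x, (sg x < i)%N -> sg x = id_state x) ->
    (forall al, grid i al -> count_mem al L = moves sg id_state al) ->
  (0 < ways L sg id_state)%N.
Proof.
have ii x : (id_state x < i)%N by rewrite ffunE /=.
elim: L sg => [|be L IH] sg /=.
  move=> _ sid cnt; rewrite (_ : sg = id_state) ?eqxx //; apply/ffunP => x.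
  apply: sid; rewrite ltnNge; apply/negP => ix.
  have lt : (id_state x < sg x)%N by apply: leq_trans (ii x) ix.
  have := cnt (mkroot lt); rewrite /grid /= ii ix => /(_ isT)/esym/eqP.
  by rewrite cards_eq0 => /eqP/setP/(_ x); rewrite !inE !eqxx.
move=> /andP[gb gL] sid cnt; have /andP[b1 b2] := gb.
have : (0 < moves sg id_state be)%N by rewrite -cnt //= eqxx.
rewrite card_gt0 => /set0Pn[x]; rewrite inE => /andP[/eqP sx /eqP tx].
rewrite (bigD1 x) /= ?sx // addn_gt0; apply/orP; left; apply: IH => // [y|al ga].
  by case: (eqVneq y x) => [->|yx]; rewrite ?upd_same // upd_neq //; apply: sid.
by apply/eqP; rewrite -(eqn_add2l (be == al)) -(moves_upd ga gb sx tx) -cnt.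
Qed.

(** ** The leading state of a lattice point *)

Lemma sum_moves sg tau A B : (forall x, (tau x < i)%N) ->
  corner i A B [ffun al => moves sg tau al] =
  #|[set x : pos | [&& (i <= sg x)%N, (B <= sg x)%N & (A <= tau x)%N]]|.
Proof.
move=> ti; rewrite /corner.
under eq_bigr do rewrite ffunE /moves -sum1dep_card big_mkcond.
rewrite exchange_big -sum1dep_card [RHS]big_mkcond /=; apply: eq_bigr => x _.
rewrite -big_mkcondr /=; case: ifP => [/and3P[ix Bx Ax]|no]; last first.
  rewrite big_pred0 // => al; apply: contraFF no.
  by move=> /andP[/and3P[/andP[_ g] h1 h2] /andP[/eqP-> /eqP->]]; rewrite g h1 h2.
have lt : (tau x < sg x)%N by apply: leq_trans (ti x) ix.
rewrite (big_pred1 (mkroot lt)) // => al; apply/idP/eqP => [|->]; last first.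
  by rewrite /grid /= ti ix Ax Bx !eqxx.
by move=> /andP[_ /andP[/eqP e2 /eqP e1]]; apply: posrootI; rewrite /= ?e1 ?e2.
Qed.

Variable sgm : 'I_m -> I -> I.
Hypothesis sgm_fix : forall t a, (sgm t a < i)%N -> sgm t a = a.
Hypothesis sgm_incr : forall t (a a' : I), (a < a' < i)%N ->
  (i <= sgm t a)%N -> (i <= sgm t a')%N -> (sgm t a < sgm t a')%N.
Variable s : {ffun posroot n -> nat}.
Hypothesis s_sgm : forall al, grid i al ->
  s al = #|[set t | sgm t (val al).1 == (val al).2]|.

(** The state given by antichains, one for each tensor factor. *)
Definition lead_state : state := [ffun x => sgm x.1 (row_ord x.2)].

Lemma lead_moves al : grid i al -> moves lead_state id_state al = s al.
Proof.
move=> ga; rewrite s_sgm //; have /andP[a1 a2] := ga.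
pose h (t : 'I_m) : pos := (t, Ordinal a1).
have h_inj : injective h by move=> t t' [].
rewrite -(card_imset _ h_inj); apply: eq_card => -[t c]; rewrite !inE !ffunE /=.
apply/andP/imsetP => [[e1 /eqP e2]|[t' + [-> ->]]].
  have e : c = Ordinal a1 by apply/val_inj; rewrite /= -e2.
  by exists t; rewrite /h ?e // inE -e2.
rewrite inE => /eqP <-; split; last by apply/eqP/val_inj.
by apply/eqP; congr sgm; apply/val_inj.
Qed.

Lemma card_pos (P : pred pos) :
  #|[set x : pos | P x]| = (\sum_t #|[set c | P (t, c)]|)%N.
Proof.
rewrite -sum1dep_card (eq_bigr (fun t => \sum_(c | P (t, c)) 1)%N); last first.
  by move=> t _; rewrite sum1dep_card.
by rewrite pair_big_dep /=; apply: eq_bigl => -[].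
Qed.

(** From the leading state, the words with exponents s lead to the identity
    state, and a word that leads to another state where hw_tensor does not
    vanish has a smaller corner sum. *)
Lemma lead_lt tau : hw_tensor tau != 0 ->
    (forall x, (lead_state x < i)%N -> tau x = lead_state x) ->
  tau = id_state \/
  (corner_sum i [ffun al => moves lead_state tau al] < corner_sum i s)%N.
Proof.
move=> /hw_tensor_neq0[ti tinj] tfix.
have [->|ne] := eqVneq tau id_state; [by left|right].
pose f t (c : 'I_i) : 'I_i := Ordinal (ti (t, c)).
have f_inj t : injective (f t).
  by move=> c c' /(congr1 val) /= e; apply: (tinj t); apply/val_inj.
pose b t (c : 'I_i) : nat := sgm t (row_ord c).
have bE t c : lead_state (t, c) = b t c :> nat by rewrite ffunE.
have f_fix t c : (b t c < i)%N -> f t c = c.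
  move=> bi; apply/val_inj => /=; rewrite tfix bE //.
  by rewrite /b sgm_fix.
have b_incr t (c c' : 'I_i) : (c < c')%N -> (i <= b t c)%N -> (i <= b t c')%N ->
    (b t c < b t c')%N.
  by move=> cc; apply: sgm_incr; rewrite /= cc ltn_ord.
have ii x : (id_state x < i)%N by rewrite ffunE /=.
have cE A B : corner i A B s = corner i A B [ffun al => moves lead_state id_state al].
  by apply: eq_bigr => al /and3P[ga _ _]; rewrite ffunE lead_moves.
have le A B : (corner i A B [ffun al => moves lead_state tau al] <= corner i A B s)%N.
  rewrite cE !sum_moves // !card_pos; apply: leq_sum => t _.
  have := block_le (f_inj t) (f_fix t) (b_incr t) A B.
  by congr (_ <= _)%N; apply: eq_card => c; rewrite !inE ?bE // !ffunE.
have [t [c0 fc0]] : exists t c, f t c != c.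
  apply: contrapT => no; case/eqP: ne; apply/ffunP => -[t c]; rewrite ffunE /=.
  apply/val_inj => /=; apply/eqP/negPn/negP => fc; apply: no; exists t, c.
  by rewrite -val_eqE.
have [c lt] := block_lt (f_inj t) (f_fix t) (b_incr t) fc0.
have ltAB : (corner i c (b t c) [ffun al => moves lead_state tau al]
    < corner i c (b t c) s)%N.
  rewrite cE !sum_moves // !card_pos (bigD1 t) //= [ltnRHS](bigD1 t) //=.
  rewrite -addSn leq_add //.
    by move: lt; congr (_ < _)%N; apply: eq_card => d; rewrite !inE ?bE // !ffunE.
  apply: leq_sum => t' _.
  have := block_le (f_inj t') (f_fix t') (b_incr t') c (b t c).
  by congr (_ <= _)%N; apply: eq_card => d; rewrite !inE ?bE // !ffunE.
rewrite /corner_sum (bigD1 (row_ord c)) //= [ltnRHS](bigD1 (row_ord c)) //=.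
rewrite -addSn leq_add //; last by do 2!(apply: leq_sum => ? _).
rewrite (bigD1 (sgm t (row_ord c))) //= [ltnRHS](bigD1 (sgm t (row_ord c))) //=.
by rewrite -addSn leq_add //; apply: leq_sum => ? _.
Qed.

Lemma fword_lead L : all (grid i) L ->
  fword tensor_op L hw_tensor lead_state != 0 ->
  (forall al, grid i al -> count_mem al L = s al) \/
  (corner_sum i [ffun al => count_mem al L] < corner_sum i s)%N.
Proof.
move=> gL; rewrite fword_ways => nz.
have [tau /andP[w0 h0]] : exists tau, (ways L lead_state tau != 0%N) && (hw_tensor tau != 0).
  apply: contrapT => no; case/eqP: nz; apply: big1 => tau _.
  apply/eqP; rewrite mulf_eq0 pnatr_eq0 -[_ || _]negbK negb_or.
  by apply/negP => h; apply: no; exists tau.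
have [ti _] := hw_tensor_neq0 h0; have [cnt tfix] := waysP gL ti w0.
have [e|lt] := lead_lt h0 tfix.
  by left=> al ga; rewrite cnt // e lead_moves.
right; apply: leq_ltn_trans lt; apply/eq_leq/eq_bigr => A _; apply: eq_bigr => B _.
by apply: eq_bigr => al /and3P[ga _ _]; rewrite !ffunE cnt.
Qed.

Lemma fword_lead_neq0 L : all (grid i) L ->
    (forall al, grid i al -> count_mem al L = s al) ->
  fword tensor_op L hw_tensor lead_state != 0.
Proof.
move=> gL cL; rewrite fword_ways (bigD1 id_state) //= hw_tensor_id mulr1.
rewrite big1 ?addr0 => [|tau ne].
  rewrite pnatr_eq0 -lt0n ways_gt0 // => [x|al ga]; last by rewrite lead_moves ?cL.
  by rewrite !ffunE; apply: sgm_fix.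
apply/eqP; rewrite mulf_eq0 pnatr_eq0 -[_ || _]negbK negb_or.
apply/negP => /andP[w0 h0].
have [ti _] := hw_tensor_neq0 h0; have [cnt tfix] := waysP gL ti w0.
have [e|] := lead_lt h0 tfix; first by rewrite e eqxx in ne.
suff -> : corner_sum i [ffun al => moves lead_state tau al] = corner_sum i s.
  by rewrite ltnn.
apply/eq_bigr => A _; apply: eq_bigr => B _.
by apply: eq_bigr => al /and3P[ga _ _]; rewrite ffunE -cnt // cL.
Qed.

End Model.

(** * Linear extension from monomials *)

Section LinExt.
Variables (K : fieldType) (N : nat) (W : lmodType K) (h : 'X_{1..N} -> W).

Definition linext (p : {mpoly K[N]}) : W := \sum_(mu <- msupp p) p@_mu *: h mu.

Lemma linext_sup (r : seq 'X_{1..N}) p : uniq r -> {subset msupp p <= r} ->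
  linext p = \sum_(mu <- r) p@_mu *: h mu.
Proof.
move=> ur sr; rewrite (bigID (fun mu => mu \in msupp p)) /= [X in _ = _ + X]big1.
  rewrite addr0 -big_filter; apply: perm_big; apply: uniq_perm.
  - exact: msupp_uniq.
  - exact: filter_uniq.
  by move=> mu; rewrite mem_filter; case: (boolP (mu \in msupp p)) => // /sr->.
by move=> mu; rewrite mcoeff_msupp negbK => /eqP->; rewrite scale0r.
Qed.

Lemma linext_linear : linear linext.
Proof.
move=> c p q; pose r := undup (msupp (c *: p + q) ++ msupp p ++ msupp q).
have ur : uniq r := undup_uniq _.
rewrite !(linext_sup ur) => [|mu|mu|mu]; rewrite ?mem_undup ?mem_cat;
  try by move=> ->; rewrite ?orbT.
rewrite scaler_sumr -big_split /=; apply: eq_bigr => mu _.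
by rewrite mcoeffD mcoeffZ scalerDl scalerA.
Qed.

Lemma linextX mu : linext 'X_[mu] = h mu.
Proof. by rewrite /linext msuppX big_seq1 mcoeffX eqxx scale1r. Qed.

End LinExt.

(** A linear identity holds on polynomials once it holds on monomials. *)
Lemma mpoly_lclosed (K : fieldType) (N : nat) (P : {mpoly K[N]} -> Prop) p :
  lclosed P -> (forall mu, mu \in msupp p -> P 'X_[mu]) -> P p.
Proof.
move=> [P0 PL] PX; rewrite [p]mpolyE big_seq.
by apply: (big_ind P) => // [x y Px Py|mu /PX Pmu];
  [rewrite -[x]scale1r | rewrite -[_ *: _]addr0]; apply: PL.
Qed.

(** * Commuting operators *)

Section Commuting.
Variables (K : fieldType) (V : lmodType K) (I : finType) (T : I -> V -> V).
Hypotheses (linT : forall t, linear (T t)) (comT : forall t u y, T t (T u y) = T u (T t y)).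
Local Notation S := {mpoly K[#|I|]}.

(** The action of a monomial, with the order of the factors used in
    sym_act. *)
Definition monact (mu : 'X_{1..#|I|}) (y : V) : V :=
  foldr (fun t => iter (mu (enum_rank t)) (T t)) y (enum I).

Definition pact (p : S) (y : V) : V := linext (fun mu => monact mu y) p.

Lemma iter_comm t u k y : T t (iter k (T u) y) = iter k (T u) (T t y).
Proof. by elim: k => //= k <-; rewrite comT. Qed.

Lemma iter_iter t u k l y :
  iter l (T t) (iter k (T u) y) = iter k (T u) (iter l (T t) y).
Proof. by elim: l => //= l ->; rewrite iter_comm. Qed.

Lemma foldr_iter_comm (a : I -> nat) (r : seq I) u k y :
  foldr (fun t => iter (a t) (T t)) (iter k (T u) y) r =
  iter k (T u) (foldr (fun t => iter (a t) (T t)) y r).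
Proof. by elim: r => //= t r ->; rewrite iter_iter. Qed.

Lemma monactD mu nu y : monact (mu + nu)%MM y = monact mu (monact nu y).
Proof.
rewrite /monact; elim: (enum I) => //= t r ->.
by rewrite mnmDE iterD foldr_iter_comm.
Qed.

Lemma monact_linear mu : linear (monact mu).
Proof.
rewrite /monact => c x y; elim: (enum I) => //= t r ->.
by elim: (mu (enum_rank t)) => //= k ->; rewrite linT.
Qed.

Lemma pactE p y : pact p y = \sum_(mu <- msupp p) p@_mu *: monact mu y.
Proof. by []. Qed.

Lemma pact_linear y : linear (pact^~ y).
Proof. exact: linext_linear. Qed.

Lemma pact_linearr p : linear (pact p).
Proof.
move=> c x y; rewrite /pact /linext scaler_sumr -big_split /=.
apply: eq_bigr => mu _; rewrite monact_linear scalerDr !scalerA.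
by rewrite mulrC.
Qed.

Lemma pactX mu y : pact 'X_[mu] y = monact mu y.
Proof. exact: linextX. Qed.

Lemma pactM p q y : pact (p * q) y = pact p (pact q y).
Proof.
apply: (mpoly_lclosed (P := fun p => pact (p * q) y = pact p (pact q y))).
  split=> [|c p1 p2 e1 e2]; first by rewrite mul0r !(lin0 (pact_linear _)).
  by rewrite mulrDl -scalerAl !pact_linear e1 e2.
move=> mu _; apply: (mpoly_lclosed
    (P := fun q => pact ('X_[mu] * q) y = pact 'X_[mu] (pact q y))).
  split=> [|c p1 p2 e1 e2].
    by rewrite mulr0 !(lin0 (pact_linear _)) (lin0 (pact_linearr _)).
  by rewrite mulrDr -scalerAr !pact_linear pact_linearr e1 e2.
by move=> nu _; rewrite -mpolyXD !pactX monactD.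
Qed.

Lemma pact1 y : pact 1 y = y.
Proof.
rewrite -mpolyX0 pactX /monact; elim: (enum I) => //= t r ->.
by rewrite mnm0E.
Qed.

Lemma pactXi t y : pact 'X_(enum_rank t) y = T t y.
Proof.
rewrite pactX /monact; have : t \in enum I by rewrite mem_enum.
elim: (enum I) (enum_uniq I) => //= u r IH /andP[ur uniq_r].
rewrite inE mnm1E (inj_eq enum_rank_inj) => /predU1P[e|tr].
  subst u; rewrite eqxx /=; congr (T t _).
  elim: r ur {IH uniq_r} => //= u' r IH; rewrite inE negb_or => /andP[tu tr].
  by rewrite mnm1E (inj_eq enum_rank_inj) (negbTE tu) IH.
rewrite (_ : t == u = false) ?IH //=.
by apply/eqP => e; rewrite -e tr in ur.
Qed.

End Commuting.

(** * Root vectors *)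

Section Roots.
Variables (R : realType) (n : nat).
Local Notation C := R[i].
Local Notation M := 'M[C]_n.+1.
Implicit Types (al be : posroot n) (x y : M).

Lemma mem_sl x : (x \in sl n R) = (\tr x == 0).
Proof. by rewrite memv_ker lfunE. Qed.

Lemma cartan_diag (d : 'I_n.+1 -> C) : \sum_a d a = 0 ->
  \sum_a d a *: delta_mx a a \in cartan n R.
Proof.
move=> d0; rewrite memv_cap; apply/andP; split.
  rewrite mem_sl linear_sum /= -[X in _ == X]d0; apply/eqP/eq_bigr => a _.
  rewrite linearZ /= /mxtrace (bigD1 a) //= big1 ?addr0 => [|b ba].
    by rewrite mxE !eqxx mulr1.
  by rewrite mxE (negbTE ba).
apply: memv_suml => a _; apply/memvZ/memv_span.
by apply/imageP; exists a.
Qed.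

Lemma cartan_root (p q : 'I_n.+1) :
  delta_mx p p - delta_mx q q \in cartan n R.
Proof.
have -> : delta_mx p p - delta_mx q q =
    \sum_a ((a == p)%:R - (a == q)%:R) *: delta_mx a a :> M.
  under eq_bigr do rewrite scalerBl.
  rewrite sumrB (bigD1 p) //= eqxx scale1r big1 ?addr0; last first.
    by move=> a /negbTE->; rewrite scale0r.
  rewrite (bigD1 q) //= eqxx scale1r big1 ?addr0 //.
  by move=> a /negbTE->; rewrite scale0r.
apply: cartan_diag; rewrite sumrB (bigD1 p) //= eqxx big1 ?addr0; last first.
  by move=> a /negbTE->.
rewrite (bigD1 q) //= eqxx big1 ?addr0 ?subrr //.
by move=> a /negbTE->.
Qed.

Lemma cartan_mxE x (a b : 'I_n.+1) : x \in cartan n R -> a != b -> x a b = 0.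
Proof.
rewrite memv_cap => /andP[_ /coord_span ->] ab.
rewrite summxE big1 // => k _; rewrite mxE.
rewrite -tnth_nth.
have := mem_tnth k (image_tuple (fun a0 : 'I_n.+1 => delta_mx a0 a0 : M) 'I_n.+1).
move=> /imageP[c _ ->]; rewrite mxE.
case: (eqVneq a c) => [<-|]; rewrite ?mulr0 //= eq_sym (negbTE ab) mulr0 //.
Qed.

Lemma lie_diag x (p q a b : 'I_n.+1) :
  lie (delta_mx p p - delta_mx q q) x a b =
  ((a == p)%:R - (a == q)%:R - ((b == p)%:R - (b == q)%:R)) * x a b.
Proof.
rewrite /lie mulmxBl mulmxBr !mxE.
have e1 (p0 : 'I_n.+1) : \sum_j (delta_mx p0 p0 : M) a j * x j b = (a == p0)%:R * x a b.
  rewrite (bigD1 a) //= big1 ?addr0 => [|j ja]; rewrite mxE.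
    by case: (eqVneq a p0) => /=.
  by case: (eqVneq a p0) => [<-|_]; rewrite ?(negbTE ja) mul0r.
have e2 (p0 : 'I_n.+1) : \sum_j x a j * (delta_mx p0 p0 : M) j b = (b == p0)%:R * x a b.
  rewrite (bigD1 b) //= big1 ?addr0 => [|j jb]; rewrite mxE.
    by rewrite mulrC; case: (eqVneq b p0) => /=.
  by case: (eqVneq b p0) => [<-|_]; rewrite ?(negbTE jb) ?andbF mulr0.
by rewrite !e1 !e2; ring.
Qed.

(** Root spaces of sl are lines. *)
Lemma root_space x (r s : 'I_n.+1) : r != s ->
    (forall h, h \in cartan n R -> lie h x = (h r r - h s s) *: x) ->
  x = x r s *: delta_mx r s.
Proof.
move=> rs hx; apply/matrixP => a b; rewrite !mxE.
have E (p q : 'I_n.+1) : ((a == p)%:R - (a == q)%:R - ((b == p)%:R - (b == q)%:R)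
   - ((r == p)%:R - (r == q)%:R - ((s == p)%:R - (s == q)%:R))) * x a b = 0.
  have e := congr1 (fun A : M => A a b) (hx _ (cartan_root p q)).
  by rewrite lie_diag !mxE !andbb in e; rewrite mulrBl e subrr.
have cancel (c : C) : c * x a b = 0 -> c != 0 -> x a b = 0.
  by move=> /eqP; rewrite mulf_eq0 => /orP[->//|/eqP].
have [/andP[/eqP-> /eqP->]|no] := boolP ((a == r) && (b == s)); first by rewrite mulr1.
rewrite mulr0; case: (eqVneq a b) => ab.
  apply: (cancel _ (E r s)); rewrite -ab subrr !eqxx (negbTE rs) (eq_sym s) (negbTE rs).
  by rewrite !subr0 !sub0r opprK oppr_eq0 -mulr2n pnatr_eq0.
apply: (cancel _ (E a b)); rewrite !eqxx (negbTE ab) (eq_sym b) (negbTE ab).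
have -> : (1 - 0 - (0 - 1) - ((r == a)%:R - (r == b)%:R - ((s == a)%:R - (s == b)%:R)) : C)
    = (2 + (r == b) + (s == a))%:R - ((r == a) + (s == b))%:R.
  by rewrite !natrD; ring.
rewrite subr_eq0 eqr_nat; move: no; rewrite (eq_sym a) (eq_sym b s).
by case: (r == a) (s == b) (r == b) (s == a) => [] [] [] [].
Qed.

End Roots.

(** * The symmetric algebra of n^- *)

Section SumDelta.
Variables (K : pzRingType) (V : lmodType K) (I : finType).

Lemma sum_delta (b : I) (g : I -> V) : \sum_q (q == b)%:R *: g q = g b.
Proof.
rewrite (bigD1 b) //= eqxx scale1r big1 ?addr0 // => q /negbTE->.
by rewrite scale0r.
Qed.

End SumDelta.

(** An identity compatible with sums and products holds on all polynomials
    once it holds on the variables. *)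
Lemma mpoly_ring_ind (K : fieldType) (N : nat) (P : {mpoly K[N]} -> Prop) p :
  lclosed P -> P 1 -> (forall j, P 'X_j) ->
  (forall q r, P q -> P r -> P (q * r)) -> P p.
Proof.
move=> Pl P1 PX PM; apply: (mpoly_lclosed Pl) => mu _; rewrite mpolyXE_id.
apply: (big_ind P) => // j _.
by elim: (mu j) => [|k IH]; rewrite ?expr0 // exprS; apply: PM.
Qed.

Section RootAction.
Variables (R : realType) (n i m : nat).
Local Notation C := R[i].
Local Notation M := 'M[C]_n.+1.
Local Notation S := {mpoly C[#|posroot n|]}.
Variable f : posroot n -> M.
Hypothesis f_root : forall al, negroot_vector al (f al).
Implicit Types (al be : posroot n) (x y : M) (p q : S).

Definition root_coef al : C := f al (val al).2 (val al).1.

Lemma root_vectorE al :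
  f al = root_coef al *: delta_mx (val al).2 (val al).1.
Proof.
have [_ _ e] := f_root al; apply: root_space => [|h hc].
  by rewrite neq_ltn posrootP orbT.
by rewrite e // /root_wt opprB.
Qed.

Lemma root_coef_neq0 al : root_coef al != 0.
Proof.
have [_ + _] := f_root al; apply: contraNneq => e.
by rewrite root_vectorE e scale0r.
Qed.

(** ** Derivations *)

Lemma nminus_class_linear : linear (nminus_class f).
Proof.
move=> c x y; rewrite /nminus_class scaler_sumr -big_split /=.
by apply: eq_bigr => al _; rewrite !mxE mulrDl scalerDl scalerA mulrA.
Qed.

Lemma lie_linear x : linear (lie x).
Proof.
move=> c y z; rewrite /lie mulmxDr mulmxDl -scalemxAr -scalemxAl.
by rewrite scalerBr opprD addrACA.
Qed.

Lemma der_linear x : linear (der f x).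
Proof.
move=> c p q; rewrite /der scaler_sumr -big_split /=.
by apply: eq_bigr => al _; rewrite mderivD mderivZ mulrDr scalerAr.
Qed.

Lemma derM x p q : der f x (p * q) = der f x p * q + p * der f x q.
Proof.
rewrite /der mulr_suml mulr_sumr -big_split /=; apply: eq_bigr => al _.
by rewrite mderivM mulrDr; congr (_ + _); rewrite ?mulrA // [p * _]mulrC.
Qed.

Lemma der1 x : der f x 1 = 0.
Proof.
by rewrite /der big1 // => al _; rewrite -mpolyC1 mderivC mulr0.
Qed.

Lemma der_svar x al : der f x (svar R al) = nminus_class f (lie x (f al)).
Proof.
rewrite /der (bigD1 al) //= big1 ?addr0 => [|be ba].
  rewrite mderivX mnm1E eqxx scale1r (_ : (_ - _)%MM = 0%MM) ?mpolyX0 ?mulr1 //.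
  by apply/mnmP => j; rewrite mnmBE mnm0E subnn.
by rewrite mderivX mnm1E (inj_eq enum_rank_inj) eq_sym (negbTE ba) scale0r mulr0.
Qed.

Lemma der_prod x (J : eqType) (r : seq J) (g : J -> S) : uniq r ->
  der f x (\prod_(k <- r) g k) =
  \sum_(k <- r) \prod_(l <- r) (if l == k then der f x (g l) else g l).
Proof.
elim: r => [|k r IH] /=; first by rewrite !big_nil der1.
move=> /andP[kr ur]; rewrite !big_cons derM IH // eqxx; congr (_ * _ + _).
  by apply: eq_big_seq => l lr; case: eqP => // e; rewrite -e lr in kr.
rewrite mulr_sumr; apply: eq_big_seq => l lr.
by rewrite big_cons; case: eqP => // e; rewrite e lr in kr.
Qed.

(** ** The action of S(n^-) on a highest weight vector *)

Section Action.
Variables (V : lmodType C) (X : 'I_n.+1 -> 'I_n.+1 -> V -> V) (v : V).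
Hypotheses (glX : gl_system X) (hwv : hw_vector i m X v).

(** The root vectors of the Levi subalgebra act by zero, as they do on v; the
    others commute, so that S(n^-) acts. *)
Definition root_op al (y : V) : V :=
  if grid i al then root_coef al *: X (val al).2 (val al).1 y else 0.

Lemma root_op_linear al : linear (root_op al).
Proof.
move=> c y z; rewrite /root_op; case: ifP; last by rewrite scaler0 addr0.
by rewrite (glP glX) scalerDr !scalerA mulrC.
Qed.

Lemma root_op_comm al be (y : V) : root_op al (root_op be y) = root_op be (root_op al y).
Proof.
rewrite /root_op; case: ifP => ga; case: ifP => gb; rewrite ?(gl0 glX) ?scaler0 //.
by rewrite !(glZ glX) (grid_comm glX y ga gb) !scalerA mulrC.
Qed.

Local Notation pact := (pact root_op).

Lemma pact_svar al (y : V) : pact (svar R al) y = root_op al y.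
Proof. exact: pactXi. Qed.

Lemma sum_grid (g : 'I_n.+1 -> 'I_n.+1 -> V) :
  \sum_(al | grid i al) g (val al).1 (val al).2 =
  \sum_(a : 'I_n.+1 | (a < i)%N) \sum_(b : 'I_n.+1 | (i <= b)%N) g a b.
Proof.
rewrite pair_big_dep /= (reindex_omap (fun al => val al) insub) /=.
  by apply: eq_bigl => al; rewrite -[sval al]/(val al) valK eqxx andbT.
by move=> p /andP[h1 h2]; rewrite insubT //; apply: leq_trans h1 h2.
Qed.

Lemma pact_nminus_class x (y : V) : pact (nminus_class f x) y =
  \sum_(a : 'I_n.+1 | (a < i)%N) \sum_(b : 'I_n.+1 | (i <= b)%N) x b a *: X b a y.
Proof.
rewrite -sum_grid (lin_sum (pact_linear _ y)) [RHS]big_mkcond /=.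
apply: eq_bigr => al _; rewrite (linZ (pact_linear _ y)) pact_svar /root_op.
case: ifP => _; last by rewrite scaler0.
by rewrite scalerA divfK // root_coef_neq0.
Qed.

(** The part of x in the Levi subalgebra. *)
Definition levi_op x (y : V) : V :=
  \sum_(p : 'I_n.+1) \sum_(q : 'I_n.+1 | (p < i)%N == (q < i)%N) x p q *: X p q y.

Lemma levi_op_linear x : linear (levi_op x).
Proof.
move=> c y z; rewrite /levi_op scaler_sumr -big_split; apply: eq_bigr => p _.
rewrite scaler_sumr -big_split; apply: eq_bigr => q _ /=.
by rewrite (glP glX) scalerDr !scalerA mulrC.
Qed.

Definition upper x : Prop := forall p q : 'I_n.+1, (q <= p)%N -> x p q = 0.

Lemma nplus_upper x : x \in nplus n R -> upper x.
Proof.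
move=> /coord_span-> p q qp; rewrite summxE big1 // => k _; rewrite mxE.
rewrite -tnth_nth; have := mem_tnth k (image_tuple (fun al : posroot n =>
  delta_mx (val al).1 (val al).2 : M) (posroot n)).
move=> /imageP[al _ ->]; rewrite mxE; case: eqP => [e1|]; rewrite ?mulr0 //.
case: eqP => [e2|]; rewrite ?mulr0 //=.
by have := posrootP al; rewrite -e1 -e2 ltnNge qp.
Qed.

Lemma lie_root_entry x al (d c : 'I_n.+1) :
  lie x (f al) d c = root_coef al *
    (x d (val al).2 * (c == (val al).1)%:R - (d == (val al).2)%:R * x (val al).1 c).
Proof.
rewrite root_vectorE (linZ (lie_linear x)) !mxE; congr (_ * (_ - _)).
  rewrite (bigD1 (val al).2) //= mxE eqxx big1 ?addr0 // => j /negbTE ne.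
  by rewrite mxE ne mulr0.
rewrite (bigD1 (val al).1) //= mxE eqxx andbT big1 ?addr0 // => j /negbTE ne.
by rewrite mxE ne andbF mul0r.
Qed.

(** The derivation of S(n^-) defined by x in n^+ corresponds to the
    commutator with the Levi part of x. *)
Lemma pact_lie x al (y : V) : upper x ->
  pact (nminus_class f (lie x (f al))) y =
  levi_op x (root_op al y) - root_op al (levi_op x y).
Proof.
move=> ux; rewrite pact_nminus_class.
have -> : \sum_(c : 'I_n.+1 | (c < i)%N) \sum_(d : 'I_n.+1 | (i <= d)%N)
      lie x (f al) d c *: X d c y =
   root_coef al *: (\sum_(c : 'I_n.+1 | (c < i)%N) (c == (val al).1)%:R *:
       \sum_(d : 'I_n.+1 | (i <= d)%N) x d (val al).2 *: X d c y
     - \sum_(d : 'I_n.+1 | (i <= d)%N) (d == (val al).2)%:R *: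
       \sum_(c : 'I_n.+1 | (c < i)%N) x (val al).1 c *: X d c y).
  under [X in _ *: (_ - X)]eq_bigr do rewrite scaler_sumr.
  rewrite [X in _ *: (_ - X)]exchange_big /= -sumrB scaler_sumr.
  apply: eq_bigr => c _; rewrite scaler_sumr -sumrB scaler_sumr.
  apply: eq_bigr => d _; rewrite lie_root_entry !scalerA -scalerBl scalerA.
  by rewrite [(c == _)%:R * _]mulrC.
have dl (P : pred 'I_n.+1) b (g : 'I_n.+1 -> V) :
    \sum_(c | P c) (c == b)%:R *: g c = (P b)%:R *: g b.
  rewrite big_mkcond /= -[RHS](sum_delta b (fun c => (P c)%:R *: g c)).
  by apply: eq_bigr => c _; case: (P c); rewrite ?scale1r // scale0r scaler0.
rewrite !dl /root_op; case: ifP => [ga|nga]; last first.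
  rewrite (lin0 (levi_op_linear x)) subr0; apply/eqP; rewrite scaler_eq0.
  apply/orP; right; rewrite subr_eq0; apply/eqP.
  have lt := posrootP al; move: nga; rewrite /grid.
  case: (ltnP (val al).1 i) => /= [ai ib|ia _].
    rewrite ib scale0r scale1r big1 // => d id; rewrite ux ?scale0r //.
    by apply: ltnW; move: ib id; rewrite leqNgt => /negbFE; exact: leq_trans.
  rewrite scale0r [in RHS]big1 ?scaler0 // => c ci.
  by rewrite ux ?scale0r //; apply: ltnW; exact: leq_trans ci ia.
have /andP[ai ib] := ga; rewrite ai ib !scale1r (linZ (levi_op_linear x)) -scalerBr.
have cancel (a b c : V) : a + b - c - a = b - c.
  by rewrite addrAC [a + b]addrC addrK.
congr (_ *: _); rewrite /levi_op (gl_sum glX) -sumrB.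
under [RHS]eq_bigr => p _.
  rewrite (gl_sum glX) -sumrB.
  under eq_bigr => q _.
    rewrite (glZ glX) -scalerBr (glC glX) cancel scalerBr.
    over.
  rewrite sumrB; over.
rewrite sumrB; congr (_ - _).
  rewrite big_mkcond; apply: eq_bigr => p _ /=.
  under eq_bigr do rewrite scalerA mulrC -scalerA.
  rewrite dl [((val al).2 < i)%N]ltnNge ib /= eqbF_neg -leqNgt.
  by case: (i <= p)%N; rewrite ?scale1r ?scale0r.
rewrite [RHS](bigD1 (val al).1) //= [X in _ = _ + X]big1 ?addr0.
  rewrite /= in ai; rewrite ai; apply: eq_big => [q|q _]; first by rewrite eq_sym eqb_id.
  by rewrite eqxx scale1r.
move=> p /negbTE pa; apply: big1 => q _.
by rewrite eq_sym pa scale0r scaler0.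
Qed.

Lemma svar_enum_val (j : 'I_#|posroot n|) : 'X_j = svar R (enum_val j).
Proof. by rewrite /svar enum_valK. Qed.

(** Both sides are derivations in p. *)
Lemma pact_der x p (y : V) : upper x ->
  pact (der f x p) y = levi_op x (pact p y) - pact p (levi_op x y).
Proof.
move=> ux; move: p y; have linL := levi_op_linear x.
have pactM := pactM root_op_linear root_op_comm.
have pl := pact_linearr root_op_linear.
move=> p; apply: (mpoly_ring_ind (P := fun p => forall y : V,
    pact (der f x p) y = levi_op x (pact p y) - pact p (levi_op x y))).
- split=> [y|c p1 p2 e1 e2 y].
    by rewrite (lin0 (der_linear x)) !(lin0 (pact_linear _ _)) (lin0 linL) subrr.
  rewrite der_linear !pact_linear e1 e2 linL scalerBr !addrA.
  by rewrite opprD addrACA !addrA.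
- by move=> y; rewrite der1 !pact1 (lin0 (pact_linear _ _)) subrr.
- by move=> j y; rewrite svar_enum_val der_svar !pact_svar pact_lie.
move=> p1 p2 e1 e2 y; rewrite derM (linD (pact_linear _ _)) !pactM e1 e2.
by rewrite (linB (pl _)) addrA subrK.
Qed.

Lemma levi_op_hw x : upper x -> levi_op x v = 0.
Proof.
move=> ux; apply: big1 => p _; apply: big1 => q /eqP pq.
have [qp|pq'] := leqP q p; first by rewrite ux // scale0r.
rewrite hwv; first by rewrite -val_eqE (ltn_eqF pq') muln0 scale0r scaler0.
by rewrite -pq leqNgt andNb.
Qed.

(** An element killing v generates an n^+-module of elements killing v,
    because the Levi part of n^+ kills v. *)
Lemma nplus_module_null (G : S -> Prop) p : (forall q, G q -> pact q v = 0) ->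
  nplus_module f G p -> pact p v = 0.
Proof.
move=> G0; elim=> {p} [p /G0 //||c p q _ ep _ eq|x p xn _ ep].
- exact: lin0 (pact_linear _ _).
- by rewrite pact_linear ep eq scaler0 addr0.
have ux := nplus_upper xn.
by rewrite pact_der // ep levi_op_hw // (lin0 (levi_op_linear x))
  (lin0 (pact_linearr root_op_linear _)) subrr.
Qed.

Lemma root_op_gword al (y : V) d : gword i X v d y -> gword i X v d.+1 (root_op al y).
Proof.
move=> gy; rewrite /root_op; case: ifP => [/andP[a1 a2]|_]; last exact: Gword_0.
by apply/gwordZ/Gword_X.
Qed.

Lemma monact_gword mu (y : V) d : gword i X v d y ->
  gword i X v (mdeg mu + d) (monact root_op mu y).
Proof.
move=> gy; have -> : mdeg mu = (\sum_(al <- enum (posroot n)) mu (enum_rank al))%N.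
  rewrite mdegE big_enum [LHS](reindex (@enum_rank (posroot n))) //=.
  exact/onW_bij/enum_rank_bij.
rewrite /monact; elim: (enum _) => [|al r IH]; first by rewrite big_nil.
rewrite big_cons -addnA /=; elim: (mu _) => [|k IHk] //=.
by rewrite addSn; apply: root_op_gword.
Qed.

Definition word_of (mu : 'X_{1..#|posroot n|}) : seq (posroot n) :=
  flatten [seq nseq (mu (enum_rank al)) al | al <- enum (posroot n)].

Definition coef_of (mu : 'X_{1..#|posroot n|}) : C :=
  \prod_(al <- enum (posroot n)) root_coef al ^+ mu (enum_rank al).

Lemma coef_of_neq0 mu : coef_of mu != 0.
Proof.
rewrite prodf_seq_neq0; apply/allP => al _; by rewrite expf_neq0 // root_coef_neq0.
Qed.

Lemma count_word_of (mu : 'X_{1..#|posroot n|}) al :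
  count_mem al (word_of mu) = mu (enum_rank al).
Proof.
rewrite /word_of count_flatten -map_comp sumnE big_map big_enum /=.
rewrite (bigD1 al) //= count_nseq /= eqxx mul1n big1 ?addn0 // => be /negbTE ne.
by rewrite count_nseq /= ne.
Qed.

(** A monomial acts as a word, up to the scalars between f_alpha and E_(b,a). *)
Lemma monact_fword (mu : 'X_{1..#|posroot n|}) (y : V) :
    (forall al, ~~ grid i al -> mu (enum_rank al) = 0%N) ->
  monact root_op mu y = coef_of mu *: fword X (word_of mu) y.
Proof.
move=> gmu; rewrite /monact /coef_of /word_of /fword.
elim: (enum _) => [|al r IH] /=; first by rewrite big_nil scale1r.
rewrite big_cons IH foldr_cat -scalerA.
elim: (mu _) (gmu al) => [|k IHk] h /=; first by rewrite expr0 scale1r.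
have ga : grid i al by apply: contraT => /h.
rewrite IHk; last by rewrite ga.
by rewrite /root_op ga !(glZ glX) !scalerA exprS mulrA.
Qed.

Lemma word_of_grid (mu : 'X_{1..#|posroot n|}) :
    (forall al, ~~ grid i al -> mu (enum_rank al) = 0%N) ->
  all (grid i) (word_of mu).
Proof.
move=> gmu; apply/allP => al; rewrite -has_pred1 has_count count_word_of.
by rewrite lt0n; apply: contraNT => /gmu->.
Qed.

End Action.

Lemma pact_exp (V : vectType C) (X : 'I_n.+1 -> 'I_n.+1 -> V -> V) v al :
    gl_system X -> hw_vector i m X v -> grid i al ->
  pact (root_op X) (svar R al ^+ m.+1) v = 0.
Proof.
move=> glX hwv ga; have /andP[a1 a2] := ga.
have -> : pact (root_op X) (svar R al ^+ m.+1) v =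
    root_coef al ^+ m.+1 *: iter m.+1 (X (val al).2 (val al).1) v.
  elim: m.+1 => [|k IH]; first by rewrite !expr0 scale1r pact1.
  rewrite !exprS (pactM (root_op_linear glX) (root_op_comm glX)) IH pact_svar //.
  by rewrite /root_op ga (glZ glX) scalerA.
have ne : (val al).1 != (val al).2 by rewrite (ord_neq a1 a2).
rewrite (sl2_nilpotent (ca := m%:R) (cb := 0) glX ne) ?scaler0 ?subr0 //.
- by rewrite hwv ?(negbTE ne) ?muln0 ?scale0r // leqNgt a1.
- by rewrite hwv ?eqxx ?a1 ?muln1 // leqNgt a1.
- by rewrite hwv ?eqxx ?ltnNge ?a2 ?muln0 ?scale0r // ltnNge a2 andbF.
Qed.

End RootAction.

(** * Permanents *)

Section Permanents.
Variables (R : realType) (n i m : nat).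
Local Notation C := R[i].
Local Notation M := 'M[C]_n.+1.
Local Notation S := {mpoly C[#|posroot n|]}.
Variable f : posroot n -> M.
Hypothesis f_root : forall al, negroot_vector al (f al).
Implicit Types (al be : posroot n) (x y : M) (p q : S).

Local Notation root_coef := (root_coef f).

(** The multiple of the variable of the root (a, b) corresponding to the
    elementary matrix E_(b, a). *)
Definition zvar (a b : 'I_n.+1) : S := nminus_class f (delta_mx b a).

Lemma zvarE al : zvar (val al).1 (val al).2 = (root_coef al)^-1 *: svar R al.
Proof.
rewrite /zvar /nminus_class (bigD1 al) //= mxE !eqxx div1r big1 ?addr0 // => be ne.
rewrite mxE; case: eqP => [e2|]; rewrite ?mul0r ?scale0r //.
case: eqP => [e1|]; rewrite ?mul0r ?scale0r //.
by case/eqP: ne; apply: posrootI.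
Qed.

Lemma lie_delta (p q b a : 'I_n.+1) :
  lie (delta_mx p q) (delta_mx b a) =
  (q == b)%:R *: delta_mx p a - (a == p)%:R *: delta_mx b q :> M.
Proof. by rewrite /lie !mul_delta_mx_cond !scaler_nat. Qed.

Lemma der_zvar x (a b : 'I_n.+1) : (a < b)%N ->
  der f x (zvar a b) = nminus_class f (lie x (delta_mx b a)).
Proof.
move=> ab; rewrite (zvarE (mkroot ab)) (linZ (der_linear f x)) der_svar.
rewrite -(linZ (nminus_class_linear f)) (root_vectorE f_root) (linZ (lie_linear x)) scalerA.
by rewrite mulVf ?scale1r // (root_coef_neq0 f_root).
Qed.

Lemma der_zvar_row (p q a b : 'I_n.+1) : (a < i)%N -> (i <= b)%N -> (q < i)%N ->
  der f (delta_mx p q) (zvar a b) = - ((a == p)%:R *: zvar q b).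
Proof.
move=> ai ib qi; rewrite der_zvar ?(leq_trans ai ib) // lie_delta.
rewrite (ord_neq qi ib) scale0r sub0r -scaleN1r !(linZ (nminus_class_linear f)).
by rewrite scaleN1r.
Qed.

Lemma der_zvar_col (p q a b : 'I_n.+1) : (a < i)%N -> (i <= b)%N -> (i <= p)%N ->
  der f (delta_mx p q) (zvar a b) = (q == b)%:R *: zvar a p.
Proof.
move=> ai ib ip; rewrite der_zvar ?(leq_trans ai ib) // lie_delta.
by rewrite (ord_neq ai ip) scale0r subr0 (linZ (nminus_class_linear f)).
Qed.

Section Permanent.
Variable N : nat.
Implicit Types (A B : 'I_N -> 'I_n.+1).

Definition perm_poly A B : S := \sum_(s : 'S_N) \prod_k zvar (A k) (B (s k)).

Definition replace_at A (k : 'I_N) (q : 'I_n.+1) : 'I_N -> 'I_n.+1 :=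
  fun l => if l == k then q else A l.

Lemma eq_perm_poly A A' B B' : A =1 A' -> B =1 B' -> perm_poly A B = perm_poly A' B'.
Proof.
move=> eA eB; apply: eq_bigr => s _; apply: eq_bigr => k _.
by rewrite eA eB.
Qed.

Lemma perm_poly_row A B (s : 'S_N) : perm_poly (A \o s) B = perm_poly A B.
Proof.
rewrite /perm_poly (reindex_inj (mulgI s)) /=; apply: eq_bigr => t _.
rewrite [RHS](reindex_inj (@perm_inj _ s)) /=.
by apply: eq_bigr => k _; rewrite permM.
Qed.

Lemma perm_poly_col A B (s : 'S_N) : perm_poly A (B \o s) = perm_poly A B.
Proof.
rewrite /perm_poly [RHS](reindex_inj (mulIg s)) /=; apply: eq_bigr => t _.
by apply: eq_bigr => k _; rewrite permM.
Qed.

Lemma replace_at_tperm A (k l : 'I_N) (q : 'I_n.+1) : A k = A l ->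
  replace_at A l q =1 replace_at A k q \o tperm k l.
Proof.
move=> e j; rewrite /replace_at /=; case: tpermP => [->|->|/eqP nk /eqP nl].
- by case: (eqVneq k l).
- by rewrite !eqxx.
by rewrite (negbTE nk) (negbTE nl).
Qed.

Lemma der_perm_row A B (p q : 'I_n.+1) : (q < i)%N ->
    (forall k, A k < i)%N -> (forall k, i <= B k)%N ->
  der f (delta_mx p q) (perm_poly A B) =
  - \sum_(k | A k == p) perm_poly (replace_at A k q) B.
Proof.
move=> qi Ai iB; rewrite (lin_sum (der_linear f _)) [in RHS]exchange_big -[RHS]sumrN /=.
apply: eq_bigr => s _; rewrite der_prod ?index_enum_uniq // -sumrN [RHS]big_mkcond.
apply: eq_bigr => k _; rewrite (bigD1 k) //= eqxx der_zvar_row //.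
case: eqP => _; last by rewrite scale0r oppr0 mul0r.
rewrite scale1r mulNr [in RHS](bigD1 k) //= /replace_at eqxx; congr (- (_ * _)).
by apply: eq_bigr => l /negbTE->.
Qed.

Lemma der_perm_col A B (p q : 'I_n.+1) : (i <= p)%N ->
    (forall k, A k < i)%N -> (forall k, i <= B k)%N ->
  der f (delta_mx p q) (perm_poly A B) =
  \sum_(k | B k == q) perm_poly A (replace_at B k p).
Proof.
move=> ip Ai iB; rewrite (lin_sum (der_linear f _)) [RHS]exchange_big /=.
apply: eq_bigr => s _; rewrite der_prod ?index_enum_uniq // [RHS]big_mkcond.
rewrite [RHS](reindex_inj (@perm_inj _ s)) /=.
apply: eq_bigr => k _; rewrite (bigD1 k) //= eqxx der_zvar_col // eq_sym.
case: eqP => _; last by rewrite scale0r mul0r.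
rewrite scale1r [RHS](bigD1 k) //= /replace_at eqxx; congr (_ * _).
by apply: eq_bigr => l /negbTE lk; rewrite lk (inj_eq perm_inj) lk.
Qed.

Section InModule.
Variable G : S -> Prop.
Local Notation Nmod := (nplus_module f G).

Lemma nplus_moduleZ c p : Nmod p -> Nmod (c *: p).
Proof. by move=> np; rewrite -[_ *: _]addr0; apply/NplusLin/NplusZero. Qed.

Lemma delta_nplus (p q : 'I_n.+1) : (p < q)%N -> delta_mx p q \in nplus n R.
Proof. by move=> pq; apply/memv_span/imageP; exists (mkroot pq). Qed.

Lemma perm_poly_set_row A B k (q : 'I_n.+1) : (A k < q < i)%N ->
    (forall l, A l < i)%N -> (forall l, i <= B l)%N ->
  Nmod (perm_poly A B) -> Nmod (perm_poly (replace_at A k q) B).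
Proof.
move=> /andP[Aq qi] Ai iB np.
have := NplusDer (delta_nplus Aq) np; rewrite der_perm_row //.
rewrite (eq_bigr (fun=> perm_poly (replace_at A k q) B)) => [|l /eqP Al]; last first.
  by rewrite (eq_perm_poly (replace_at_tperm q (esym Al)) (frefl B)) perm_poly_row.
rewrite sumr_const -scaler_nat -scaleNr => /(nplus_moduleZ (- #|[pred l | A l == A k]|%:R)^-1).
rewrite scalerA mulVf ?scale1r // oppr_eq0 pnatr_eq0 -lt0n.
by apply/card_gt0P; exists k; rewrite inE.
Qed.

Lemma perm_poly_set_col A B k (p : 'I_n.+1) : (i <= p < B k)%N ->
    (forall l, A l < i)%N -> (forall l, i <= B l)%N ->
  Nmod (perm_poly A B) -> Nmod (perm_poly A (replace_at B k p)).
Proof.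
move=> /andP[ip pB] Ai iB np.
have := NplusDer (delta_nplus pB) np; rewrite der_perm_col //.
rewrite (eq_bigr (fun=> perm_poly A (replace_at B k p))) => [|l /eqP Bl]; last first.
  by rewrite (eq_perm_poly (frefl A) (replace_at_tperm p (esym Bl))) perm_poly_col.
rewrite sumr_const -scaler_nat => /(nplus_moduleZ (#|[pred l | B l == B k]|%:R)^-1).
rewrite scalerA mulVf ?scale1r // pnatr_eq0 -lt0n.
by apply/card_gt0P; exists k; rewrite inE.
Qed.

(** Starting from N! times a power of one variable, the rows and the columns
    are replaced one at a time: by symmetry, all terms of the derivative of a
    permanent are equal. *)
Lemma perm_poly_nplus (a0 b0 : 'I_n.+1) A B : (0 < N)%N -> Nmod (zvar a0 b0 ^+ N) ->
    (forall k, a0 <= A k < i)%N -> (forall k, i <= B k <= b0)%N ->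
  Nmod (perm_poly A B).
Proof.
move=> N0 np hA hB; have k0 : 'I_N := Ordinal N0.
have a0i : (a0 < i)%N by have := hA k0; lia.
have ib0 : (i <= b0)%N by have := hB k0; lia.
pose Aj j (k : 'I_N) := if (k < j)%N then A k else a0.
pose Bj j (k : 'I_N) := if (k < j)%N then B k else b0.
have start : Nmod (perm_poly (fun=> a0) (fun=> b0)).
  rewrite (_ : perm_poly _ _ = #|'S_N|%:R *: (zvar a0 b0 ^+ N)); first exact: nplus_moduleZ.
  transitivity (\sum_(s : 'S_N) zvar a0 b0 ^+ N); last first.
    by rewrite sumr_const scaler_nat.
  by apply: eq_bigr => s _; rewrite prodr_const card_ord.
have rows j : (j <= N)%N -> Nmod (perm_poly (Aj j) (fun=> b0)).
  elim: j => [_|j IH jN]; first by rewrite (eq_perm_poly (A' := fun=> a0) (B' := fun=> b0)).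
  have {IH} := IH (ltnW jN); pose k := Ordinal jN.
  have e : Aj j.+1 =1 replace_at (Aj j) k (A k).
    move=> l; rewrite /Aj /replace_at ltnS leq_eqVlt -val_eqE /=.
    by case: eqP => //= e; congr A; apply/val_inj.
  rewrite (eq_perm_poly e (frefl _)).
  have Ak : Aj j k = a0 by rewrite /Aj ltnn.
  have := hA k; rewrite leq_eqVlt => /andP[/orP[/eqP/val_inj ek|lt] Ai]; last first.
    apply: perm_poly_set_row => // [|l]; first by rewrite Ak lt.
    by rewrite /Aj; case: ifP => // _; case/andP: (hA l).
  rewrite (eq_perm_poly (A' := Aj j) (B' := fun=> b0)) // => l.
  by rewrite /replace_at; case: eqP => // ->; rewrite Ak ek.
have rowsA : Nmod (perm_poly A (fun=> b0)).
  rewrite (eq_perm_poly (A' := Aj N) (B' := fun=> b0)) // => [|k].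
    exact: rows.
  by rewrite /Aj ltn_ord.
have cols j : (j <= N)%N -> Nmod (perm_poly A (Bj j)).
  elim: j => [_|j IH jN]; first by rewrite (eq_perm_poly (A' := A) (B' := fun=> b0)).
  have {IH} := IH (ltnW jN); pose k := Ordinal jN.
  have e : Bj j.+1 =1 replace_at (Bj j) k (B k).
    move=> l; rewrite /Bj /replace_at ltnS leq_eqVlt -val_eqE /=.
    by case: eqP => //= e; congr B; apply/val_inj.
  rewrite (eq_perm_poly (frefl A) e).
  have Bk : Bj j k = b0 by rewrite /Bj ltnn.
  have := hB k; rewrite [(B k <= b0)%N]leq_eqVlt => /andP[ib /orP[/eqP/val_inj ek|lt]]; last first.
    apply: perm_poly_set_col => // [|l|l]; first by rewrite Bk ib lt.
      by case/andP: (hA l).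
    by rewrite /Bj; case: ifP => // _; case/andP: (hB l).
  rewrite (eq_perm_poly (A' := A) (B' := Bj j)) // => l.
  by rewrite /replace_at; case: eqP => // ->; rewrite Bk ek.
rewrite (eq_perm_poly (A' := A) (B' := Bj N)) // => [|k]; first exact: cols.
by rewrite /Bj ltn_ord.
Qed.

End InModule.
End Permanent.
End Permanents.

(** * Corner sums of contingency tables *)

Section Tables.
Variables (n i : nat).
Local Notation expn := {ffun posroot n -> nat}.
Implicit Types (s t : expn) (al be : posroot n).

(** Inclusion and exclusion for four quadrants recovers an entry. *)
Lemma corner_step s al : grid i al ->
  (s al + (corner i (val al).1.+1 (val al).2 s
          + corner i (val al).1 (val al).2.+1 s) =
  corner i (val al).1 (val al).2 s + corner i (val al).1.+1 (val al).2.+1 s)%N.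
Proof.
move=> ga; have -> : s al = (\sum_(be | grid i be) (be == al) * s be)%N.
  rewrite (bigD1 al) //= eqxx mul1n big1 ?addn0 // => be /andP[_ /negbTE->].
  by rewrite mul0n.
rewrite /corner !(big_mkcondr _ _ (grid i)) /= -!big_split /=.
apply: eq_bigr => be gb.
have -> : (be == al) = ((val al).1 == (val be).1 :> nat) && ((val al).2 == (val be).2 :> nat).
  apply/eqP/andP => [->|[/eqP e1 /eqP e2]]; first by rewrite !eqxx.
  by apply: posrootI; apply/val_inj.
case: (ltngtP (val al).1 (val be).1); case: (ltngtP (val al).2 (val be).2) => //=; lia.
Qed.

Lemma corner_out s A B : (n < A)%N || (n < B)%N -> corner i A B s = 0%N.
Proof.
move=> AB; apply: big1 => al /and3P[_ h1 h2].
have := ltn_ord (val al).1; have := ltn_ord (val al).2; move: AB h1 h2.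
by move: (val al).1 (val al).2 => a b; lia.
Qed.

Lemma corner_inj s t : (forall al, ~~ grid i al -> s al = 0%N) ->
    (forall al, ~~ grid i al -> t al = 0%N) ->
    (forall A B, corner i A B s = corner i A B t) ->
  s = t.
Proof.
move=> s0 t0 e; apply/ffunP => al.
have [ga|ga] := boolP (grid i al); last by rewrite s0 ?t0.
have := corner_step s ga; have := corner_step t ga; rewrite !e => <-.
by move/eqP; rewrite eqn_add2r => /eqP.
Qed.

Lemma corner_sum_lt s t : (forall al, ~~ grid i al -> s al = 0%N) ->
    (forall al, ~~ grid i al -> t al = 0%N) ->
    (forall A B, corner i A B s <= corner i A B t)%N ->
  t = s \/ (corner_sum i s < corner_sum i t)%N.
Proof.
move=> s0 t0 le; have [e|] := eqVneq (corner_sum i s) (corner_sum i t); last first.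
  move=> ne; right; rewrite ltn_neqAle ne /=.
  by do 2!(apply: leq_sum => ? _).
left; apply: corner_inj => // A B; apply/esym.
have [AB|] := boolP ((n < A)%N || (n < B)%N); first by rewrite !corner_out.
rewrite negb_or -!leqNgt => /andP[An Bn].
have eq_terms (F G : 'I_n.+1 -> nat) X : (forall x, F x <= G x)%N ->
    (\sum_x F x = \sum_x G x)%N -> F X = G X.
  move=> FG eFG; apply/eqP; rewrite eqn_leq FG /=.
  have : (\sum_(x | x != X) F x <= \sum_(x | x != X) G x)%N by apply: leq_sum.
  by move: eFG; rewrite (bigD1 X) //= [RHS](bigD1 X) //=; lia.
have le' (x : 'I_n.+1) : (\sum_(y < n.+1) corner i x y s <= \sum_(y < n.+1) corner i x y t)%N.
  exact: leq_sum.
have /= e2 := eq_terms _ _ (Ordinal (An : (A < n.+1)%N)) le' e.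
exact: (eq_terms _ _ (Ordinal (Bn : (B < n.+1)%N)) (fun y => le A y) e2).
Qed.

Lemma corner_le_sum s A B : (corner i A B s <= \sum_al s al)%N.
Proof. by rewrite /corner big_mkcond leq_sum // => al _; case: ifP. Qed.

Lemma corner_sum_bound s : (corner_sum i s <= n.+1 * (n.+1 * \sum_al s al))%N.
Proof.
have cst (k : nat) : (\sum_(j < n.+1) k = n.+1 * k)%N by rewrite sum_nat_const card_ord.
rewrite -!cst leq_sum // => A _.
by rewrite leq_sum // => B _; apply: corner_le_sum.
Qed.

Definition add_exp s t : expn := [ffun al => (s al + t al)%N].

Lemma corner_sumD s t : corner_sum i (add_exp s t) = (corner_sum i s + corner_sum i t)%N.
Proof.
rewrite /corner_sum -big_split; apply: eq_bigr => A _.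
rewrite -big_split; apply: eq_bigr => B _.
by rewrite /corner -big_split; apply: eq_bigr => al _; rewrite ffunE.
Qed.

Section Count.
Variable N : nat.
Implicit Types (A B : 'I_N -> 'I_n.+1).

(** The exponents of the product of the z_(A k, B k). *)
Definition table A B : expn :=
  [ffun al => #|[set k | (A k == (val al).1) && (B k == (val al).2)]|].

Lemma table_grid A B al : (forall k, A k < i)%N -> (forall k, i <= B k)%N ->
  ~~ grid i al -> table A B al = 0%N.
Proof.
move=> Ai iB; apply: contraNeq; rewrite ffunE cards_eq0 => /set0Pn[k].
by rewrite inE => /andP[/eqP e1 /eqP e2]; rewrite /grid -e1 -e2 Ai iB.
Qed.

Lemma corner_table A B (a b : nat) :
    (forall k, A k < i)%N -> (forall k, i <= B k)%N ->
  corner i a b (table A B) = #|[set k | (a <= A k)%N && (b <= B k)%N]|.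
Proof.
move=> Ai iB; rewrite /corner.
under eq_bigr do rewrite ffunE -sum1dep_card big_mkcond.
rewrite exchange_big -sum1dep_card [RHS]big_mkcond /=; apply: eq_bigr => k _.
rewrite -big_mkcondr /=.
have lt : (A k < B k)%N by apply: leq_trans (Ai k) (iB k).
case: ifP => [/andP[h1 h2]|no]; last first.
  rewrite big_pred0 // => al; apply: contraFF no.
  by move=> /andP[/and3P[_ h1 h2] /andP[/eqP-> /eqP->]]; rewrite h1 h2.
rewrite (big_pred1 (mkroot lt)) // => al; apply/idP/eqP => [|->]; last first.
  by rewrite /grid /= Ai iB h1 h2 !eqxx.
by move=> /andP[_ /andP[/eqP e1 /eqP e2]]; apply: posrootI; rewrite /= ?e1 ?e2.
Qed.

Lemma sum_table A B : (forall k, A k < i)%N -> (forall k, i <= B k)%N ->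
  (\sum_al table A B al = N)%N.
Proof.
move=> Ai iB; have := corner_table 0 0 Ai iB.
rewrite /corner big_mkcond (eq_bigr (table A B)) => [->|al _].
  by rewrite (eq_card (B := predT)) ?card_ord // => k; rewrite !inE.
by rewrite !leq0n !andbT; case: (boolP (grid i al)) => // /(table_grid Ai iB)->.
Qed.

(** Of all tables with given margins, the one supported on a chain has the
    smallest corner sums: a quadrant and the opposite one cannot both meet
    the chain. *)
Lemma table_perm_lt A B (s : 'S_N) :
    (forall k, A k < i)%N -> (forall k, i <= B k)%N ->
    (forall k l : 'I_N, k <= l -> A k <= A l)%N ->
    (forall k l : 'I_N, k <= l -> B l <= B k)%N ->
  table A (B \o s) = table A B \/
  (corner_sum i (table A B) < corner_sum i (table A (B \o s)))%N.
Proof.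
move=> Ai iB Ainc Bdec; have iBs k : (i <= (B \o s) k)%N by apply: iB.
apply: corner_sum_lt => [al|al|a b]; try exact: table_grid.
rewrite !corner_table //.
pose U := [set k | (a <= A k)%N]; pose D := [set k | (b <= B k)%N].
have -> : [set k | (a <= A k)%N && (b <= B k)%N] = U :&: D.
  by apply/setP => k; rewrite !inE.
have -> : [set k | (a <= A k)%N && (b <= (B \o s) k)%N] = U :&: (s @^-1: D).
  by apply/setP => k; rewrite !inE.
have cD : #|s @^-1: D| = #|D|.
  by rewrite on_card_preimset //; exists (s^-1)%g => k _; rewrite ?permK ?permKV.
have := cardsUI U D; have := cardsUI U (s @^-1: D); rewrite cD.
have [->|/set0Pn[k]] := eqVneq (U :&: D) set0; first by rewrite cards0.
rewrite !inE => /andP[ak bk].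
have -> : U :|: D = setT.
  apply/setP => l; rewrite !inE; case: (leqP k l) => kl.
    by rewrite (leq_trans ak (Ainc _ _ kl)).
  by rewrite (leq_trans bk (Bdec _ _ (ltnW kl))) orbT.
have := subset_leq_card (subsetT (U :|: s @^-1: D)); lia.
Qed.

End Count.
End Tables.

(** * Straightening *)

Section Straighten.
Variables (R : realType) (n i m : nat).
Local Notation C := R[i].
Local Notation M := 'M[C]_n.+1.
Local Notation S := {mpoly C[#|posroot n|]}.
Local Notation expn := {ffun posroot n -> nat}.
Variable f : posroot n -> M.
Hypothesis f_root : forall al, negroot_vector al (f al).
Variable w : 'S_n.+1.
Hypothesis w_min : w \in Wmin i.
Implicit Types (al be : posroot n) (p q : S) (s t : expn).

(** ** Polynomials in the variables of n_w^- *)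

Lemma in_Sw_lclosed : lclosed (fun p : S => in_Sw w p).
Proof.
split=> [mu|c p q hp hq mu]; first by rewrite msupp0.
by move=> /msuppD_le; rewrite mem_cat => /orP[/msuppZ_le/hp|/hq].
Qed.

Lemma in_SwM p q : in_Sw w p -> in_Sw w q -> in_Sw w (p * q).
Proof.
move=> hp hq mu /msuppM_le /allpairsP[[m1 m2] /= [m1p m2q ->]] al aw.
by rewrite mnmDE (hp _ m1p) ?(hq _ m2q).
Qed.

Lemma in_SwZ c p : in_Sw w p -> in_Sw w (c *: p).
Proof.
by move=> hp; rewrite -[_ *: _]addr0; case: in_Sw_lclosed => h0; apply.
Qed.

Lemma in_Sw_sum (J : Type) (r : seq J) (P : pred J) (h : J -> S) :
  (forall j, P j -> in_Sw w (h j)) -> in_Sw w (\sum_(j <- r | P j) h j).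
Proof.
move=> hP; have [h0 hD] := in_Sw_lclosed.
by apply: big_ind => // x y hx hy; rewrite -[x]scale1r; apply: hD.
Qed.

Lemma in_Sw_prod (J : Type) (r : seq J) (P : pred J) (h : J -> S) :
  (forall j, P j -> in_Sw w (h j)) -> in_Sw w (\prod_(j <- r | P j) h j).
Proof.
move=> hP; apply: big_ind => //; last exact: in_SwM.
by move=> mu; rewrite msupp1 inE => /eqP-> al _; rewrite mnm0E.
Qed.

Lemma in_Sw_svar al : al \in Rminus w -> in_Sw w (svar R al).
Proof.
move=> aw mu; rewrite msuppX inE => /eqP-> be bw.
rewrite mnm1E (inj_eq enum_rank_inj); case: eqP => // e.
by rewrite -e aw in bw.
Qed.

(** ** Monomials *)

Definition mono s : 'X_{1..#|posroot n|} := [multinom s (enum_val j) | j < #|posroot n|].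

Definition expo (mu : 'X_{1..#|posroot n|}) : expn := [ffun al => mu (enum_rank al)].

Lemma expoK : cancel expo mono.
Proof. by move=> mu; apply/mnmP => j; rewrite mnmE ffunE enum_valK. Qed.

Lemma monoK : cancel mono expo.
Proof. by move=> s; apply/ffunP => al; rewrite ffunE mnmE enum_rankK. Qed.

Lemma monoE s al : mono s (enum_rank al) = s al.
Proof. by rewrite mnmE enum_rankK. Qed.

Lemma X_mono s : 'X_[mono s] = \prod_al svar R al ^+ s al :> S.
Proof.
rewrite mpolyXE_id (reindex (@enum_rank (posroot n))) /=.
  by apply: eq_bigr => al _; rewrite monoE.
exact/onW_bij/enum_rank_bij.
Qed.

(** The monomials in the rescaled variables, in terms of which permanents
    have nonnegative integral coefficients. *)
Definition zmon s : S := \prod_al zvar f (val al).1 (val al).2 ^+ s al.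

Definition zcoef s : C := \prod_al (root_coef f al)^-1 ^+ s al.

Lemma zcoef_neq0 s : zcoef s != 0.
Proof.
apply/prodf_neq0 => al _; rewrite expf_neq0 // invr_eq0.
exact: root_coef_neq0 f_root al.
Qed.

Lemma zmonE s : zmon s = zcoef s *: 'X_[mono s].
Proof.
rewrite X_mono /zcoef -scaler_prod; apply: eq_bigr => al _.
by rewrite zvarE // exprZn.
Qed.

Lemma zmonD s t : zmon (add_exp s t) = zmon s * zmon t.
Proof.
by rewrite /zmon -big_split; apply: eq_bigr => al _; rewrite ffunE exprD.
Qed.

Lemma zmon_in_Sw s : (forall al, al \notin Rminus w -> s al = 0%N) -> in_Sw w (zmon s).
Proof.
move=> s0; rewrite zmonE; apply: in_SwZ => mu; rewrite msuppX inE => /eqP-> al aw.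
by rewrite monoE s0.
Qed.

Lemma perm_polyE N (A B : 'I_N -> 'I_n.+1) :
    (forall k, A k < i)%N -> (forall k, i <= B k)%N ->
  perm_poly f A B = \sum_(s : 'S_N) zmon (table A (B \o s)).
Proof.
move=> Ai iB; apply: eq_bigr => s _.
have lt k : (A k < B (s k))%N by apply: leq_trans (Ai k) (iB _).
rewrite (partition_big (fun k => mkroot (lt k)) xpredT) //=.
apply: eq_bigr => al _; rewrite ffunE -prodr_const.
apply: eq_big => [k|k /eqP <- //]; rewrite inE /=.
apply/eqP/andP => [<-|[/eqP e1 /eqP e2]]; first by rewrite !eqxx.
exact: posrootI.
Qed.

(** ** The ideal of relations *)

Local Notation Nmod := (nplus_module f (root_powers w m)).
Local Notation Ideal := (ideal_gen w (fun q => Nmod q /\ in_Sw w q)).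

Lemma ideal_gen0 : Ideal 0.
Proof. by exists [::]; rewrite ?big_nil. Qed.

Lemma ideal_genD p q : Ideal p -> Ideal q -> Ideal (p + q).
Proof.
move=> [r1 h1 ->] [r2 h2 ->]; exists (r1 ++ r2); last by rewrite big_cat.
by move=> t; rewrite mem_cat => /orP[/h1|/h2].
Qed.

Lemma ideal_genM p q : in_Sw w p -> Ideal q -> Ideal (p * q).
Proof.
move=> hp [r hr ->]; exists [seq (p * pq.1, pq.2) | pq <- r].
  by move=> _ /mapP[t /hr[h1 h2] ->]; split=> //; apply: in_SwM.
by rewrite big_map mulr_sumr; apply: eq_bigr => t _; rewrite mulrA.
Qed.

Lemma in_Sw_const (c : C) : in_Sw w c%:MP.
Proof.
rewrite -[c%:MP]mulr1 mul_mpolyC; apply: in_SwZ.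
by move=> mu; rewrite msupp1 inE => /eqP-> al _; rewrite mnm0E.
Qed.

Lemma ideal_genZ c p : Ideal p -> Ideal (c *: p).
Proof. by rewrite -mul_mpolyC; apply/ideal_genM/in_Sw_const. Qed.

Lemma ideal_gen_gen p q : in_Sw w p -> Nmod q -> in_Sw w q -> Ideal (p * q).
Proof.
move=> hp nq hq; exists [:: (p, q)]; last by rewrite big_seq1.
by move=> t; rewrite inE => /eqP->.
Qed.

(** The lattice points of the chain polytope of w. *)
Definition normal_exp s : Prop :=
  (forall al, al \notin Rminus w -> s al = 0%N) /\
  forall c, sorted (@poset_gt n) c -> (\sum_(al <- c) s al <= m)%N.

(** Congruence to a combination of monomials of lattice points. *)
Definition straightens p : Prop := exists2 q,
  forall mu, mu \in msupp q -> normal_exp (expo mu) & Ideal (p - q).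

Lemma straightens_lclosed : lclosed straightens.
Proof.
split=> [|c p1 p2 [q1 h1 i1] [q2 h2 i2]].
  by exists 0; [move=> mu; rewrite msupp0 | rewrite subrr; apply: ideal_gen0].
exists (c *: q1 + q2).
  by move=> mu /msuppD_le; rewrite mem_cat => /orP[/msuppZ_le/h1|/h2].
rewrite opprD addrACA -scalerBr; apply: ideal_genD => //.
exact: ideal_genZ.
Qed.

Lemma straightens_sum (J : Type) (r : seq J) (P : pred J) (h : J -> S) :
  (forall j, P j -> straightens (h j)) -> straightens (\sum_(j <- r | P j) h j).
Proof.
move=> hP; have [h0 hD] := straightens_lclosed.
by apply: big_ind => // x y hx hy; rewrite -[x]scale1r; apply: hD.
Qed.

Lemma straightens_ideal p : Ideal p -> straightens p.
Proof. by move=> ip; exists 0; [move=> mu; rewrite msupp0 | rewrite subr0]. Qed.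

Lemma straightens_normal s : normal_exp s -> straightens (zmon s).
Proof.
move=> ns; exists (zmon s); last by rewrite subrr; apply: ideal_gen0.
by move=> mu; rewrite zmonE => /msuppZ_le; rewrite msuppX inE => /eqP->; rewrite monoK.
Qed.

(** All factors of the permanent belong to roots below (a0, b0), hence to
    R_w^-. *)
Lemma perm_poly_ideal (A B : 'I_m.+1 -> 'I_n.+1) (a0 b0 : 'I_n.+1) (h0 : (a0 < b0)%N) s :
    mkroot h0 \in Rminus w ->
    (forall k, a0 <= A k < i)%N -> (forall k, i <= B k <= b0)%N ->
    (forall al, al \notin Rminus w -> s al = 0%N) ->
  Ideal (zmon s * perm_poly f A B).
Proof.
move=> w0 hA hB s0; apply: ideal_gen_gen; first exact: zmon_in_Sw.
  apply: (perm_poly_nplus (i := i) f_root (a0 := a0) (b0 := b0)) => //.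
  rewrite (zvarE f (mkroot h0)) exprZn; apply/nplus_moduleZ/NplusGen.
  by exists (mkroot h0).
apply: in_Sw_sum => t _; apply: in_Sw_prod => k _.
have /andP[aA Ai] := hA k; have /andP[iB Bb] := hB (t k).
have lt : (A k < B (t k))%N by apply: leq_trans Ai iB.
rewrite (zvarE f (mkroot lt)); apply/in_SwZ/in_Sw_svar.
apply: (Rminus_closed w_min _ w0); first by rewrite /grid /= Ai iB.
by rewrite poset_geE /= aA Bb.
Qed.

(** A violated chain inequality provides m + 1 factors supported on a chain;
    the permanent of their rows and columns rewrites their product into
    monomials with larger corner sums. *)
Lemma straightens_zmon s : (forall al, al \notin Rminus w -> s al = 0%N) ->
  straightens (zmon s).
Proof.
move: {2}(_ - _)%N (leqnn (n.+1 * (n.+1 * \sum_al s al) - corner_sum i s)) => d.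
elim/ltn_ind: d s => d IH s led s0.
have [ns|nns] := pselect (normal_exp s); first exact: straightens_normal.
have [c sc lt_m] : exists2 c, sorted (@poset_gt n) c & (m < \sum_(al <- c) s al)%N.
  apply: contrapT => no; apply: nns; split=> // c sc; rewrite leqNgt; apply/negP => lt.
  by apply: no; exists c.
(* the factors of the monomial on the chain, repeated by their exponents *)
pose L := flatten [seq nseq (s al) al | al <- c].
have sizeL : size L = (\sum_(al <- c) s al)%N.
  rewrite size_flatten /shape -map_comp sumnE big_map.
  by apply: eq_bigr => al _; rewrite /= size_nseq.
have uc : uniq c.
  by apply: (sorted_uniq (@poset_gt_trans n)) sc => al; rewrite /poset_gt eqxx.
have countL al : (count_mem al L <= s al)%N.
  rewrite count_flatten -map_comp sumnE big_map.
  have [ac|nac] := boolP (al \in c); last first.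
    rewrite big_seq big1 // => be bc; rewrite /= count_nseq /=.
    by case: eqP => [e|]; rewrite ?mul0n // -e bc in nac *.
  rewrite (bigD1_seq al) //= count_nseq /= eqxx mul1n big1 ?addn0 // => be /negbTE ne.
  by rewrite count_nseq /= ne.
have sL : sorted (@poset_ge n) L.
  rewrite sorted_pairwise; last exact: poset_ge_trans.
  move: sc; rewrite sorted_pairwise; last exact: poset_gt_trans.
  rewrite /L; elim: c {lt_m L sizeL uc countL} => //= al c IHc /andP[h1 h2].
  rewrite pairwise_cat IHc // andbT; apply/andP; split.
    apply/allrelP => x y; rewrite mem_nseq => /andP[_ /eqP->].
    move=> /flattenP[_ /mapP[be bc ->]]; rewrite mem_nseq => /andP[_ /eqP->].
    by have /allP/(_ be bc)/andP[] := h1.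
  elim: (s al) => //= k ->; rewrite andbT; apply/allP => x.
  by rewrite mem_nseq => /andP[_ /eqP->]; rewrite poset_geE !leqnn.
have szl : size (take m.+1 L) == m.+1 by rewrite size_takel // sizeL.
pose l := Tuple szl.
have sl : sorted (@poset_ge n) l by apply: take_sorted.
have count_l al : (count_mem al l <= s al)%N.
  apply: leq_trans (countL al).
  by rewrite -[X in (_ <= count _ X)%N](cat_take_drop m.+1 L) count_cat leq_addr.
have lw k : tnth l k \in Rminus w.
  apply: contraT => /s0 e; have := count_l (tnth l k); rewrite e leqn0.
  by move=> /eqP/count_memPn; rewrite mem_tnth.
have lg k : grid i (tnth l k) by apply: Rminus_grid w_min (lw k).
pose A k := (val (tnth l k)).1; pose B k := (val (tnth l k)).2.
have Ai k : (A k < i)%N by case/andP: (lg k).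
have iB k : (i <= B k)%N by case/andP: (lg k).
have le_l (j k : 'I_m.+1) : (j <= k)%N -> poset_ge (tnth l j) (tnth l k).
  move=> jk; have x0 := tnth l ord0; rewrite !(tnth_nth x0).
  apply: (sorted_leq_nth (@poset_ge_trans n)) => //.
  - by move=> x; rewrite poset_geE !leqnn.
  - by rewrite inE size_tuple.
  - by rewrite inE size_tuple.
have tE al : table A B al = count_mem al l.
  rewrite ffunE -sum1dep_card -sum1_count big_tuple; apply: eq_bigl => k /=.
  apply/andP/eqP => [[/eqP e1 /eqP e2]|<-]; last by rewrite !eqxx.
  exact: posrootI.
pose s' : expn := [ffun al => (s al - table A B al)%N].
have sE : s = add_exp s' (table A B).
  by apply/ffunP => al; rewrite !ffunE subnK //; have := count_l al; rewrite -tE ffunE.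
have s'0 al : al \notin Rminus w -> s' al = 0%N by move=> /s0 e; rewrite ffunE e.
have ip : Ideal (zmon s' * perm_poly f A B).
  apply: (@perm_poly_ideal A B (A ord0) (B ord0) (posrootP (tnth l ord0))) => //.
  - by rewrite (_ : mkroot _ = tnth l ord0) //; apply: posrootI.
  - by move=> k; rewrite Ai andbT; have := le_l ord0 k (leq0n k); rewrite poset_geE => /andP[].
  - by move=> k; rewrite iB /=; have := le_l ord0 k (leq0n k); rewrite poset_geE => /andP[].
(* In the permanent, the terms with the table of A and B give back the monomial of s; all
   others have larger corner sums. *)
have st := straightens_ideal ip.
rewrite perm_polyE // mulr_sumr (bigID (fun t : 'S_m.+1 => table A (B \o t) == table A B)) /= in st.
have st2 : straightens (\sum_(t : 'S_m.+1 | table A (B \o t) != table A B)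
    zmon s' * zmon (table A (B \o t))).
  apply: straightens_sum => t ne; rewrite -zmonD.
  have iBt k : (i <= (B \o t) k)%N by apply: iB.
  have [e|lt] := table_perm_lt t Ai iB (fun j k jk => proj1 (andP (le_l j k jk)))
     (fun j k jk => proj2 (andP (le_l j k jk))).
    by rewrite e eqxx in ne.
  have sumE : (\sum_al add_exp s' (table A (B \o t)) al = \sum_al s al)%N.
    rewrite sE; under eq_bigr do rewrite ffunE.
    under [RHS]eq_bigr do rewrite ffunE.
    by rewrite !big_split /= !(sum_table (i := i)).
  apply: (IH (n.+1 * (n.+1 * \sum_al s al) - corner_sum i (add_exp s' (table A (B \o t))))%N).
  - apply: leq_trans led; apply: ltn_sub2l.
      rewrite sE corner_sumD; have := corner_sum_bound i (add_exp s' (table A (B \o t))).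
      by rewrite sumE -sE corner_sumD; apply: leq_trans; rewrite ltn_add2l.
    by rewrite {1}sE !corner_sumD ltn_add2l.
  - by rewrite sumE.
  move=> al aw; rewrite ffunE s'0 // add0n; apply: contraNeq aw.
  rewrite ffunE cards_eq0 => /set0Pn[k]; rewrite inE => /andP[/eqP e1 /eqP e2].
  apply: (Rminus_closed w_min _ (lw ord0)).
    by rewrite /grid -e1 -e2 Ai iBt.
  rewrite poset_geE -e1 -e2; apply/andP; split.
    by have /andP[] := le_l ord0 k (leq0n k).
  by have /andP[] := le_l ord0 (t k) (leq0n _).
have [h0 hD] := straightens_lclosed.
have sub (x y : S) : straightens y -> straightens (x + y) -> straightens x.
  by move=> hy hxy; have := hD (-1) _ _ hy hxy; rewrite scaleN1r addrCA addNr addr0.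
have := sub _ _ st2 st.
rewrite (eq_bigr (fun=> zmon s)) => [|t /eqP e]; last by rewrite e -zmonD -sE.
rewrite sumr_const -scaler_nat => st3.
have := hD (#|[pred t : 'S_m.+1 | table A (B \o t) == table A B]|%:R^-1) _ _ st3 h0.
rewrite addr0 scalerA mulVf ?scale1r // pnatr_eq0 -lt0n.
apply/card_gt0P; exists 1%g; rewrite inE; apply/eqP/ffunP => al; rewrite !ffunE.
by apply: eq_card => k; rewrite !inE /= perm1.
Qed.

Lemma straighten p : in_Sw w p -> straightens p.
Proof.
move=> hp; apply: (mpoly_lclosed straightens_lclosed) => mu mup.
have [h0 hD] := straightens_lclosed.
have : straightens (zmon (expo mu)).
  by apply: straightens_zmon => al aw; rewrite ffunE (hp _ mup).
move=> /(hD (zcoef (expo mu))^-1 _ _)/(_ h0).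
by rewrite addr0 zmonE scalerA mulVf ?zcoef_neq0 // scale1r expoK.
Qed.

End Straighten.

(** * Subspaces given by predicates *)

Lemma lclosed_vspace (K : fieldType) (V : vectType K) (P : V -> Prop) :
  lclosed P -> exists U : {vspace V}, forall y, y \in U <-> P y.
Proof.
move=> [P0 PL].
pose Q d := `[< exists2 U : {vspace V}, \dim U = d & forall y, y \in U -> P y >].
have exQ : exists d, Q d.
  exists 0%N; apply/asboolP; exists 0%VS; first exact: dimv0.
  by move=> y; rewrite memv0 => /eqP->.
have Qb d : Q d -> (d <= \dim {:V})%N.
  by move=> /asboolP[U <- _]; apply/dimvS/subvf.
have [d /asboolP[U dU UP] dmax] := ex_maxnP exQ Qb.
exists U => y; split=> [/UP //|Py]; apply: contraT => yU.
have : Q (\dim (U + <[y]>)%VS).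
  apply/asboolP; exists (U + <[y]>)%VS => // z /memv_addP[u uU [t /vlineP[c ->] ->]].
  by rewrite addrC; apply: PL => //; apply: UP.
move/dmax; rewrite -dU => le.
have := dimv_leqif_eq (addvSl U <[y]>); move/leqifP; case: eqP => [e _|_]; last by rewrite ltnNge le.
by case/negP: yU; rewrite e; apply: (subvP (addvSr U <[y]>)); apply: memv_line.
Qed.

Lemma span_lclosed (K : fieldType) (V : vectType K) (T : finType) (A : {pred T})
    (h : T -> V) (P : V -> Prop) x :
  lclosed P -> (forall t, t \in A -> P (h t)) ->
  x \in <<[seq h t | t in A]>>%VS -> P x.
Proof.
move=> cP hP; have [U UP] := lclosed_vspace cP => xs; apply/UP.
apply: subvP xs; apply/span_subvP => _ /imageP[t tA ->].
exact/UP/hP.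
Qed.

(** * Representations of sl as representations of gl *)

Section Rep.
Variables (R : realType) (n i m : nat).
Local Notation C := R[i].
Local Notation M := 'M[C]_n.+1.
Variables (V : vectType C) (rho : {linear M -> 'End(V)}) (v : V).
Hypothesis ii : (1 <= i <= n)%N.
Hypothesis rep : is_rep rho.
Hypothesis hw : is_highest_weight_vector rho (fun h => m%:R * omega i h) v.

Implicit Types (p q r s : 'I_n.+1) (x : M) (y : V).

(** The traceless part of the matrix unit. *)
Definition slE p q : M := delta_mx p q - ((p == q)%:R / n.+1%:R)%:M.

(** The scalar by which the identity matrix acts is chosen such that the
    diagonal matrix units have eigenvalues m and 0 on v. *)
Definition rep_gl p q y : V :=
  rho (slE p q) y + ((p == q)%:R * (m%:R * i%:R / n.+1%:R)) *: y.

Lemma n1_neq0 : (n.+1%:R : C) != 0. Proof. by rewrite pnatr_eq0. Qed.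

Lemma mxtrace_delta p q : \tr (delta_mx p q : M) = (p == q)%:R.
Proof.
rewrite /mxtrace (bigD1 p) //= mxE eqxx big1 ?addr0 // => r /negbTE ne.
by rewrite mxE ne.
Qed.

Lemma slE_sl p q : slE p q \in sl n R.
Proof.
rewrite mem_sl linearB /= mxtrace_delta mxtrace_scalar -[X in _ - X]mulr_natr divfK ?subrr //.
exact: n1_neq0.
Qed.

Lemma lie_slE p q r s :
  lie (slE p q) (slE r s) = (q == r)%:R *: slE p s - (s == p)%:R *: slE r q.
Proof.
have liesc x c : lie x c%:M = 0 by rewrite /lie scalar_mxC subrr.
have lieN x x' : lie x x' = - lie x' x by rewrite /lie opprB.
have lieB x x' c : lie x (x' - c%:M) = lie x x'.
  by rewrite (linB (lie_linear x)) liesc subr0.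
rewrite lieB lieN lieB -lieN lie_delta /slE !scalerBr.
have -> : (q == r)%:R *: ((p == s)%:R / n.+1%:R)%:M =
    (s == p)%:R *: ((r == q)%:R / n.+1%:R)%:M :> M.
  rewrite !scale_scalar_mx !mulrA -!natrM !mulnb [(s == p) && _]andbC.
  by rewrite (eq_sym s) (eq_sym r).
by rewrite opprB addrA subrK.
Qed.

Lemma rho_lin c x x' y : rho (c *: x + x') y = c *: rho x y + rho x' y.
Proof. by rewrite linearP add_lfunE scale_lfunE. Qed.

Lemma rhoZ c x y : rho (c *: x) y = c *: rho x y.
Proof. by rewrite linearZ scale_lfunE. Qed.

Lemma rhoB x x' y : rho (x - x') y = rho x y - rho x' y.
Proof. by rewrite addrC -scaleN1r rho_lin scaleN1r addrC. Qed.

Lemma rep_gl_gl : gl_system rep_gl.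
Proof.
split=> [p q c y z|p q r s y]; rewrite /rep_gl.
  by rewrite linearP scalerDr scalerDr !scalerA addrACA mulrC.
have rhoDr x c z t : rho x (z + c *: t) = rho x z + c *: rho x t.
  by rewrite linearD linearZ.
rewrite !rhoDr; have := rep (slE_sl p q) (slE_sl r s) y; rewrite lie_slE rhoB !rhoZ => e.
have -> : rho (slE p q) (rho (slE r s) y) = rho (slE r s) (rho (slE p q) y) +
   ((q == r)%:R *: rho (slE p s) y - (s == p)%:R *: rho (slE r q) y).
  by rewrite e addrC subrK.
set k := m%:R * i%:R / n.+1%:R.
have zeq : (s == p)%:R *: (((r == q)%:R * k) *: y) = (q == r)%:R *: (((p == s)%:R * k) *: y).
  by rewrite !scalerA !mulrA -!natrM !mulnb [(s == p) && _]andbC eq_sym (eq_sym s).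
have key (a b c d e' z t : V) :
    a + (b - c) + d + (e' + z) = a + e' + (d + z) + (b + t) - (c + t).
  by rewrite [X in _ = X - _]addrA [c + t]addrC addrKA -[RHS]addrA [LHS](AC (3*2) ((1*4)*(3*5)*2)).
have zz : ((p == q)%:R * k) *: (((r == s)%:R * k) *: y) =
    ((r == s)%:R * k) *: (((p == q)%:R * k) *: y).
  by rewrite !scalerA [in RHS]mulrC.
by rewrite !scalerDr zeq zz; apply: key.
Qed.

Lemma rho_rep_gl x y : x \in sl n R ->
  rho x y = \sum_p \sum_q x p q *: rep_gl p q y.
Proof.
rewrite mem_sl => /eqP trx.
have {1}-> : x = \sum_p \sum_q x p q *: slE p q.
  rewrite /slE; under eq_bigr do under eq_bigr do rewrite scalerBr.
  under eq_bigr do rewrite sumrB; rewrite sumrB -matrix_sum_delta.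
  rewrite [X in _ - X](_ : _ = 0) ?subr0 //.
  rewrite (eq_bigr (fun p => x p p *: (n.+1%:R^-1)%:M)); last first.
    move=> p _; rewrite (bigD1 p) //= eqxx div1r big1 ?addr0 // => q ne.
    by rewrite eq_sym (negbTE ne) mul0r raddf0 scaler0.
  by rewrite -scaler_suml -/(mxtrace x) trx scale0r.
rewrite linear_sum sum_lfunE; under eq_bigr do rewrite linear_sum sum_lfunE.
rewrite /rep_gl; under [RHS]eq_bigr do under eq_bigr do rewrite scalerDr.
under [RHS]eq_bigr do rewrite big_split /=.
rewrite big_split /= [X in _ = _ + X](_ : _ = 0) ?addr0.
  by apply: eq_bigr => p _; apply: eq_bigr => q _; rewrite rhoZ.
rewrite (eq_bigr (fun p => x p p *: ((m%:R * i%:R / n.+1%:R) *: y))); last first.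
  move=> p _; rewrite (bigD1 p) //= eqxx mul1r big1 ?addr0 // => q ne.
  by rewrite eq_sym (negbTE ne) mul0r scale0r scaler0.
by rewrite -scaler_suml -/(mxtrace x) trx scale0r.
Qed.

Lemma rho_delta p q y : p != q -> rho (delta_mx p q) y = rep_gl p q y.
Proof.
by move=> /negbTE pq; rewrite /rep_gl /slE pq !mul0r scale0r addr0 raddf0 subr0.
Qed.

Lemma slE_cartan p : slE p p \in cartan n R.
Proof.
have -> : slE p p = \sum_a ((a == p)%:R - n.+1%:R^-1) *: delta_mx a a.
  under eq_bigr do rewrite scalerBl; rewrite sumrB /slE eqxx div1r; congr (_ - _).
    by rewrite (sum_delta p (fun a => delta_mx a a : M)).
  apply/matrixP => a b; rewrite summxE mxE (bigD1 a) //= !mxE eqxx /=.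
  rewrite big1 ?addr0 => [|c ca]; last by rewrite !mxE eq_sym (negbTE ca) mulr0.
  by rewrite eq_sym; case: eqP => _; rewrite ?mulr1 ?mulr0.
apply: cartan_diag; rewrite sumrB (bigD1 p) //= eqxx big1 ?addr0; last first.
  by move=> a /negbTE->.
by rewrite sumr_const card_ord -[X in _ - X]mulr_natl divff ?subrr // n1_neq0.
Qed.

Lemma rep_gl_weight (u : 'S_n.+1) y p :
    is_weight_vector rho (weyl_wt u (fun h => m%:R * omega i h)) y ->
  rep_gl p p y = (m * ((u^-1)%g p < i))%N%:R *: y.
Proof.
move=> [_ hy]; rewrite /rep_gl eqxx mul1r hy ?slE_cartan //.
rewrite -scalerDl; congr (_ *: y); rewrite /weyl_wt.
have -> : omega i (mxsub u u (slE p p)) = ((u^-1)%g p < i)%:R - i%:R / n.+1%:R.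
  rewrite /omega (eq_bigr (fun a => (a == (u^-1)%g p)%:R - n.+1%:R^-1)); last first.
    move=> a _; rewrite !mxE !eqxx andbb mulr1n div1r.
    by rewrite -(inj_eq (@perm_inj _ u)) permKV.
  rewrite sumrB; congr (_ - _).
    rewrite big_mkcond (bigD1 ((u^-1)%g p)) //= eqxx big1 ?addr0; first by case: ifP.
    by move=> a /negbTE->; case: ifP.
  have /andP[_ /leqW iin] := ii.
  rewrite -(big_ord_widen n.+1 (fun=> n.+1%:R^-1) iin) sumr_const card_ord.
  by rewrite -[LHS]mulr_natl.
by rewrite natrM mulrBr mulrA subrK.
Qed.

Lemma weyl_wt1 mu (h : M) : weyl_wt 1%g mu h = mu h.
Proof. by congr mu; apply/matrixP => a b; rewrite mxE !perm1. Qed.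

(** A lowering operator inside a block kills v by sl_2-theory: the two diagonal
    units have the same eigenvalue on v. *)
Lemma rep_gl_hw : hw_vector i m rep_gl v.
Proof.
have [[v0 hv] nv] := hw; have gl := rep_gl_gl.
have up p q : (p < q)%N -> rep_gl p q v = 0.
  move=> pq; rewrite -rho_delta; last by rewrite -val_eqE ltn_eqF.
  by apply: nv; apply/memv_span/imageP; exists (mkroot pq).
have diag p : rep_gl p p v = (m * (p < i))%N%:R *: v.
  rewrite (@rep_gl_weight 1%g) ?invg1 ?perm1 //; split=> // h hc.
  by rewrite weyl_wt1 hv.
move=> p q pq; case: (ltngtP p q) => [lt|gt|/val_inj e].
- by rewrite up // -val_eqE (ltn_eqF lt) muln0 scale0r.
- rewrite -val_eqE (gtn_eqF gt) muln0 scale0r.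
  have ne : q != p by rewrite -val_eqE ltn_eqF.
  have e : (m * (q < i))%N%:R - (m * (p < i))%N%:R = 0%:R :> C.
    apply/eqP; rewrite subr_eq0 eqr_nat; apply/eqP; congr (_ * _)%N.
    by move: pq; case: (ltnP q i); case: (ltnP p i) => //; lia.
  by have := sl2_nilpotent gl ne (up _ _ gt) (diag q) (diag p) e.
by rewrite -e diag eqxx.
Qed.

End Rep.

(** * Words in the lowering operators *)

Section Words.
Variables (R : realType) (n i m : nat).
Local Notation C := R[i].
Local Notation M := 'M[C]_n.+1.
Local Notation S := {mpoly C[#|posroot n|]}.
Variable f : posroot n -> M.
Hypothesis f_root : forall al, negroot_vector al (f al).
Hypothesis ii : (1 <= i <= n)%N.
Variables (V : vectType C) (X : 'I_n.+1 -> 'I_n.+1 -> V -> V) (v : V).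
Hypotheses (glX : gl_system X) (hwv : hw_vector i m X v).
Implicit Types (al be : posroot n) (p q : S) (y : V).

Local Notation pact := (pact (root_op i f X)).
Let pactM := pactM (root_op_linear i f glX) (root_op_comm i f glX).

Lemma pact_zvar al y : grid i al ->
  pact (zvar f (val al).1 (val al).2) y = X (val al).2 (val al).1 y.
Proof.
move=> ga; rewrite zvarE (linZ (pact_linear _ _)) pact_svar /root_op ga scalerA.
by rewrite mulVf ?scale1r // (root_coef_neq0 f_root).
Qed.

Lemma pact_prod_zvar (L : seq (posroot n)) y : all (grid i) L ->
  pact (\prod_(al <- L) zvar f (val al).1 (val al).2) y = fword X L y.
Proof.
elim: L => [|al L IH] /=; first by rewrite big_nil pact1.
by move=> /andP[ga gL]; rewrite big_cons pactM IH // pact_zvar.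
Qed.

(** The permanents come from the power of the variable of the highest root. *)
Lemma perm_poly_null (A B : 'I_m.+1 -> 'I_n.+1) :
    (forall k, A k < i)%N -> (forall k, i <= B k)%N ->
  pact (perm_poly f A B) v = 0.
Proof.
move=> Ai iB; have /andP[i0 iN] := ii.
pose G (p : S) := exists2 al, grid i al & p = svar R al ^+ m.+1.
apply: (nplus_module_null f_root glX hwv (G := G)).
  by move=> q [al ga ->]; apply: pact_exp.
have lt : ((ord0 : 'I_n.+1) < (ord_max : 'I_n.+1))%N by apply: leq_trans iN.
apply: (perm_poly_nplus (i := i) f_root (a0 := ord0) (b0 := ord_max)) => //.
  rewrite (zvarE f (mkroot lt)) exprZn; apply/nplus_moduleZ/NplusGen.
  by exists (mkroot lt); rewrite // /grid /= i0 iN.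
by move=> k; rewrite iB /= -ltnS.
Qed.

(** A word with more than m factors in the same row (or column) kills v: the
    permanent of such factors is a multiple of their product. *)
Lemma fword_row_bound (L : seq (posroot n)) (P : pred (posroot n)) :
    all (grid i) L ->
    (exists a, forall al, P al -> (val al).1 = a) \/
    (exists b, forall al, P al -> (val al).2 = b) ->
    (m < count P L)%N ->
  fword X L v = 0.
Proof.
move=> gL Pc lt.
pose L1 := take m.+1 (filter P L); pose L2 := drop m.+1 (filter P L) ++ filter (predC P) L.
have pL : perm_eq L (L2 ++ L1).
  by rewrite perm_sym /L1 /L2 perm_catC catA cat_take_drop perm_filterC.
have g1 : all (grid i) L1.
  by apply/allP => al /mem_take; rewrite mem_filter => /andP[_ /(allP gL)].
have gL2 : all (grid i) L2.
  by move: gL; rewrite (perm_all _ pL) all_cat => /andP[].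
have s1 : size L1 == m.+1 by rewrite size_takel // size_filter.
have P1 : all P L1.
  by apply/allP => al /mem_take; rewrite mem_filter => /andP[].
rewrite -(pact_prod_zvar _ gL) (perm_big _ pL) /= big_cat pactM.
suff -> : pact (\prod_(al <- L1) zvar f (val al).1 (val al).2) v = 0.
  exact: lin0 (pact_linearr (root_op_linear i f glX) _).
pose l := Tuple s1.
have lP k : P (tnth l k) by apply: (allP P1); rewrite mem_tnth.
have lg k : grid i (tnth l k) by apply: (allP g1); rewrite mem_tnth.
pose A k := (val (tnth l k)).1; pose B k := (val (tnth l k)).2.
have pE : perm_poly f A B = #|'S_m.+1|%:R *: \prod_(al <- L1) zvar f (val al).1 (val al).2.
  rewrite -[L1]/(tval l) big_tuple scaler_nat -sumr_const.
  apply: eq_bigr => s _; case: Pc => [[a ha]|[b hb]].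
    rewrite [RHS](reindex_inj (@perm_inj _ s)); apply: eq_bigr => k _.
    by rewrite /A (ha _ (lP k)) (ha _ (lP (s k))).
  by apply: eq_bigr => k _; rewrite /B (hb _ (lP k)) (hb _ (lP (s k))).
have := perm_poly_null (A := A) (B := B); rewrite pE (linZ (pact_linear _ _)).
move=> /(_ (fun k => proj1 (andP (lg k))) (fun k => proj2 (andP (lg k)))) /eqP.
rewrite scaler_eq0 pnatr_eq0 -leqn0 leqNgt => /orP[|/eqP //].
by rewrite (_ : (0 < _)%N) //; apply/card_gt0P; exists 1%g.
Qed.

(** A letter in row r lowers the eigenvalue, and one in column r raises it. *)
Lemma fword_weight (L : seq (posroot n)) r : all (grid i) L ->
  X r r (fword X L v) =
  ((m * (r < i))%N%:R - (count (fun al => (val al).1 == r) L)%:R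
    + (count (fun al => (val al).2 == r) L)%:R) *: fword X L v.
Proof.
elim: L => [_|al L IH] /=.
  by rewrite hwv ?eqxx ?subr0 ?addr0 // leqNgt andNb.
move=> /andP[ga gL]; rewrite (glC glX) -/(fword X L) IH // (glZ glX).
set y := X (val al).2 (val al).1 (fword X L v).
have -> : (r == (val al).2)%:R *: X r (val al).1 (fword X L v) = (r == (val al).2)%:R *: y.
  by case: eqP => [->|]; rewrite ?scale0r.
have -> : ((val al).1 == r)%:R *: X (val al).2 r (fword X L v) = ((val al).1 == r)%:R *: y.
  by case: eqP => [<-|]; rewrite ?scale0r.
rewrite -scalerDl -scalerBl (eq_sym r); congr (_ *: y).
by rewrite !natrD; ring.
Qed.

(** The span of all words in the lowering operators applied to v. *)
Inductive gsum : V -> Prop :=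
| Gsum_word d y : gword i X v d y -> gsum y
| Gsum_lin c x y : gsum x -> gsum y -> gsum (c *: x + y).

Lemma gsum_lclosed : lclosed gsum.
Proof. by split; [apply: (Gsum_word (d := 0)); exact: Gword_0 | exact: Gsum_lin]. Qed.

Lemma gsum_X (p q : 'I_n.+1) y : gsum y -> gsum (X p q y).
Proof.
elim=> {y} [d y gy|c x y _ gx _ gy]; last by rewrite (glP glX); apply: Gsum_lin.
have [pq|pq] := boolP ((p < i)%N == (q < i)%N).
  by apply: Gsum_word; apply: (gword_levi glX hwv (eqP pq) gy).
have [pi|ip] := ltnP p i.
  have iq : (i <= q)%N by move: pq; rewrite pi; case: ltnP.
  have := gword_up glX hwv pi iq gy; case: d gy => [|d] _; last exact: Gsum_word.
  by move=> ->; case: gsum_lclosed.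
have qi : (q < i)%N by move: pq; rewrite ltnNge ip; case: ltnP.
by apply: (Gsum_word (d := d.+1)); apply: Gword_X.
Qed.

Lemma gsum_fword (P : V -> Prop) y : lclosed P ->
  (forall L, all (grid i) L -> P (fword X L v)) -> gsum y -> P y.
Proof.
move=> cP hP; elim=> {y} [d y gy|c x y _ Px _ Py]; last by case: cP => _; apply.
by apply: (gword_span glX cP _ gy) => L _; apply: hP.
Qed.

(** The weights of the words are bounded, so a vector of another weight
    vanishes: the product of the X r r - k for k <= m kills everything. *)
Lemma weight_bound r y mu : gsum y -> X r r y = mu *: y ->
  (forall k, (k <= m)%N -> mu != k%:R) -> y = 0.
Proof.
move=> gy ey muk.
pose Q z := foldr (fun k z => X r r z - k%:R *: z) z (iota 0 m.+1).
have linX (p q : 'I_n.+1) : linear (X p q) by case: glX.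
have linQ : linear Q.
  rewrite /Q; elim: (iota _ _) => // k s IH c z t.
  by rewrite /= IH linX scalerBr scalerDr opprD addrACA !scalerA [k%:R * _]mulrC.
have Qe z nu : X r r z = nu *: z -> Q z = (\prod_(k <- iota 0 m.+1) (nu - k%:R)) *: z.
  move=> ez; rewrite /Q; elim: (iota _ _) => [|k s IH] /=.
    by rewrite big_nil scale1r.
  by rewrite IH big_cons (glZ glX) ez !scalerA -scalerBl mulrBl mulrC.
have Qy : Q y = 0.
  apply: (gsum_fword (P := fun y => Q y = 0)) gy.
    by split=> [|c z t Qz Qt]; rewrite ?(lin0 linQ) // linQ Qz Qt scaler0 addr0.
  move=> L gL; have [w0|/eqP w0] := eqVneq (fword X L v) 0; first by rewrite w0 (lin0 linQ).
  set cr := count (fun al => (val al).1 == r) L.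
  set cc := count (fun al => (val al).2 == r) L.
  have crm : (cr <= m)%N.
    rewrite leqNgt; apply/negP => lt; apply: w0; apply: fword_row_bound gL _ lt.
    by left; exists r => al /eqP.
  have ccm : (cc <= m)%N.
    rewrite leqNgt; apply/negP => lt; apply: w0; apply: fword_row_bound gL _ lt.
    by right; exists r => al /eqP.
  have [k km ek] : exists2 k, (k <= m)%N &
      (m * (r < i))%N%:R - cr%:R + cc%:R = k%:R :> C.
    have [ri|ir] := ltnP r i.
      have -> : cc = 0%N.
        apply/eqP; rewrite /cc -leqn0 leqNgt -has_count; apply/hasPn => al /(allP gL).
        by move=> /andP[_ ib]; rewrite eq_sym (ord_neq ri ib).
      by exists (m - cr)%N; rewrite ?leq_subr // muln1 addr0 natrB.
    have -> : cr = 0%N.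
      apply/eqP; rewrite /cr -leqn0 leqNgt -has_count; apply/hasPn => al /(allP gL).
      by move=> /andP[ai _]; rewrite (ord_neq ai ir).
    by exists cc; rewrite // muln0 subr0 add0r.
  rewrite (Qe _ _ (fword_weight r gL)) -/cr -/cc ek.
  by rewrite (bigD1_seq k) ?iota_uniq ?mem_iota //= subrr mul0r scale0r.
have := Qe _ _ ey; rewrite Qy => /esym/eqP; rewrite scaler_eq0 => /orP[|/eqP //].
rewrite prodf_seq_eq0 => /hasP[k]; rewrite mem_iota /= add0n ltnS => km.
by rewrite subr_eq0 (negbTE (muk k km)).
Qed.

End Words.

Section Generation.
Variables (R : realType) (n i m : nat).
Local Notation C := R[i].
Local Notation M := 'M[C]_n.+1.
Variables (V : vectType C) (rho : {linear M -> 'End(V)}) (v : V).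
Hypothesis ii : (1 <= i <= n)%N.
Hypothesis rep : is_rep rho.
Hypothesis simple : is_simple_module rho.
Hypothesis hw : is_highest_weight_vector rho (fun h => m%:R * omega i h) v.

(** The span of the words is stable under sl: Levi operators preserve the
    length of words, raising operators decrease it by one. *)
Lemma rep_gsum y : gsum i (rep_gl i m rho) v y.
Proof.
have gl := rep_gl_gl i m rep; have hv := rep_gl_hw ii rep hw.
have [U UP] := lclosed_vspace (gsum_lclosed i (rep_gl i m rho) v).
have [_ /(_ U)] := simple; case.
- move=> x xs; apply/subvP => _ /memv_imgP[z zU ->]; apply/UP.
  rewrite (rho_rep_gl i m) //.
  have [h0 hD] := gsum_lclosed i (rep_gl i m rho) v.
  have gD a b : gsum i (rep_gl i m rho) v a -> gsum i (rep_gl i m rho) v b ->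
      gsum i (rep_gl i m rho) v (a + b) by move=> ga gb; rewrite -[a]scale1r; apply: hD.
  apply: big_ind => // p _; apply: big_ind => // q _.
  rewrite -[_ *: _]addr0; apply: hD => //.
  by apply: (gsum_X gl hv); apply/UP.
- move=> U0; have : v \in U by apply/UP/(Gsum_word (d := 0))/Gword_v.
  by rewrite U0 memv0; have [[/negbTE-> _] _] := hw.
by move=> Uf; apply/UP; rewrite Uf memvf.
Qed.

End Generation.

(** * Graded spaces *)

Section GradedClasses.
Variables (K : fieldType) (V : vectType K) (F : nat -> {vspace V}).
Local Notation D := (\dim {:V}).

Lemma gr_class_linear (r : 'I_D.+1) : linear (gr_class F r).
Proof. by move=> c x y; rewrite /gr_class !linearP. Qed.

Lemma shift_linear (T : 'End(V)) : linear (@shift _ V T).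
Proof.
move=> c x y; apply/ffunP => r; rewrite !ffunE; case: eqP => _.
  by rewrite scaler0 addr0.
by rewrite linearP.
Qed.

Lemma gr_op0 (T : 'End(V)) : gr_op (F := F) T 0 = 0.
Proof.
rewrite /gr_op linear0 (_ : shift T 0 = 0) ?linear0 //.
by have := lin0 (shift_linear T).
Qed.

Lemma shift_max (T : 'End(V)) x : shift T (dsum_inj (ord_max : 'I_D.+1) x) = 0.
Proof.
apply/ffunP => r; rewrite !ffunE; case: eqP => // r0.
rewrite (_ : inord r.-1 == ord_max = false) ?linear0 //.
have := ltn_ord r; rewrite -val_eqE /= inordK; first lia.
by have := ltn_ord r; lia.
Qed.

Lemma gr_class_sum (g : {ffun 'I_D.+1 -> V}) :
  \sum_r gr_class F r (g r) = quot_pi (dsum D.+1 (lower F)) g.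
Proof.
rewrite -linear_sum; congr (quot_pi _ _); apply/ffunP => s.
rewrite sum_ffunE (bigD1 s) //= ffunE eqxx big1 ?addr0 // => r /negbTE ne.
by rewrite ffunE eq_sym ne.
Qed.

End GradedClasses.

Section Graded.
Variables (R : realType) (n i m : nat).
Local Notation C := R[i].
Local Notation M := 'M[C]_n.+1.
Local Notation S := {mpoly C[#|posroot n|]}.
Local Notation expn := {ffun posroot n -> nat}.
Variable f : posroot n -> M.
Hypothesis f_root : forall al, negroot_vector al (f al).
Variable w : 'S_n.+1.
Hypothesis w_min : w \in Wmin i.
Variables (V : vectType C) (rho : {linear M -> 'End(V)}) (v : V).
Hypothesis ii : (1 <= i <= n)%N.
Hypothesis rep : is_rep rho.
Hypothesis hw : is_highest_weight_vector rho (fun h => m%:R * omega i h) v.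
Implicit Types (al be : posroot n) (p q : S) (y : V).

Local Notation X := (rep_gl i m rho).
Local Notation pact := (pact (root_op i f X)).
Local Notation gword := (gword i X v).
Local Notation u := (nminus_of f w).
Local Notation F := (PBW rho u v).
Local Notation D := (\dim {:V}).
Local Notation ev := (sym_eval rho u v f).
Let glX := rep_gl_gl i m rep.
Let hwv := rep_gl_hw ii rep hw.
Let pactM := pactM (root_op_linear i f glX) (root_op_comm i f glX).

Lemma root_op_rho al y : al \in Rminus w -> root_op i f X al y = rho (f al) y.
Proof.
move=> /(Rminus_grid w_min) ga; rewrite /root_op ga (root_vectorE f_root) rhoZ.
by rewrite (rho_delta i m) // neq_ltn posrootP orbT.
Qed.

Lemma root_in_u al : al \in Rminus w -> f al \in u.
Proof. by move=> aw; apply/memv_span/imageP; exists al. Qed.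

Lemma monact_F (mu : 'X_{1..#|posroot n|}) :
    (forall al, al \notin Rminus w -> mu (enum_rank al) = 0%N) ->
  monact (root_op i f X) mu v \in F (mdeg mu).
Proof.
move=> mu0; have -> : mdeg mu = (\sum_(al <- enum (posroot n)) mu (enum_rank al))%N.
  rewrite mdegE big_enum [LHS](reindex (@enum_rank (posroot n))) //=.
  exact/onW_bij/enum_rank_bij.
rewrite /monact; elim: (enum _) => [|al r IH]; first by rewrite big_nil memv_line.
rewrite big_cons /=; have := mu0 al; elim: (mu _) => [|k IHk] h //.
have aw : al \in Rminus w by apply: contraT => /h.
rewrite addSn iterS root_op_rho //; apply: PBW_act; first exact: root_in_u.
by apply: IHk; rewrite aw.
Qed.

Lemma rho_gword x d y : x \in u -> gword d y -> gword d.+1 (rho x y).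
Proof.
move=> xu gy; apply: (span_lclosed (P := fun x => gword d.+1 (rho x y))) xu.
  split=> [|c a b ga gb]; first by rewrite linear0 lfunE; apply: Gword_0.
  by rewrite rho_lin; apply: Gword_lin.
by move=> al aw; rewrite -root_op_rho //; apply: root_op_gword.
Qed.

(** The filtration is the one by word length. *)
Lemma F_gword r y : y \in F r ->
  exists2 h : nat -> V, forall d, gword d (h d) & y = \sum_(d < r.+1) h d.
Proof.
pose P y := exists2 h : nat -> V, forall d, gword d (h d) & y = \sum_(d < r.+1) h d.
have [|U UP] := lclosed_vspace (P := P).
  split=> [|c x z [h1 g1 ->] [h2 g2 ->]].
    by exists (fun=> 0); [move=> d; apply: Gword_0 | rewrite big1].
  exists (fun d => c *: h1 d + h2 d); first by move=> d; apply: Gword_lin.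
  by rewrite scaler_sumr -big_split.
move=> yF; apply/UP; apply: subvP yF; apply: PBW_min => s su sr; apply/UP.
exists (fun d => if d == size s then foldr (fun x => rho x) v s else 0).
  move=> d; case: eqP => [->|_]; last exact: Gword_0.
  elim: s su {sr} => [|x s IH] su /=; first exact: Gword_v.
  apply: rho_gword; first by apply: su; rewrite mem_head.
  by apply: IH => z zs; apply: su; rewrite inE zs orbT.
rewrite (bigD1 (Ordinal (sr : (size s < r.+1)%N))) //= eqxx big1 ?addr0 // => d.
by rewrite -val_eqE /= => /negbTE->.
Qed.

Lemma gword_lower r y : gword r y -> y \in lower F r -> y = 0.
Proof.
move=> gy; case: r gy => [|r] gy; first by rewrite memv0 => /eqP.
move=> /F_gword[h gh ey].
pose z d := if d == r.+1 then - y else h d.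
have gz d : (d < r.+2)%N -> gword d (z d).
  by rewrite /z; case: eqP => [->|] _ //; rewrite -scaleN1r; apply: gwordZ.
have := gword_indep glX hwv gz; rewrite big_ord_recr /= {2}/z eqxx.
rewrite (eq_bigr (fun d : 'I_r.+1 => h d)) => [|d _]; last first.
  by rewrite /z ltn_eqF.
rewrite -ey subrr => /(_ erefl r.+1 (ltnSn _)); rewrite /z eqxx.
by move/eqP; rewrite oppr_eq0 => /eqP.
Qed.

Definition degcomp r p : V :=
  \sum_(mu <- msupp p | mdeg mu == r) p@_mu *: monact (root_op i f X) mu v.

Lemma degcomp_gword r p : gword r (degcomp r p).
Proof.
apply: gword_sum => mu /eqP <-; apply: gwordZ; rewrite -[mdeg mu]addn0.
exact/monact_gword/Gword_v.
Qed.

Lemma degcomp_F r p : in_Sw w p -> degcomp r p \in F r.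
Proof.
move=> hp; rewrite /degcomp big_seq_cond; apply: memv_suml => mu /andP[mup /eqP <-].
by apply/memvZ/monact_F => al aw; apply: hp mup al aw.
Qed.

Lemma pact_degcomp p : pact p v = \sum_(r < msize p) degcomp r p.
Proof.
rewrite /degcomp; under eq_bigr do rewrite big_mkcond.
rewrite exchange_big /= pactE big_seq [RHS]big_seq.
apply: eq_bigr => mu /msize_mdeg_lt lt.
rewrite (bigD1 (Ordinal lt)) //= eqxx big1 ?addr0 // => r.
by rewrite -val_eqE eq_sym /= => /negbTE->.
Qed.

Lemma pact_eq0 p : pact p v = 0 <-> forall r, degcomp r p = 0.
Proof.
split=> [e r|e]; last by rewrite pact_degcomp big1.
have [lt|le] := ltnP r (msize p).
  apply: (gword_indep glX hwv (y := fun r => degcomp r p)) lt => [d _|].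
    exact: degcomp_gword.
  by rewrite -pact_degcomp.
rewrite /degcomp big_seq_cond big1 // => mu /andP[/msize_mdeg_lt lt /eqP e'].
by rewrite e' ltnNge le in lt.
Qed.

(** The model of the graded space stops at degree dim V, and the operators
    kill its last component. *)
Lemma gr_word (mu : 'X_{1..#|posroot n|}) :
    (forall al, al \notin Rminus w -> mu (enum_rank al) = 0%N) ->
  foldr (fun al => iter (mu (enum_rank al)) (gr_op (rho (f al))))
     (gr_class F ord0 v) (enum (posroot n)) =
  if (mdeg mu <= D)%N then gr_class F (inord (mdeg mu)) (monact (root_op i f X) mu v)
  else 0.
Proof.
move=> mu0; have -> : mdeg mu = (\sum_(al <- enum (posroot n)) mu (enum_rank al))%N.
  rewrite mdegE big_enum [LHS](reindex (@enum_rank (posroot n))) //=.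
  exact/onW_bij/enum_rank_bij.
rewrite /monact; elim: (enum _) => [|al r IH] /=.
  by rewrite big_nil leq0n; congr (gr_class _ _ _); apply/val_inj; rewrite /= inordK.
rewrite big_cons IH; have := mu0 al; elim: (mu _) => [|k IHk] h //=.
have aw : al \in Rminus w by apply: contraT => /h.
have TF d y : y \in F d -> rho (f al) y \in F d.+1.
  exact/PBW_act/root_in_u.
rewrite IHk ?aw // addSn; set d := (k + _)%N; set y := iter k _ _.
case: (ltngtP d D) => [lt|gt|eq].
- rewrite (gr_op_class (r' := inord d.+1)) ?root_op_rho //.
  by rewrite !inordK // ltnS ltnW.
- by rewrite gr_op0.
rewrite /gr_class (_ : inord d = ord_max); last by apply/val_inj; rewrite /= inordK ?eq.
by rewrite gr_op_pi // shift_max linear0.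
Qed.

Lemma ev_degcomp p : in_Sw w p ->
  ev p = quot_pi (dsum D.+1 (lower F)) [ffun r : 'I_D.+1 => degcomp r p].
Proof.
move=> hp; rewrite -gr_class_sum /sym_eval /sym_act.
under [RHS]eq_bigr do rewrite ffunE /degcomp (lin_sum (gr_class_linear F _)) big_mkcond.
rewrite exchange_big /= big_seq [RHS]big_seq; apply: eq_bigr => mu mup.
rewrite gr_word; last by move=> al; apply: hp mup al.
case: ifP => [le|gt].
  rewrite (bigD1 (inord (mdeg mu))) //= inordK ?ltnS // eqxx.
  rewrite (linZ (gr_class_linear F _)) big1 ?addr0 // => r ne; case: eqP => // e.
  by case/eqP: ne; apply/val_inj; rewrite /= inordK ?ltnS.
rewrite scaler0 big1 // => r _; case: eqP => // e.
by have := ltn_ord r; rewrite -e ltnS gt.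
Qed.

(** On the symmetric algebra of n_w^-, passing to the graded space loses
    nothing, since the module is already graded by word length. *)
Lemma ev_eq0 p : in_Sw w p -> ev p = 0 <-> pact p v = 0.
Proof.
move=> hp; rewrite ev_degcomp // pact_eq0; split=> [/eqP|e]; last first.
  rewrite (_ : [ffun r => _] = 0) ?linear0 //; apply/ffunP => r.
  by rewrite !ffunE e.
rewrite quot_pi_eq0 => /mem_dsum low r.
have [rD|Dr] := leqP r D.
  have := low (Ordinal (rD : (r < D.+1)%N)); rewrite ffunE /=.
  exact/gword_lower/degcomp_gword.
apply: gword_lower (degcomp_gword r p) _; case: r Dr => // r Dr /=.
have := degcomp_F r.+1 hp; rewrite PBW_stationary ?(ltnW Dr) //.
by rewrite -(PBW_stationary rho u v (r := r)).
Qed.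

End Graded.

(** * Linear independence *)

Section LatticePoints.
Variables (R : realType) (n i m : nat) (w : 'S_n.+1).
Hypotheses (i0 : (0 < i)%N) (w_min : w \in Wmin i).
Local Notation expn := {ffun posroot n -> nat}.

Lemma lattice_pointP (s : expn) :
  lattice_point (chain_polytope R m i (ell i w)) s <-> normal_exp m w s.
Proof.
have inE al := in_poset_Rminus al i0 w_min.
split=> [[_ s0 sc]|[s0 sc]].
  have s0' al : al \notin Rminus w -> s al = 0%N.
    by rewrite -inE => /s0; rewrite ffunE => /eqP; rewrite pnatr_eq0 => /eqP.
  split=> // c cs; rewrite -(ler_nat R) natr_sum.
  have -> : \sum_(al <- c) (s al)%:R = \sum_(al <- c) [ffun al => (s al)%:R] al :> R.
    by apply: eq_bigr => al _; rewrite ffunE.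
  rewrite (sum_chain_filter (P := fun al => al \in Rminus w)) => [|al /s0' e].
    apply: sc; last exact: sorted_filter (@poset_gt_trans n) _ _ cs.
    by apply/allP => al; rewrite mem_filter inE => /andP[].
  by rewrite ffunE e.
split=> [al|al|c _ cs]; rewrite ?ffunE ?ler0n //.
  by rewrite inE => /s0->.
under eq_bigr do rewrite ffunE.
by rewrite -natr_sum ler_nat; apply: sc.
Qed.

Lemma normal_exp_le (s : expn) al : normal_exp m w s -> (s al <= m)%N.
Proof. by move=> [_ /(_ [:: al] isT)]; rewrite big_seq1. Qed.

(** All exponents of a lattice point are at most m. *)
Definition normal_list : seq expn :=
  [seq s <- [seq [ffun al => (t al : nat)] | t : {ffun posroot n -> 'I_m.+1}]
     | `[< normal_exp m w s >]].

Lemma normal_list_uniq : uniq normal_list.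
Proof.
apply/filter_uniq; rewrite map_inj_uniq ?enum_uniq // => t t' /ffunP e.
by apply/ffunP => al; apply/val_inj; have := e al; rewrite !ffunE.
Qed.

Lemma mem_normal_list s : s \in normal_list <-> normal_exp m w s.
Proof.
rewrite mem_filter; split=> [/andP[/asboolP]//|ns]; apply/andP; split; first exact/asboolP.
apply/imageP; exists [ffun al => inord (s al)] => //.
by apply/ffunP => al; rewrite !ffunE inordK // ltnS normal_exp_le.
Qed.

End LatticePoints.

Section Independence.
Variables (R : realType) (n i m : nat).
Local Notation C := R[i].
Local Notation M := 'M[C]_n.+1.
Local Notation S := {mpoly C[#|posroot n|]}.
Local Notation expn := {ffun posroot n -> nat}.
Variable f : posroot n -> M.
Hypothesis f_root : forall al, negroot_vector al (f al).
Variable w : 'S_n.+1.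
Hypothesis w_min : w \in Wmin i.
Variables (V : vectType C) (rho : {linear M -> 'End(V)}) (v : V).
Hypothesis ii : (1 <= i <= n)%N.
Hypothesis rep : is_rep rho.
Hypothesis hw : is_highest_weight_vector rho (fun h => m%:R * omega i h) v.
Implicit Types (al be : posroot n) (p q : S) (y : V).

Local Notation X := (rep_gl i m rho).
Local Notation pact := (pact (root_op i f X)).
Let glX := rep_gl_gl i m rep.
Let hwv := rep_gl_hw ii rep hw.
Let pactM := pactM (root_op_linear i f glX) (root_op_comm i f glX).

Lemma i_le : (i <= n.+1)%N. Proof. by have /andP[_ /leqW] := ii. Qed.

Local Notation Y := (tensor_op (F := C) (n := n) (i := i) (m := m)).
Local Notation t := (hw_tensor C m i_le).
Local Notation Z := (pair_op X Y).

Lemma fword_pair L (z : (V * tensor C n i m)%type) :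
  fword Z L z = (fword X L z.1, fword Y L z.2).
Proof. by elim: L => [|al L IH] /=; [case: z | rewrite IH]. Qed.

Lemma fword_gword_pair L : all (grid i) L ->
  gword i Z (v, t) (size L) (fword Z L (v, t)).
Proof.
elim: L => [_|al L IH] /=; first exact: Gword_v.
by move=> /andP[/andP[a1 a2] gL]; apply: Gword_X => //; apply: IH.
Qed.

(** Linear independence: a relation between the monomials of the lattice
    points holds in the tensor model as well, where it is evaluated at the
    leading state of a monomial with smallest corner sum. *)
Lemma normal_indep q :
    (forall mu, mu \in msupp q -> normal_exp m w (expo mu)) ->
  pact q v = 0 -> q = 0.
Proof.
move=> nq /(pact_eq0 f ii rep hw q) q0.
have [//|nz] := eqVneq q 0; exfalso.
have [mu0 mu0q] : exists mu, mu \in msupp q.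
  move: nz; rewrite -msupp_eq0; case: (msupp q) => // mu r _.
  by exists mu; rewrite mem_head.
pose P d := [exists k : 'I_(size (msupp q)), corner_sum i (expo (nth mu0 (msupp q) k)) == d].
have exP : exists d, P d.
  exists (corner_sum i (expo mu0)); apply/existsP.
  have lt : (index mu0 (msupp q) < size (msupp q))%N by rewrite index_mem.
  by exists (Ordinal lt); rewrite /= nth_index.
have [d /existsP[k /eqP ek] dmin] := ex_minnP exP.
set mu := nth mu0 (msupp q) k in ek.
have muq : mu \in msupp q by rewrite mem_nth.
have min nu : nu \in msupp q -> (corner_sum i (expo mu) <= corner_sum i (expo nu))%N.
  move=> nuq; rewrite ek; apply: dmin; apply/existsP.
  have lt : (index nu (msupp q) < size (msupp q))%N by rewrite index_mem.
  by exists (Ordinal lt); rewrite /= nth_index.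
have gnu nu : nu \in msupp q -> forall al, ~~ grid i al -> nu (enum_rank al) = 0%N.
  move=> nuq al ga; have [h _] := nq nu nuq; have := h al; rewrite ffunE; apply.
  by apply: contra ga => /(Rminus_grid w_min).
pose y : (V * tensor C n i m)%type := \sum_(nu <- msupp q | mdeg nu == mdeg mu)
   (q@_nu * coef_of f nu) *: fword Z (word_of nu) (v, t).
have size_word (nu : 'X_{1..#|posroot n|}) : size (word_of nu) = mdeg nu.
  rewrite /word_of size_flatten /shape -map_comp sumnE big_map big_enum mdegE.
  rewrite [RHS](reindex (@enum_rank (posroot n))) /=.
    by apply: eq_bigr => al _; rewrite size_nseq.
  exact/onW_bij/enum_rank_bij.
have gy : gword i Z (v, t) (mdeg mu) y.
  rewrite /y big_seq_cond; apply: gword_sum => nu /andP[nuq /eqP <-].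
  by rewrite -size_word; apply/gwordZ/fword_gword_pair/word_of_grid/gnu.
have y1 : y.1 = 0.
  rewrite -[RHS](q0 (mdeg mu)) /degcomp /y (raddf_sum fst) /= big_seq_cond [RHS]big_seq_cond.
  apply: eq_bigr => nu /andP[nuq _].
  by rewrite fword_pair /= (monact_fword _ glX) ?scalerA //; apply: gnu.
have y2 : y.2 = 0.
  have [[v0 _] _] := hw.
  apply: (transfer (B := @tensor_form C n i m) glX hwv v0 (tensor_gl _ _ _ _)
    (hw_tensorP C m i_le) (d := mdeg mu)).
  - exact: tensor_form0.
  - exact: tensor_form_lclosed.
  - exact: tensor_form_adj.
  - exact: tensor_form_def.
  by rewrite -y1 -surjective_pairing.
have [nmu1 nmu2] := nq mu muq.
have smu0 al : ~~ grid i al -> expo mu al = 0%N by rewrite ffunE; apply: gnu.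
have [sgm [sg1 sg2 sg3]] := antichain_decomposition nmu2 smu0.
have : y.2 (lead_state i_le sgm) = 0 by rewrite y2 ffunE.
rewrite /y (raddf_sum snd) /= sum_ffunE big_mkcond (bigD1_seq mu) //=.
rewrite eqxx big1_seq ?addr0 => [|nu /andP[numu nuq]].
  rewrite fword_pair /= ffunE => /eqP; rewrite scaler_eq0 mulf_eq0.
  rewrite (negbTE (coef_of_neq0 f_root mu)) orbF mcoeff_eq0 muq /=.
  have lg := word_of_grid (gnu mu muq).
  apply/negP; apply: (fword_lead_neq0 C i_le sg1 sg2 sg3 lg) => al ga.
  by rewrite count_word_of ffunE.
case: ifP => // _.
rewrite fword_pair /= ffunE; apply/eqP; rewrite scaler_eq0; apply/orP; right.
apply/negPn/negP => ne.
have cE : [ffun al => count_mem al (word_of nu)] = expo nu.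
  by apply/ffunP => al; rewrite !ffunE count_word_of.
have [e|] := fword_lead (F := C) (hi := i_le) sg1 sg2 sg3 (word_of_grid (gnu nu nuq)) ne; last first.
  by rewrite cE ltnNge min.
case/eqP: numu; rewrite -[nu]expoK -[mu]expoK; congr mono; rewrite -cE.
apply/ffunP => al; rewrite ffunE.
have [ga|ga] := boolP (grid i al); first exact: e.
by rewrite count_word_of (gnu nu nuq) // smu0.
Qed.

End Independence.

(** * Basis and relations *)

Lemma free_family (K : fieldType) (W : vectType K) (T : eqType) (L : seq T)
    (x : T -> W) : uniq L ->
    (forall k : T -> K, \sum_(s <- L) k s *: x s = 0 -> forall s, s \in L -> k s = 0) ->
  free [seq x s | s <- L].
Proof.
move=> uL ind; suff : free (map_tuple x (in_tuple L)) by [].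
apply/freeP => k k0 j.
have s0 := tnth (in_tuple L) j.
pose k' s := if insub (index s L) is Some j then k j else 0.
have kE (l : 'I_(size L)) : k' (tnth (in_tuple L) l) = k l.
  by rewrite /k' (tnth_nth s0) /= index_uniq // valK.
rewrite -kE; apply: ind; last exact: mem_tnth.
rewrite -[X in \sum_(s <- X) _]/(tval (in_tuple L)) big_tuple -[RHS]k0.
by apply: eq_bigr => l _; rewrite kE -tnth_nth tnth_map.
Qed.

Section Parts.
Variables (R : realType) (n i m : nat).
Local Notation C := R[i].
Local Notation M := 'M[C]_n.+1.
Local Notation S := {mpoly C[#|posroot n|]}.
Local Notation expn := {ffun posroot n -> nat}.
Variable f : posroot n -> M.
Hypothesis f_root : forall al, negroot_vector al (f al).
Variable w : 'S_n.+1.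
Hypothesis w_min : w \in Wmin i.
Variables (V : vectType C) (rho : {linear M -> 'End(V)}) (v : V).
Hypothesis ii : (1 <= i <= n)%N.
Hypothesis rep : is_rep rho.
Hypothesis hw : is_highest_weight_vector rho (fun h => m%:R * omega i h) v.
Implicit Types (al be : posroot n) (p q : S) (y : V).

Local Notation X := (rep_gl i m rho).
Local Notation pact := (pact (root_op i f X)).
Local Notation u := (nminus_of f w).
Local Notation F := (PBW rho u v).
Local Notation D := (\dim {:V}).
Local Notation ev := (sym_eval rho u v f).
Local Notation Ideal := (ideal_gen w
  (fun q => nplus_module f (root_powers w m) q /\ in_Sw w q)).
Let glX := rep_gl_gl i m rep.
Let hwv := rep_gl_hw ii rep hw.
Let pactM := pactM (root_op_linear i f glX) (root_op_comm i f glX).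
Let ev0 p (hp : in_Sw w p) := ev_eq0 f_root w_min ii rep hw hp.

Lemma ideal_null p : Ideal p -> pact p v = 0.
Proof.
move=> [r hr ->]; rewrite (lin_sum (pact_linear _ _)) big_seq big1 // => pq /hr[_ [np _]].
rewrite pactM (nplus_module_null f_root glX hwv _ np).
  exact: lin0 (pact_linearr (root_op_linear i f glX) _).
by move=> q [al /(Rminus_grid w_min) ga ->]; apply: pact_exp.
Qed.

Lemma normal_in_Sw q :
  (forall mu, mu \in msupp q -> normal_exp m w (expo mu)) -> in_Sw w q.
Proof.
by move=> nq mu /nq[h _] al /h; rewrite ffunE.
Qed.

Lemma ev_straighten p : in_Sw w p -> exists q,
  [/\ forall mu, mu \in msupp q -> normal_exp m w (expo mu), Ideal (p - q) & ev p = ev q].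
Proof.
move=> hp; have [q nq ipq] := straighten m f_root w_min hp.
exists q; split=> //; have hq := normal_in_Sw nq.
have hpq : in_Sw w (p - q).
  rewrite -[p]scale1r -scaleN1r addrC; have [h0 hD] := in_Sw_lclosed R w.
  by apply: hD => //; rewrite scale1r.
apply/eqP; rewrite -subr_eq0; apply/eqP.
rewrite -scaleN1r addrC -[ev p]/(linext _ p) -[ev q]/(linext _ q) -linext_linear.
rewrite scaleN1r addrC -[linext _ _]/(ev (p - q)).
exact/ev0/ideal_null.
Qed.

(** Straightening modulo the ideal leaves a combination of independent
    elements, which vanishes if its value does. *)
Theorem relations p : in_Sw w p -> (ev p = 0 <-> Ideal p).
Proof.
move=> hp; split=> [e|/ideal_null e]; last exact/ev0.
have [q [nq ipq epq]] := ev_straighten hp.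
suff q0 : q = 0 by rewrite q0 subr0 in ipq.
apply: (normal_indep f_root w_min ii rep hw nq).
by apply/ev0; [exact: normal_in_Sw | rewrite -epq].
Qed.

Lemma fmonE s : normal_exp m w s -> fmon R w s = 'X_[mono s].
Proof.
move=> [s0 _]; rewrite X_mono /fmon big_mkcond; apply: eq_bigr => al _.
by case: ifP => // /negbT/s0->; rewrite expr0.
Qed.

(** Words in n_w^- applied to v come from homogeneous elements of S(n_w^-). *)
Lemma word_poly (s : seq M) : {subset s <= u} -> exists p,
  [/\ in_Sw w p, forall mu, mu \in msupp p -> mdeg mu = size s
    & foldr (fun x => rho x) v s = pact p v].
Proof.
elim: s => [_|x s IH] /=.
  exists 1; split; rewrite ?pact1 //; first by rewrite -mpolyC1; apply: in_Sw_const.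
  by move=> mu; rewrite msupp1 inE => /eqP->; rewrite mdeg0.
move=> su; have [|p [hp dp ->]] := IH.
  by move=> z zs; apply: su; rewrite inE zs orbT.
have : x \in u by apply: su; rewrite mem_head.
apply: (span_lclosed (P := fun x => exists p', [/\ in_Sw w p',
   forall mu, mu \in msupp p' -> mdeg mu = (size s).+1 & rho x (pact p v) = pact p' v])).
  split=> [|c a b [p1 [h1 d1 e1]] [p2 [h2 d2 e2]]].
    exists 0; split=> [|mu|]; rewrite ?msupp0 //; first by case: (in_Sw_lclosed R w).
    by rewrite linear0 lfunE (lin0 (pact_linear _ _)).
  exists (c *: p1 + p2); split.
  - by case: (in_Sw_lclosed R w) => _; apply.
  - by move=> mu /msuppD_le; rewrite mem_cat => /orP[/msuppZ_le/d1|/d2].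
  by rewrite rho_lin e1 e2 pact_linear.
move=> al aw; exists (svar R al * p); split.
- by apply: in_SwM => //; apply: in_Sw_svar.
- move=> mu /msuppM_le/allpairsP[[m1 m2] /= [+ m2p ->]].
  by rewrite msuppX inE mdegD => /eqP->; rewrite mdeg1 (dp _ m2p).
by rewrite pactM pact_svar (root_op_rho m f_root w_min).
Qed.

Lemma ev_gr p : in_Sw w p -> ev p \in gr F.
Proof.
move=> hp; rewrite (ev_degcomp m f_root w_min) //; apply: memv_img.
by apply/mem_dsum => r; rewrite ffunE; apply: (degcomp_F m f_root w_min).
Qed.

Lemma gr_class_ev (r : 'I_D.+1) p : in_Sw w p ->
    (forall mu, mu \in msupp p -> mdeg mu = r) ->
  gr_class F r (pact p v) = ev p.
Proof.
move=> hp dp; rewrite (ev_degcomp m f_root w_min) // /gr_class; congr (quot_pi _ _).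
apply/ffunP => r'; rewrite !ffunE /degcomp; case: (eqVneq r' r) => [->|ne].
  rewrite pactE big_seq [RHS]big_seq_cond; apply: eq_bigl => mu.
  by case: (boolP (mu \in msupp p)) => // /dp->; rewrite eqxx.
rewrite big_seq_cond big1 // => mu /andP[/dp e /eqP e'].
by case/eqP: ne; apply/val_inj; rewrite /= -e -e'.
Qed.

(** Homogeneous elements of S(n_w^-) give all of the graded space, and
    straightening reduces them to lattice points. *)
Theorem monomial_basis :
  is_basis_family (lattice_point (chain_polytope R m i (ell i w)))
    (fun s => ev (fmon R w s)) (gr F).
Proof.
have /andP[i0 _] := ii; pose L := normal_list m w.
exists L; split=> [|s|].
- exact: normal_list_uniq.
- by rewrite lattice_pointP // mem_normal_list.
have LN s : s \in L -> normal_exp m w s by move=> /mem_normal_list.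
have nX s : normal_exp m w s ->
    forall mu, mu \in msupp ('X_[mono s] : S) -> normal_exp m w (expo mu).
  by move=> ns mu; rewrite msuppX inE => /eqP->; rewrite monoK.
have evX (mu : 'X_{1..#|posroot n|}) : ev 'X_[mu] = linext (fun mu => ev 'X_[mu]) 'X_[mu].
  by rewrite linextX.
have evE q : ev q = \sum_(mu <- msupp q) q@_mu *: ev 'X_[mu].
  apply: (mpoly_lclosed (P := fun q => ev q = linext (fun mu => ev 'X_[mu]) q)).
    have evl : linear ev := linext_linear _.
    split=> [|c p1 p2 e1 e2]; first by rewrite (lin0 evl) (lin0 (linext_linear _)).
    by rewrite evl linext_linear e1 e2.
  by move=> mu _; apply: evX.
rewrite /basis_of; apply/andP; split.
  set Sp := <<_>>%VS; have evSp q : (forall mu, mu \in msupp q -> normal_exp m w (expo mu)) ->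
      ev q \in Sp.
    move=> nq; rewrite evE big_seq; apply: memv_suml => mu /nq nmu.
    apply/memvZ/memv_span/mapP; exists (expo mu); first by apply/mem_normal_list.
    by rewrite fmonE // expoK.
  rewrite eqEsubv; apply/andP; split.
    apply/span_subvP => _ /mapP[s /LN ns ->]; apply: ev_gr.
    by rewrite fmonE //; apply/normal_in_Sw/nX.
  apply/subvP => _ /memv_imgP[g /mem_dsum gF ->]; rewrite -gr_class_sum.
  apply: memv_suml => r _; have [|U UP] := lclosed_vspace (P := fun y => gr_class F r y \in Sp).
    have gl := gr_class_linear F r.
    split=> [|c y z hy hz]; first by rewrite (lin0 gl) mem0v.
    by rewrite gl memvD // memvZ.
  apply/UP; apply: subvP (gF r); apply: PBW_min => s su sr; apply/UP.
  move: sr; rewrite leq_eqVlt => /orP[/eqP es|lt].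
    have [p [hp dp ->]] := word_poly su.
    rewrite gr_class_ev // => [|mu /dp ->]; last by rewrite es.
    by have [q [nq _ ->]] := ev_straighten hp; apply: evSp.
  rewrite (_ : gr_class _ _ _ = 0) ?mem0v //; apply/eqP; rewrite gr_class_eq0.
  by case: (nat_of_ord r) lt => // r'; rewrite ltnS => le; apply: PBW_word.
apply: free_family; first exact: normal_list_uniq.
move=> k k0 s sL; pose q : S := \sum_(s <- L) k s *: 'X_[mono s].
have nq mu : mu \in msupp q -> normal_exp m w (expo mu).
  move: mu; rewrite /q big_seq; apply: (big_ind (fun q : S =>
    forall mu, mu \in msupp q -> normal_exp m w (expo mu))) => [mu|p1 p2 h1 h2 mu|t tL mu].
  - by rewrite msupp0.
  - by move=> /msuppD_le; rewrite mem_cat => /orP[/h1|/h2].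
  - by move=> /msuppZ_le/(nX _ (LN _ tL)).
have evq : ev q = 0.
  rewrite -[RHS]k0 /q; have evl : linear ev := linext_linear _.
  rewrite (lin_sum evl) big_seq [RHS]big_seq; apply: eq_bigr => t /LN nt.
  by rewrite (linZ evl) fmonE.
have q0 : q = 0.
  by apply: (normal_indep f_root w_min ii rep hw nq); apply/ev0; first exact: normal_in_Sw.
have := congr1 (fun q : S => q@_(mono s)) q0.
rewrite mcoeff0 /q linear_sum /= (bigD1_seq s) ?normal_list_uniq //=.
rewrite mcoeffZ mcoeffX eqxx mulr1 big1 ?addr0 // => t ts.
by rewrite mcoeffZ mcoeffX (can_eq (@monoK n)) (negbTE ts) mulr0.
Qed.

End Parts.

(** * Demazure modules *)

Section Twist.
Variables (R : realType) (n i m : nat).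
Local Notation C := R[i].
Local Notation M := 'M[C]_n.+1.
Variable f : posroot n -> M.
Hypothesis f_root : forall al, negroot_vector al (f al).
Variable w : 'S_n.+1.
Hypothesis w_min : w \in Wmin i.
Variable g : M.
Hypothesis g_lift : is_lift g w.
Variables (V : vectType C) (rho : {linear M -> 'End(V)}) (v vw : V).
Hypothesis ii : (1 <= i <= n)%N.
Hypothesis rep : is_rep rho.
Hypothesis simple : is_simple_module rho.
Hypothesis hw : is_highest_weight_vector rho (fun h => m%:R * omega i h) v.
Hypothesis wt : is_weight_vector rho (weyl_wt w (fun h => m%:R * omega i h)) vw.
Implicit Types (al be : posroot n) (x h : M) (y z : V).

Let gU : g \in unitmx. Proof. by case: g_lift. Qed.

(** An automorphism of sl that induces w on the Cartan subalgebra. *)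
Definition conj_lift x : M := g *m x *m invmx g.

Definition twist : {linear M -> 'End(V)} :=
  (rho \o (mulmxr (invmx g) \o mulmx g))%FUN.

Lemma twistE x : twist x = rho (conj_lift x). Proof. by []. Qed.

Definition unconj x : M := invmx g *m x *m g.

Lemma conjK : cancel unconj conj_lift.
Proof. by move=> x; rewrite /conj_lift /unconj !mulmxA mulmxV // mul1mx mulmxK. Qed.

Lemma unconjK : cancel conj_lift unconj.
Proof. by move=> x; rewrite /conj_lift /unconj !mulmxA mulVmx // mul1mx mulmxKV. Qed.

Lemma conj_lie x x' : lie (conj_lift x) (conj_lift x') = conj_lift (lie x x').
Proof.
by rewrite /lie /conj_lift mulmxBr mulmxBl !mulmxA !(mulmxKV gU).
Qed.

Lemma conj_sl x : (conj_lift x \in sl n R) = (x \in sl n R).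
Proof. by rewrite !mem_sl /conj_lift mxtrace_mulC mulmxA mulVmx // mul1mx. Qed.

Lemma unconj_sl x : (unconj x \in sl n R) = (x \in sl n R).
Proof. by rewrite -conj_sl conjK. Qed.

Lemma cartan_sl h : h \in cartan n R -> h \in sl n R.
Proof. by rewrite memv_cap => /andP[]. Qed.

Lemma cartan_mxsub (u : 'S_n.+1) h : h \in cartan n R -> mxsub u u h \in cartan n R.
Proof.
move=> hc; have -> : mxsub u u h = \sum_a h (u a) (u a) *: delta_mx a a.
  apply/matrixP => a b; rewrite summxE mxE (bigD1 a) //= !mxE eqxx /= big1 ?addr0.
    case: (eqVneq b a) => [->|ba]; rewrite ?mulr1 ?mulr0 // (cartan_mxE hc) //.
    by rewrite (inj_eq perm_inj) eq_sym.
  by move=> c ca; rewrite !mxE eq_sym (negbTE ca) mulr0.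
apply: cartan_diag; have := cartan_sl hc; rewrite mem_sl => /eqP e.
by rewrite -[RHS]e /mxtrace [RHS](reindex_inj (@perm_inj _ u)).
Qed.

Lemma unconj_cartan h : h \in cartan n R -> unconj h = mxsub w w h.
Proof. by case: g_lift => _; apply. Qed.

Lemma conj_cartan h : h \in cartan n R -> conj_lift h = mxsub (w^-1)%g (w^-1)%g h.
Proof.
move=> hc; apply: (can_inj conjK); rewrite unconjK unconj_cartan ?cartan_mxsub //.
by apply/matrixP => a b; rewrite !mxE !permK.
Qed.

(** Conjugation by g maps the root space of (p, q) to the one of (w p, w q). *)
Lemma conj_delta (p q : 'I_n.+1) : p != q ->
  conj_lift (delta_mx p q) =
  conj_lift (delta_mx p q) (w p) (w q) *: delta_mx (w p) (w q).
Proof.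
move=> pq; apply: root_space => [|h hc]; first by rewrite (inj_eq perm_inj).
rewrite -[h]conjK conj_lie unconj_cartan //.
have -> : lie (mxsub w w h) (delta_mx p q) = (h (w p) (w p) - h (w q) (w q)) *: delta_mx p q.
  have hc' := cartan_mxsub w hc; apply/matrixP => a b; rewrite !mxE.
  rewrite (bigD1 a) //= big1 ?addr0 => [|c ca]; last first.
    by rewrite (cartan_mxE hc') ?mul0r // eq_sym.
  rewrite (bigD1 b) //= big1 ?addr0 => [|c cb]; last first.
    by rewrite (cartan_mxE hc') ?mulr0.
  rewrite !mxE; case: (eqVneq a p) => [->|_]; case: (eqVneq b q) => [->|_];
  by rewrite /= ?mulr0 ?mul0r ?subrr ?mulr1 ?mul1r.
by rewrite /conj_lift -scalemxAr -scalemxAl -/(conj_lift _) -[mxsub w w h]unconj_cartan // conjK.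
Qed.

Lemma twist_rep : is_rep twist.
Proof.
move=> x y xs ys z; rewrite !twistE -conj_lie.
by apply: rep; rewrite conj_sl.
Qed.

Local Notation X := (rep_gl i m rho).
Local Notation Y := (rep_gl i m twist).

(** The weights obtained from that of vw by adding the root of (w p, w q),
    p < q, have an entry outside of [0, m]. *)
Lemma twist_hw : is_highest_weight_vector twist (fun h => m%:R * omega i h) vw.
Proof.
have [vw0 hwt] := wt; have gl := rep_gl_gl i m rep.
split.
  split=> // h hc; rewrite twistE conj_cartan // hwt ?cartan_mxsub //.
  by rewrite /weyl_wt; congr (_ * omega i _ *: _); apply/matrixP => a b; rewrite !mxE !permK.
move=> x; apply: (span_lclosed (P := fun x => twist x vw = 0)) => [|al _].
  split=> [|c a b ea eb]; first by rewrite linear0 lfunE.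
  by rewrite linearP add_lfunE scale_lfunE ea eb scaler0 addr0.
move: (val al).1 (val al).2 (posrootP al) => p q pq.
have npq : p != q by rewrite -val_eqE ltn_eqF.
have nwpq : w p != w q by rewrite (inj_eq perm_inj).
rewrite twistE conj_delta // rhoZ (rho_delta i m) // [X in _ *: X](_ : _ = 0) ?scaler0 //.
have Xd r := rep_gl_weight ii r wt.
have gs := rep_gsum ii rep simple hw (X (w p) (w q) vw).
have wb := weight_bound f_root ii gl (rep_gl_hw ii rep hw) gs.
have [pi|ip] := ltnP p i.
  apply: (wb (w p) m.+1%:R) => [|k km]; last by rewrite eqr_nat gtn_eqF.
  rewrite (glC gl) Xd permK pi muln1 (glZ gl) eqxx scale1r eq_sym (negbTE nwpq).
  by rewrite scale0r subr0 -[in RHS]addn1 natrD scalerDl scale1r.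
apply: (wb (w q) (-1)) => [|k km].
  rewrite (glC gl) Xd permK [(q < i)%N]ltnNge (leq_trans ip (ltnW pq)) /= muln0 scale0r (gl0 gl).
  by rewrite eq_sym (negbTE nwpq) scale0r eqxx scale1r !add0r scaleN1r.
by rewrite eq_sym -addr_eq0 natr1 pnatr_eq0.
Qed.

(** ** The two filtrations *)

Local Notation u := (nminus_of f w).
Local Notation F := (PBW twist u vw).
Let glY := rep_gl_gl i m twist_rep.
Let hwY := rep_gl_hw ii twist_rep twist_hw.

Lemma twist_F_ind r (P : V -> Prop) y : lclosed P ->
    (forall y, y \in F r -> P y) ->
    (forall al y, al \in Rminus w -> y \in F r -> P (Y (val al).2 (val al).1 y)) ->
  y \in F r.+1 -> P y.
Proof.
move=> cP h1 h2; have [U UP] := lclosed_vspace cP => yF; apply/UP.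
apply: subvP yF => /=; rewrite subv_add; apply/andP; split.
  by apply/subvP => z /h1/UP.
rewrite big_seq; elim/big_ind: _ => [|A B AU BU|x /vbasis_mem xu].
- exact: sub0v.
- by rewrite subv_add AU.
apply/subvP => _ /memv_imgP[z zF ->]; apply/UP.
apply: (span_lclosed (P := fun x => P (twist x z))) xu => [|al aw].
  case: cP => P0 PD; split=> [|c a b Pa Pb]; first by rewrite linear0 lfunE.
  by rewrite linearP add_lfunE scale_lfunE; apply: PD.
rewrite (root_vectorE f_root) rhoZ (rho_delta i m) ?neq_ltn ?posrootP ?orbT //.
by case: cP => P0 PD; rewrite -[_ *: _]addr0; apply: PD => //; apply: h2.
Qed.

Lemma F_up r al y : al \in Rminus w -> y \in F r -> Y (val al).2 (val al).1 y \in F r.+1.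
Proof.
move=> aw yF; have : twist (f al) y \in F r.+1.
  by apply: PBW_act yF; apply/memv_span/imageP; exists al.
rewrite (root_vectorE f_root) rhoZ (rho_delta i m) ?neq_ltn ?posrootP ?orbT //.
by rewrite rpredZeq (negbTE (root_coef_neq0 f_root al)).
Qed.

(** Operators of w^-1(b) other than those of n_w^- preserve the filtration of
    n_w^-: their commutators with n_w^- belong to w^-1(b) again. *)
Lemma F_stable r (p q : 'I_n.+1) y :
    (p == q) || ((p < q)%N && (w p < w q)%N) -> y \in F r -> Y p q y \in F r.
Proof.
elim: r p q y => [|r IH] p q y pq.
  move=> /vlineP[c ->]; rewrite (glZ glY) hwY; first by rewrite !memvZ ?memv_line.
  by move: pq => /orP[/eqP->|/andP[lt _]]; rewrite negb_and -ltnNge -leqNgt; lia.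
have good (p' q' : 'I_n.+1) z : (w p' < w q')%N -> z \in F r -> Y p' q' z \in F r.+1.
  move=> lt zF; case: (ltngtP p' q') => [lt'|gt|/val_inj e].
  - by apply: (subvP (PBW_le _ _ _ (leqnSn r))); apply: IH; rewrite ?lt' ?lt ?orbT.
  - by apply: (F_up (al := mkroot gt)) zF; rewrite inE.
  - by rewrite e ltnn in lt.
apply: (twist_F_ind (P := fun y => Y p q y \in F r.+1)) => [|z zF|al z aw zF].
- split=> [|c a b ha hb]; first by rewrite (gl0 glY) mem0v.
  by rewrite (glP glY) memvD // memvZ.
- by apply: (subvP (PBW_le _ _ _ (leqnSn r))); apply: IH.
have wab : (w (val al).2 < w (val al).1)%N by move: aw; rewrite inE.
have wpq : (w p <= w q)%N by case/orP: pq => [/eqP-> //|/andP[_ /ltnW]].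
rewrite (glC glY); apply: memvB; first apply: memvD.
- by apply: (F_up aw); apply: IH.
- case: eqP => [e|_]; last by rewrite scale0r mem0v.
  by apply/memvZ/good => //; apply: leq_ltn_trans wpq _; rewrite e.
- case: eqP => [e|_]; last by rewrite scale0r mem0v.
  by apply/memvZ/good => //; apply: leq_trans wpq; rewrite -e.
Qed.

Lemma borel_F x r y : x \in borel -> y \in F r -> rho x y \in F r.+1.
Proof.
move=> /memv_addP[h hc [x' xn ->]] yF; rewrite linearD add_lfunE memvD //.
  have hs : unconj h \in sl n R by rewrite unconj_sl cartan_sl.
  rewrite -[h]conjK -twistE (rho_rep_gl i m twist y hs).
  rewrite unconj_cartan //; have hc' := cartan_mxsub w hc.
  apply: memv_suml => p _; apply: memv_suml => q _.
  case: (eqVneq p q) => [->|pq]; last by rewrite (cartan_mxE hc' pq) scale0r mem0v.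
  apply/memvZ/(subvP (PBW_le _ _ _ (leqnSn r))).
  by apply: F_stable => //; rewrite eqxx.
apply: (span_lclosed (P := fun x => rho x y \in F r.+1)) xn => [|al _].
  split=> [|c a b ha hb]; first by rewrite linear0 lfunE mem0v.
  by rewrite linearP add_lfunE scale_lfunE memvD // memvZ.
move: (val al).1 (val al).2 (posrootP al) => c d cd.
pose p := (w^-1)%g c; pose q := (w^-1)%g d.
have wp : w p = c by rewrite permKV.
have wq : w q = d by rewrite permKV.
have pq : p != q by rewrite (inj_eq perm_inj) -val_eqE ltn_eqF.
have nz : conj_lift (delta_mx p q) c d != 0.
  apply/eqP => e; have := conj_delta pq; rewrite wp wq e scale0r => e0.
  have := congr1 unconj e0; rewrite unconjK /unconj mulmx0 mul0mx => /matrixP/(_ p q)/eqP.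
  by rewrite !mxE !eqxx oner_eq0.
have -> : delta_mx c d = (conj_lift (delta_mx p q) c d)^-1 *: conj_lift (delta_mx p q).
  by rewrite [X in _ = _ *: X](conj_delta pq) wp wq scalerA mulVf ?scale1r.
rewrite rhoZ memvZ // -twistE (rho_delta i m) //.
case: (ltngtP p q) => [lt|gt|/val_inj e]; last by rewrite e eqxx in pq.
  apply: (subvP (PBW_le _ _ _ (leqnSn r))); apply: F_stable => //.
  by rewrite lt wp wq cd orbT.
by apply: (F_up (al := mkroot gt)); rewrite // inE /= wp wq.
Qed.

Lemma conj_u x : x \in u -> conj_lift x \in borel.
Proof.
apply: (span_lclosed (P := fun x => conj_lift x \in borel)) => [|al aw].
  have lc : linear conj_lift.
    by move=> c a b; rewrite /conj_lift mulmxDr mulmxDl -scalemxAr -scalemxAl.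
  split=> [|c a b ha hb]; first by rewrite (lin0 lc) mem0v.
  by rewrite lc memvD // memvZ.
rewrite (root_vectorE f_root) /conj_lift -scalemxAr -scalemxAl -/(conj_lift _).
rewrite memvZ // conj_delta ?neq_ltn ?posrootP ?orbT // memvZ //.
apply: (subvP (addvSr _ _)); apply: memv_span; apply/imageP.
have lt : (w (val al).2 < w (val al).1)%N by move: aw; rewrite inE.
by exists (mkroot lt).
Qed.

(** Words in n_w^- are words in w^-1(b); the converse is borel_F. *)
Lemma PBW_twist : PBW rho borel vw = F.
Proof.
apply: funext => r; apply/eqP; rewrite eqEsubv; apply/andP; split.
  apply: PBW_min => s sb sr; apply: (subvP (PBW_le _ _ _ sr)).
  elim: s sb {sr} => [|x s IH] sb /=; first exact: memv_line.
  apply: borel_F; first by apply: sb; rewrite mem_head.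
  by apply: IH => z zs; apply: sb; rewrite inE zs orbT.
apply: PBW_min => s su sr.
have -> : foldr (fun x => twist x) vw s = foldr (fun x => rho x) vw (map conj_lift s).
  by rewrite foldr_map.
apply: PBW_word; rewrite ?size_map // => _ /mapP[x /su xu ->].
exact: conj_u.
Qed.

Theorem demazure_basis :
  is_basis_family (lattice_point (chain_polytope R m i (ell i w)))
    (fun s => sym_eval rho borel vw (fun al => g *m f al *m invmx g) (fmon R w s))
    (gr (PBW rho borel vw)).
Proof.
have := monomial_basis f_root w_min ii twist_rep twist_hw.
by rewrite /sym_eval PBW_twist.
Qed.

End Twist.

(** * The theorem *)

Theorem mainTheorem1 (R : realType) (n i : nat) (w : 'S_n.+1) (m : nat)
    (f : posroot n -> 'M[R[i]]_n.+1) (g : 'M[R[i]]_n.+1)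
    (V : vectType R[i]) (rho : {linear 'M[R[i]]_n.+1 -> 'End(V)})
    (v vw : V) :
    (1 <= i <= n)%N ->
    w \in Wmin i ->
    (* f al is a root vector of root - al, and g is a lift of w *)
    (forall al, negroot_vector al (f al)) ->
    is_lift g w ->
    (* V = V(m omega_i), v = v_m, vw = v_(w(m omega_i)) *)
    is_rep rho ->
    is_simple_module rho ->
    is_highest_weight_vector rho (fun h => m%:R * omega i h) v ->
    is_weight_vector rho (weyl_wt w (fun h => m%:R * omega i h)) vw ->
  [/\
    is_basis_family (lattice_point (chain_polytope R m i (ell i w)))
      (fun s => sym_eval rho (nminus_of f w) v f (fmon R w s))
      (gr (PBW rho (nminus_of f w) v)),

    forall p : {mpoly R[i][#|posroot n|]}, in_Sw w p ->
      (sym_eval rho (nminus_of f w) v f p = 0 <->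
       ideal_gen w
         (fun q => nplus_module f (root_powers w m) q /\ in_Sw w q) p),

    is_basis_family (lattice_point (chain_polytope R m i (ell i w)))
      (fun s => sym_eval rho borel vw
                  (fun al => g *m f al *m invmx g) (fmon R w s))
      (gr (PBW rho borel vw)),

    forall tau : 'S_n.+1, tau \in Wmin i -> bruhat_le w tau ->
      is_face (n := n) (chain_polytope R m i (ell i w))
              (chain_polytope R m i (ell i tau))
  & forall w0 wl : 'S_n.+1, is_longest wl -> w0 \in Wmin i ->
      same_coset i w0 wl ->
      forall s : {ffun posroot n -> R},
        chain_polytope R m i (ell i w0) s <-> BD_polytope R m i s].
Proof.
move=> ii wm f_root gl rep simple hw wt; have /andP[i0 _] := ii; split.
- exact: (monomial_basis f_root wm ii rep hw).
- exact: (relations f_root wm ii rep hw).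
- exact: (demazure_basis f_root wm gl ii rep simple hw wt).
- move=> tau tm wt'; apply: chain_polytope_face => //.
  exact: (Rminus_bruhat wm tm wt').
- move=> w0 wl lw w0m sc s; apply: chain_polytope_full => // al ga.
  exact: (Rminus_longest lw sc ga).
Qed.
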